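(* For every $a\in\mathbb{C}$ such that neither $a+\frac14$ nor $a+\frac34$ is a non-positive integer, $${}_3F_2\Bigl(a,\,a+\tfrac12,\,\tfrac{4a+1}{6};\ a+\tfrac14,\,a+\tfrac34\,\Big|\,\tfrac34\Bigr)=\frac{\Gamma\bigl(\frac{5-4a}{6}\bigr)\,\Gamma\bigl(\frac{1+2a}{6}\bigr)\,\Gamma\bigl(1+\frac a3\bigr)}{2^{2-2a}\sqrt{\pi}\;\Gamma\bigl(\frac12-2a\bigr)\,\Gamma(1+2a)\,\cos\frac{2\pi a}{3}\,\cos\frac{\pi(1+2a)}{3}},$$ where the right-hand side is understood by continuity at its removable singularities.
   Context: ${}_3F_2(a_1,a_2,a_3;b_1,b_2\,|\,w)=\sum_{n\ge0}\frac{(a_1)_n(a_2)_n(a_3)_n}{(b_1)_n(b_2)_n}\frac{w^n}{n!}$ for $|w|<1$, where $(a)_n=a(a+1)\cdots(a+n-1)$. *)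

(* Defs.v *)
(* Classical reals of Stdlib, with Coquelicot's complex numbers [C]. *)
From Stdlib Require Export Reals Factorial.
From Coquelicot Require Export Coquelicot.
Open Scope C_scope.

Fixpoint pochhammer (a : C) (n : nat) : C :=
  match n with
  | O => 1
  | S m => pochhammer a m * (a + INR m)
  end.

Definition hyp3F2_term (a1 a2 a3 b1 b2 w : C) (n : nat) : C :=
  pochhammer a1 n * pochhammer a2 n * pochhammer a3 n
    / (pochhammer b1 n * pochhammer b2 n) * (w ^ n / INR (fact n)).

(* Meaningful only when the series converges, like [Series] on [R]. *)
Definition hyp3F2 (a1 a2 a3 b1 b2 w : C) : C :=
  @iota C_CompleteNormedModule
    (@is_series C_AbsRing C_NormedModule (hyp3F2_term a1 a2 a3 b1 b2 w)).

Definition Cexp (z : C) : C :=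
  (exp (Re z) * cos (Im z), exp (Re z) * sin (Im z))%R.

Definition Ccos (z : C) : C := (Cexp (Ci * z) + Cexp (- (Ci * z))) / 2.

(* Principal value of [x ^ z]; intended for [0 < x]. *)
Definition Rpow_C (x : R) (z : C) : C := Cexp (z * ln x).

Definition nonpos_int (z : C) : Prop := exists k : nat, z = - INR k.

(* Gauss's definition, valid on the whole domain of Gamma:
   Gamma z = lim_n  n! n^z / (z (z+1) ... (z+n)).
   Meaningful only for [z] outside [nonpos_int]. *)
Definition CGamma (z : C) : C :=
  @iota C_CompleteNormedModule (fun l : C =>
    filterlim
      (fun n : nat => INR (fact n) * Rpow_C (INR n) z / pochhammer z (S n))
      eventually (@locally C_UniformSpace l)).

(* [v] is the value at [z] of the expression [f], where [D] is the set of
   points at which [f] makes sense as written; at the other points [f] is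
   understood by continuity. The complement of [D] should be discrete, so that
   a punctured neighbourhood of [z] only sees genuine values of [f]. *)
Definition value_by_continuity (D : C -> Prop) (f : C -> C) (z v : C) : Prop :=
  (D z -> v = f z) /\
  (~ D z -> filterlim f (@locally' C_UniformSpace z) (@locally C_UniformSpace v)).

Definition closed_form (a : C) : C :=
  CGamma ((5 - 4 * a) / 6) * CGamma ((1 + 2 * a) / 6) * CGamma (1 + a / 3)
  / (Rpow_C 2 (2 - 2 * a) * sqrt PI * CGamma (1 / 2 - 2 * a) * CGamma (1 + 2 * a)
     * Ccos (2 * PI * a / 3) * Ccos (PI * (1 + 2 * a) / 3)).

(* All five Gamma factors are at points where Gamma is defined, and the cosines
   in the denominator do not vanish. *)
Definition closed_form_regular (a : C) : Prop :=
  ~ nonpos_int ((5 - 4 * a) / 6) /\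
  ~ nonpos_int ((1 + 2 * a) / 6) /\
  ~ nonpos_int (1 + a / 3) /\
  ~ nonpos_int (1 / 2 - 2 * a) /\
  ~ nonpos_int (1 + 2 * a) /\
  Ccos (2 * PI * a / 3) <> 0 /\
  Ccos (PI * (1 + 2 * a) / 3) <> 0.

(* Main.v *)
Require Import Defs.
From Stdlib Require Import Lra Lia.

(* Let S(a) be the sum and c = (4a+1)/6. A Wilf-Zeilberger certificate gives a first order
   recurrence S(a+3) = r(a) S(a) with r rational, so S(a) is the limit of S(a+3N) divided by
   r(a) r(a+3) ... r(a+3N-3), a quotient of Pochhammer symbols that Gauss's product formula
   turns into Gamma factors. The n-th term of S(a+3N) is the negative binomial weight
   (c+2N)_n (3/4)^n / n!, of total mass 4^(c+2N), times
   (2a+6N)_{2n} / (2a+6N+1/2)_{2n}, which is close to (1 + n/(3N))^(-1/2). The weights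
   concentrate at n = 6N, whence S(a+3N) / 16^N tends to 4^c / sqrt 3. This evaluates S(a) for
   every admissible a; the reflection formula and
   cos 3x = 4 cos x cos (x + pi/3) cos (x - pi/3) turn the value into the stated closed form,
   and since S is continuous the singular points of the closed form are removable. *)

(** * Limits of complex sequences *)

(** The step is 3 because c moves by 2/3 when [a] moves by 1, and only an integral shift of c
    compares Pochhammer symbols; [a + 3] gives [c + 2]. The factor r has poles at admissible points,
    for instance at a = -1, where S vanishes. Hence the recurrence and its iterates are kept in
    product form, and Gamma enters through its reciprocal [rGamma], which is defined everywhere. The
    resulting identity for S has no exceptional point besides the inadmissible ones; Gamma values
    are divided out only where the closed form is regular. The value 6N is the mean 3 (2N) of the
    negative binomial law with parameters 2N and 1/4, and 1 + n/(3N) = 3 at n = 6N yields the factor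
    1/sqrt 3. For complex c the weights are complex. They are dominated by the positive weights with
    parameter |c + 2N|, whose total mass exceeds the scale 16^N by at most the constant factor
    4^|c|, so a Chebyshev estimate with the second moment still applies. Derivatives and integrals
    of complex functions are handled through real and imaginary parts. *)

Definition Clim (u : nat -> C) (l : C) : Prop :=
  is_lim_seq (fun n => Cmod (u n - l)) 0%R.

Lemma Clim_eps u l :
  Clim u l <->
  (forall eps : posreal, exists N, forall n, (N <= n)%nat -> (Cmod (u n - l) < eps)%R).
Proof.
unfold Clim; rewrite <- is_lim_seq_spec; split; intros H eps; destruct (H eps) as [N HN];
  exists N; intros n Hn; specialize (HN n Hn); simpl in *;
  rewrite Rminus_0_r, Rabs_pos_eq in *; auto using Cmod_ge_0.
Qed.

(** Balls of [C_UniformSpace] are boxes in the real and imaginary parts. A box of radius r lies in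
    the disc of radius r sqrt 2, which accounts for the [sqrt 2]. *)
Lemma Clim_filterlim u l :
  filterlim u eventually (@locally C_UniformSpace l) <-> Clim u l.
Proof.
rewrite Clim_eps; split.
- intros H eps.
  assert (H2 : 0 < eps / sqrt 2).
  { apply Rdiv_lt_0_compat; [apply cond_pos | apply sqrt_lt_R0; lra]. }
  destruct (H (fun y => ball (l : C_UniformSpace) (mkposreal _ H2) y)) as [N HN].
  { exists (mkposreal _ H2); auto. }
  exists N; intros n Hn.
  specialize (HN n Hn).
  apply C_NormedModule_mixin_compat2 in HN; simpl in HN.
  replace (sqrt 2 * (eps / sqrt 2))%R with (pos eps) in HN.
  + exact HN.
  + field; apply Rgt_not_eq, sqrt_lt_R0; lra.
- intros H P [eps HP].
  destruct (H eps) as [N HN].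
  exists N; intros n Hn; apply HP.
  apply C_NormedModule_mixin_compat1, HN, Hn.
Qed.

Lemma Clim_unique u l1 l2 : Clim u l1 -> Clim u l2 -> l1 = l2.
Proof.
intros H1 H2.
apply Ceq_minus, Cmod_eq_0.
assert (H : is_lim_seq (fun _ => Cmod (l1 - l2)) 0).
{ apply is_lim_seq_le_le with (u := fun _ => 0%R)
    (w := fun n => (Cmod (u n - l1) + Cmod (u n - l2))%R).
  - intros n; split; [apply Cmod_ge_0|].
    replace (l1 - l2) with (- (u n - l1) + (u n - l2)) by ring.
    eapply Rle_trans; [apply Cmod_triangle|]. rewrite Cmod_opp; lra.
  - apply is_lim_seq_const.
  - evar_last; [apply is_lim_seq_plus'; [exact H1 | exact H2]|]. simpl; f_equal; lra. }
apply is_lim_seq_unique in H. rewrite Lim_seq_const in H. congruence.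
Qed.

Lemma Clim_dominated u l (v : nat -> R) :
  (exists N, forall n, (N <= n)%nat -> (Cmod (u n - l) <= v n)%R) ->
  is_lim_seq v 0%R -> Clim u l.
Proof.
intros [N HN] Hv.
apply is_lim_seq_le_le_loc with (u := fun _ => 0%R) (w := v).
- exists N; intros n Hn; split; [apply Cmod_ge_0 | auto].
- apply is_lim_seq_const.
- exact Hv.
Qed.

Lemma Clim_ext_loc u v l :
  (exists N, forall n, (N <= n)%nat -> u n = v n) -> Clim u l -> Clim v l.
Proof.
intros [N HN] H. eapply is_lim_seq_ext_loc; [|exact H].
exists N; intros n Hn; simpl; now rewrite HN.
Qed.

Lemma Clim_ext u v l : (forall n, u n = v n) -> Clim u l -> Clim v l.
Proof. intros H; apply Clim_ext_loc; exists O; auto. Qed.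

Lemma Clim_const l : Clim (fun _ => l) l.
Proof.
unfold Clim. apply is_lim_seq_ext with (fun _ => 0%R); [|apply is_lim_seq_const].
intros _. replace (l - l) with (RtoC 0) by ring. now rewrite Cmod_0.
Qed.

Lemma Clim_plus u v l m : Clim u l -> Clim v m -> Clim (fun n => u n + v n) (l + m).
Proof.
intros Hu Hv.
apply Clim_dominated with (fun n => (Cmod (u n - l) + Cmod (v n - m))%R).
- exists O; intros n _. replace (u n + v n - (l + m)) with ((u n - l) + (v n - m)) by ring.
  apply Cmod_triangle.
- evar_last; [apply is_lim_seq_plus'; [exact Hu | exact Hv]|]. simpl; f_equal; lra.
Qed.

Lemma Clim_mult u v l m : Clim u l -> Clim v m -> Clim (fun n => u n * v n) (l * m).
Proof.
intros Hu Hv.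
apply Clim_dominated with (fun n => (Cmod (u n - l) * Cmod (v n - m)
  + Cmod (u n - l) * Cmod m + Cmod l * Cmod (v n - m))%R).
- exists O; intros n _.
  replace (u n * v n - l * m) with
    ((u n - l) * (v n - m) + (u n - l) * m + l * (v n - m)) by ring.
  eapply Rle_trans; [apply Cmod_triangle|]. rewrite <- !Cmod_mult.
  apply Rplus_le_compat_r, Cmod_triangle.
- evar_last.
  + apply is_lim_seq_plus'; [apply is_lim_seq_plus'|].
    * apply is_lim_seq_mult'; [exact Hu | exact Hv].
    * apply is_lim_seq_mult'; [exact Hu | apply is_lim_seq_const].
    * apply is_lim_seq_mult'; [apply is_lim_seq_const | exact Hv].
  + simpl; f_equal; ring.
Qed.

Lemma Clim_opp u l : Clim u l -> Clim (fun n => - u n) (- l).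
Proof.
intros H. unfold Clim. eapply is_lim_seq_ext; [|exact H].
intros n; simpl. rewrite <- Cmod_opp. f_equal; ring.
Qed.

Lemma Clim_inv u (l : C) : l <> 0 -> Clim u l -> Clim (fun n => / u n) (/ l).
Proof.
intros Hl Hu.
assert (Hl' : 0 < Cmod l) by exact (proj1 (Cmod_gt_0 l) Hl).
assert (H2 : 0 < Cmod l / 2) by lra.
destruct (proj1 (Clim_eps u l) Hu (mkposreal _ H2)) as [N HN]; simpl in HN.
apply Clim_dominated with (fun n => (Cmod (u n - l) * (2 / (Cmod l * Cmod l)))%R).
- exists N; intros n Hn. specialize (HN n Hn).
  assert (Hun : Cmod l / 2 < Cmod (u n)).
  { assert (Cmod l <= Cmod (u n - l) + Cmod (u n))%R; [|lra].
    replace l with (- (u n - l) + u n) at 1 by ring.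
    eapply Rle_trans; [apply Cmod_triangle|]. rewrite Cmod_opp; lra. }
  assert (Hn0 : u n <> 0) by (apply (proj2 (Cmod_gt_0 _)); lra).
  replace (/ u n - / l) with (- (u n - l) / (u n * l)) by (field; auto).
  rewrite Cmod_div, Cmod_opp, Cmod_mult by now apply Cmult_neq_0.
  unfold Rdiv; apply Rmult_le_compat_l; [apply Cmod_ge_0|].
  replace (2 * / (Cmod l * Cmod l))%R with (/ (Cmod l / 2 * Cmod l))%R by (field; lra).
  apply Rinv_le_contravar; [nra|]. apply Rmult_le_compat_r; lra.
- evar_last; [apply is_lim_seq_mult'; [exact Hu | apply is_lim_seq_const]|].
  simpl; f_equal; ring.
Qed.

Lemma Clim_div u v (l m : C) : m <> 0 -> Clim u l -> Clim v m -> Clim (fun n => u n / v n) (l / m).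
Proof. intros Hm Hu Hv. apply Clim_mult; [|apply Clim_inv]; auto. Qed.

Lemma Clim_RtoC (u : nat -> R) (l : R) : is_lim_seq u l -> Clim (fun n => RtoC (u n)) l.
Proof.
intros H. unfold Clim.
apply is_lim_seq_ext with (fun n => Rabs (u n - l)).
{ intros n. now rewrite <- RtoC_minus, Cmod_R. }
replace 0%R with (Rabs (l - l)) by (rewrite Rminus_diag; apply Rabs_R0).
apply (is_lim_seq_abs _ (Finite (l - l))).
apply is_lim_seq_minus'; [exact H | apply is_lim_seq_const].
Qed.

Lemma Clim_subseq u l (phi : nat -> nat) :
  (forall n, (n <= phi n)%nat) -> Clim u l -> Clim (fun n => u (phi n)) l.
Proof.
intros Hphi H. apply Clim_eps; intros eps.
destruct (proj1 (Clim_eps _ _) H eps) as [N HN].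
exists N; intros n Hn. apply HN. specialize (Hphi n); lia.
Qed.

Lemma Clim_incr_n u l k : Clim (fun n => u (n + k)%nat) l -> Clim u l.
Proof. apply (is_lim_seq_incr_n (fun n => Cmod (u n - l)) k). Qed.

Lemma Re_Im_le_Cmod (z : C) : (Rabs (Re z) <= Cmod z /\ Rabs (Im z) <= Cmod z)%R.
Proof.
pose proof (Rmax_Cmod z); split; (eapply Rle_trans; [|eassumption]);
  [apply Rmax_l | apply Rmax_r].
Qed.

Lemma Cmod_le_Re_Im (z : C) : (Cmod z <= Rabs (Re z) + Rabs (Im z))%R.
Proof.
destruct z as [x y]; simpl.
replace ((x, y) : C) with (RtoC x + RtoC y * Ci).
- eapply Rle_trans; [apply Cmod_triangle|].
  rewrite Cmod_mult, Cmod_Ci, !Cmod_R; lra.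
- unfold RtoC, Ci, Cplus, Cmult; simpl; f_equal; ring.
Qed.

Lemma C_ext (z w : C) : Re z = Re w -> Im z = Im w -> z = w.
Proof. destruct z, w; simpl; intros; subst; reflexivity. Qed.

Lemma Re_minus (z w : C) : Re (z - w) = (Re z - Re w)%R.
Proof. destruct z, w; reflexivity. Qed.

Lemma Im_minus (z w : C) : Im (z - w) = (Im z - Im w)%R.
Proof. destruct z, w; reflexivity. Qed.

Lemma Clim_Re_Im u l :
  Clim u l <-> is_lim_seq (fun n => Re (u n)) (Re l) /\ is_lim_seq (fun n => Im (u n)) (Im l).
Proof.
split.
- intros H; split.
  + apply is_lim_seq_ext with (fun n => (Re (u n - l) + Re l)%R).
    { intros n; unfold Re; destruct (u n), l; simpl; ring. }
    evar_last; [apply is_lim_seq_plus'; [|apply is_lim_seq_const]|].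
    * apply is_lim_seq_abs_0.
      apply is_lim_seq_le_le with (u := fun _ => 0%R) (w := fun n => Cmod (u n - l)).
      -- intros n; split; [apply Rabs_pos | apply Re_Im_le_Cmod].
      -- apply is_lim_seq_const.
      -- exact H.
    * simpl; f_equal; ring.
  + apply is_lim_seq_ext with (fun n => (Im (u n - l) + Im l)%R).
    { intros n; unfold Im; destruct (u n), l; simpl; ring. }
    evar_last; [apply is_lim_seq_plus'; [|apply is_lim_seq_const]|].
    * apply is_lim_seq_abs_0.
      apply is_lim_seq_le_le with (u := fun _ => 0%R) (w := fun n => Cmod (u n - l)).
      -- intros n; split; [apply Rabs_pos | apply Re_Im_le_Cmod].
      -- apply is_lim_seq_const.
      -- exact H.
    * simpl; f_equal; ring.
- intros [H1 H2].
  apply Clim_ext with (fun n => RtoC (Re (u n)) + Ci * RtoC (Im (u n))).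
  { intros n; apply C_ext; simpl; ring. }
  replace l with (RtoC (Re l) + Ci * RtoC (Im l)) by (apply C_ext; simpl; ring).
  apply Clim_plus; [now apply Clim_RtoC|].
  apply Clim_mult; [apply Clim_const | now apply Clim_RtoC].
Qed.

Lemma exp_mono (x y : R) : (x <= y)%R -> (exp x <= exp y)%R.
Proof.
intros [H|H]; [left; now apply exp_increasing | subst; lra].
Qed.

(* If [P (n+1) / P n = 1 + O(1/n^2)], the infinite product converges; the tail is
   controlled by the telescoping bound [1/(n+1)^2 <= 1/n - 1/(n+1)]. *)
Lemma Clim_product_ex (P : nat -> C) (K : R) (N : nat) :
  (forall n, (N <= n)%nat -> (Cmod (P (S n) - P n) <= Cmod (P n) * (K / INR (S n) ^ 2))%R) ->
  exists l, Clim P l.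
Proof.
revert N.
assert (H : forall N, (1 <= N)%nat -> (forall n, (N <= n)%nat ->
    (Cmod (P (S n) - P n) <= Cmod (P n) * (K / INR (S n) ^ 2))%R) -> exists l, Clim P l).
{ intros N HN1 H.
  assert (HK : exists K', 0 <= K' /\ forall n, (N <= n)%nat ->
    (Cmod (P (S n) - P n) <= Cmod (P n) * (K' * (/ INR n - / INR (S n))))%R).
  { exists (Rmax K 0); split; [apply Rmax_r|]. intros n Hn.
    assert (0 < INR n) by (apply lt_0_INR; lia).
    eapply Rle_trans; [apply H, Hn|].
    apply Rmult_le_compat_l; [apply Cmod_ge_0|].
    unfold Rdiv.
    apply Rle_trans with (Rmax K 0 * / INR (S n) ^ 2)%R.
    { apply Rmult_le_compat_r; [|apply Rmax_l].
      apply Rlt_le, Rinv_0_lt_compat, pow_lt; rewrite S_INR; lra. }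
    apply Rmult_le_compat_l; [apply Rmax_r|].
    rewrite S_INR.
    replace (/ INR n - / (INR n + 1))%R with (/ (INR n * (INR n + 1)))%R by (field; lra).
    apply Rinv_le_contravar; nra. }
  destruct HK as [K' [HK0 HK]]. clear H K.
  (* By [1 + x <= exp x] the growth of |P| is at most the exponential of a telescoping sum, so |P|
     is bounded by [M]. *)
  set (M := (Cmod (P N) * exp (K' * / INR N))%R).
  assert (HM : forall n, (N <= n)%nat -> (Cmod (P n) <= M)%R).
  { intros n Hn.
    apply Rle_trans with (Cmod (P N) * exp (K' * (/ INR N - / INR n)))%R.
    - induction Hn as [|n Hn IH].
      + rewrite Rminus_diag, Rmult_0_r, exp_0; lra.
      + apply Rle_trans with (Cmod (P n) * exp (K' * (/ INR n - / INR (S n))))%R.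
        * replace (P (S n)) with (P n + (P (S n) - P n)) by ring.
          eapply Rle_trans; [apply Cmod_triangle|].
          specialize (HK n Hn).
          pose proof (exp_ineq1_le (K' * (/ INR n - / INR (S n)))).
          pose proof (Cmod_ge_0 (P n)). nra.
        * replace (K' * (/ INR N - / INR (S n)))%R with
            (K' * (/ INR N - / INR n) + K' * (/ INR n - / INR (S n)))%R by ring.
          rewrite exp_plus, <- Rmult_assoc.
          apply Rmult_le_compat_r; [apply Rlt_le, exp_pos | exact IH].
    - apply Rmult_le_compat_l; [apply Cmod_ge_0|].
      assert (0 < / INR n) by (apply Rinv_0_lt_compat, lt_0_INR; lia).
      apply exp_mono. nra. }
  assert (HM0 : 0 <= M) by (eapply Rle_trans; [apply Cmod_ge_0 | apply (HM N); lia]).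
  assert (HC : forall n k, (N <= n)%nat ->
    (Cmod (P (n + k)%nat - P n) <= M * K' * (/ INR n - / INR (n + k)))%R).
  { intros n k Hn. induction k as [|k IH].
    - rewrite Nat.add_0_r. replace (P n - P n) with (RtoC 0) by ring. rewrite Cmod_0; lra.
    - rewrite Nat.add_succ_r.
      replace (P (S (n + k)) - P n) with ((P (S (n + k)) - P (n + k)%nat) + (P (n + k)%nat - P n)) by ring.
      eapply Rle_trans; [apply Cmod_triangle|].
      assert (Hnk : (N <= n + k)%nat) by lia.
      assert (0 <= K' * (/ INR (n + k) - / INR (S (n + k))))%R.
      { apply Rmult_le_pos; [lra|].
        assert (/ INR (S (n + k)) <= / INR (n + k))%R; [|lra].
        apply Rinv_le_contravar; [apply lt_0_INR; lia | apply le_INR; lia]. }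
      pose proof (HK _ Hnk). pose proof (HM _ Hnk). nra. }
  assert (HCauchy : forall eps : posreal, exists N0, forall n m, (N0 <= n)%nat -> (N0 <= m)%nat ->
     (Cmod (P n - P m) < eps)%R).
  { intros eps.
    assert (Hl : is_lim_seq (fun n => (M * K' * / INR n)%R) 0).
    { evar_last; [apply is_lim_seq_mult'; [apply is_lim_seq_const|]|].
      - apply (is_lim_seq_inv _ p_infty); [apply is_lim_seq_INR | discriminate].
      - simpl; f_equal; ring. }
    rewrite <- is_lim_seq_spec in Hl. destruct (Hl eps) as [N0 HN0].
    assert (Hw : forall n k, (N + N0 <= n)%nat -> (Cmod (P (n + k)%nat - P n) < eps)%R).
    { intros n k Hn. eapply Rle_lt_trans; [apply HC; lia|].
      assert (Hn0 : (N0 <= n)%nat) by lia. specialize (HN0 n Hn0). simpl in HN0.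
      rewrite Rminus_0_r in HN0. apply Rabs_def2 in HN0.
      assert (0 < / INR (n + k)) by (apply Rinv_0_lt_compat, lt_0_INR; lia).
      assert (0 <= M * K') by now apply Rmult_le_pos. nra. }
    exists (N + N0)%nat; intros n m Hn Hm.
    destruct (Nat.le_ge_cases n m) as [Hnm|Hnm].
    - replace m with (n + (m - n))%nat by lia.
      rewrite <- Cmod_opp. replace (- (P n - P (n + (m - n))%nat)) with (P (n + (m - n))%nat - P n) by ring.
      now apply Hw.
    - replace n with (m + (n - m))%nat by lia. now apply Hw. }
  assert (HR : ex_finite_lim_seq (fun n => Re (P n))).
  { apply ex_lim_seq_cauchy_corr. intros eps. destruct (HCauchy eps) as [N0 H0].
    exists N0; intros n m Hn Hm. eapply Rle_lt_trans; [|apply (H0 n m Hn Hm)].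
    rewrite <- Re_minus.
    apply Re_Im_le_Cmod. }
  assert (HI : ex_finite_lim_seq (fun n => Im (P n))).
  { apply ex_lim_seq_cauchy_corr. intros eps. destruct (HCauchy eps) as [N0 H0].
    exists N0; intros n m Hn Hm. eapply Rle_lt_trans; [|apply (H0 n m Hn Hm)].
    rewrite <- Im_minus.
    apply Re_Im_le_Cmod. }
  destruct HR as [x Hx], HI as [y Hy].
  exists ((x, y) : C). apply Clim_Re_Im; split; assumption. }
(* The telescoping bound fails at n = 0, where [/ INR 0] is 0; starting from [S N] avoids this. *)
intros N HN. apply (H (S N)); [lia|]. intros n Hn; apply HN; lia.
Qed.

(** * The complex exponential *)

Lemma Cexp_plus z w : Cexp (z + w) = Cexp z * Cexp w.
Proof.
destruct z as [a b], w as [c d]; unfold Cexp, Cplus, Cmult; simpl.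
rewrite exp_plus, cos_plus, sin_plus. f_equal; ring.
Qed.

Lemma Cexp_RtoC (x : R) : Cexp x = exp x.
Proof. unfold Cexp, RtoC; simpl. rewrite cos_0, sin_0. f_equal; ring. Qed.

Lemma Cexp_0 : Cexp 0 = 1.
Proof. now rewrite Cexp_RtoC, exp_0. Qed.

Lemma Cmod_Cexp z : Cmod (Cexp z) = exp (Re z).
Proof.
destruct z as [a b]; unfold Cexp, Cmod; simpl fst; simpl snd; simpl Re; simpl Im.
replace ((exp a * cos b) ^ 2 + (exp a * sin b) ^ 2)%R with (Rsqr (exp a)).
- apply sqrt_Rsqr, Rlt_le, exp_pos.
- pose proof (sin2_cos2 b) as H; unfold Rsqr in *.
  replace ((exp a * cos b) ^ 2 + (exp a * sin b) ^ 2)%R with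
    (exp a * exp a * (sin b * sin b + cos b * cos b))%R by ring.
  rewrite H; ring.
Qed.

Lemma Cexp_neq_0 z : Cexp z <> 0.
Proof.
apply (proj2 (Cmod_gt_0 _)). rewrite Cmod_Cexp. apply exp_pos.
Qed.

Lemma Cexp_opp z : Cexp (- z) = / Cexp z.
Proof.
pose proof (Cexp_neq_0 z).
replace (Cexp (- z)) with (Cexp (- z) * Cexp z / Cexp z) by (field; auto).
rewrite <- Cexp_plus. replace (- z + z) with (RtoC 0) by ring.
rewrite Cexp_0. field; auto.
Qed.

Lemma exp_sub_1_bound x : (Rabs (exp x - 1) <= Rabs x * exp (Rabs x))%R.
Proof.
pose proof (exp_ineq1_le x). pose proof (exp_ineq1_le (- x)) as H'.
pose proof (exp_pos x). pose proof (exp_pos (- x)).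
assert (E : (exp x * exp (- x) = 1)%R) by (rewrite <- exp_plus, Rplus_opp_r; apply exp_0).
destruct (Rle_lt_dec 0 x).
- rewrite !Rabs_pos_eq; nra.
- rewrite !Rabs_left1 by nra. nra.
Qed.

(** Only [1 + t <= exp t] at t = x and t = -x is needed: multiplying the second instance by [exp x]
    gives exp x - 1 <= x exp x, hence exp x - 1 - x <= x (exp x - 1). *)
Lemma exp_sub_1_sub_x_bound x : (Rabs (exp x - 1 - x) <= x ^ 2 * exp (Rabs x))%R.
Proof.
pose proof (exp_ineq1_le x). pose proof (exp_ineq1_le (- x)) as H'.
pose proof (exp_pos x). pose proof (exp_pos (- x)).
assert (E : (exp x * exp (- x) = 1)%R) by (rewrite <- exp_plus, Rplus_opp_r; apply exp_0).
rewrite Rabs_pos_eq by lra.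
assert (Hx1 : (exp x - 1 - x <= x * (exp x - 1))%R) by nra.
destruct (Rle_lt_dec 0 x).
- rewrite Rabs_pos_eq by lra.
  assert (exp x - 1 <= x * exp x)%R by nra. nra.
- rewrite Rabs_left1 by lra.
  assert (1 <= exp (- x))%R by lra. nra.
Qed.

Lemma Rabs_sin_le x : (Rabs (sin x) <= Rabs x)%R.
Proof.
destruct (Rtotal_order x 0) as [H|[H|H]].
- assert (H' : (0 < - x)%R) by lra. pose proof (sin_lt_x _ H') as H1.
  rewrite sin_neg in H1. rewrite (Rabs_left x) by lra.
  apply Rabs_le; split; [lra|].
  destruct (Rle_lt_dec (- x) PI).
  + pose proof (sin_ge_0 (- x) ltac:(lra) ltac:(lra)) as H2. rewrite sin_neg in H2.
    pose proof PI_RGT_0. lra.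
  + pose proof (SIN_bound x). pose proof PI2_1. lra.
- subst. rewrite sin_0; lra.
- pose proof (sin_lt_x _ H). rewrite (Rabs_pos_eq x) by lra.
  apply Rabs_le; split; [|lra].
  destruct (Rle_lt_dec x PI).
  + pose proof (sin_ge_0 x ltac:(lra) ltac:(lra)). lra.
  + pose proof (SIN_bound x). pose proof PI2_1. lra.
Qed.

Lemma one_sub_cos x : (1 - cos x = 2 * (sin (x / 2)) ^ 2)%R.
Proof.
replace x with (2 * (x / 2))%R at 1 by field. rewrite cos_2a_sin. ring.
Qed.

Lemma Rabs_cos_sub_1 x : (Rabs (cos x - 1) <= x ^ 2 /\ Rabs (cos x - 1) <= Rabs x)%R.
Proof.
rewrite Rabs_minus_sym, one_sub_cos.
pose proof (Rabs_sin_le (x / 2)) as H.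
assert (H1 : (Rabs (sin (x / 2)) <= 1)%R) by (apply Rabs_le, SIN_bound).
assert (E : (Rabs (x / 2) = Rabs x / 2)%R).
{ unfold Rdiv; rewrite Rabs_mult, (Rabs_pos_eq (/ 2)); lra. }
rewrite E in H.
rewrite Rabs_pos_eq by nra.
rewrite <- (pow2_abs (sin _)), <- (pow2_abs x).
pose proof (Rabs_pos (sin (x / 2))). pose proof (Rabs_pos x).
split; nra.
Qed.

Lemma Rabs_sin_sub_x x : (Rabs (sin x - x) <= x ^ 2)%R.
Proof.
destruct (MVT_gen (fun t => sin t - t)%R 0 x (fun t => cos t - 1)%R) as [c [Hc H]].
- intros t _. auto_derive; auto. ring.
- intros t _. apply continuity_pt_minus; [apply continuity_sin | apply derivable_continuous_pt, derivable_pt_id].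
- rewrite sin_0, !Rminus_0_r in H. rewrite H, Rabs_mult, <- (pow2_abs x).
  destruct (Rabs_cos_sub_1 c) as [_ H1].
  assert (Rabs c <= Rabs x)%R.
  { unfold Rmin, Rmax in Hc; destruct (Rle_dec 0 x).
    - rewrite !Rabs_pos_eq; lra.
    - rewrite !Rabs_left1; lra. }
  pose proof (Rabs_pos x). pose proof (Rabs_pos (cos c - 1)). nra.
Qed.

(** The constant 4 counts the real error terms [B1] to [B4], each at most |z|^2 exp |z|. This
    estimate supplies the O(1/n^2) in the Gamma product and, through [Ccos], the O(x^2) in the
    cosine integrals. *)
Lemma Cexp_second_order z :
  (Cmod (Cexp z - 1 - z) <= 4 * Cmod z ^ 2 * exp (Cmod z))%R.
Proof.
destruct (Re_Im_le_Cmod z) as [Hx Hy].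
destruct z as [x y]. set (M := Cmod (x, y)) in *. simpl in Hx, Hy.
eapply Rle_trans; [apply Cmod_le_Re_Im|].
replace (Re (Cexp (x, y) - 1 - (x, y))) with ((exp x - 1 - x) + exp x * (cos y - 1))%R
  by (unfold Cexp, Cminus, Cplus, Copp, RtoC; simpl; ring).
replace (Im (Cexp (x, y) - 1 - (x, y))) with ((exp x - 1) * sin y + (sin y - y))%R
  by (unfold Cexp, Cminus, Cplus, Copp, RtoC; simpl; ring).
assert (HE : (exp (Rabs x) <= exp M)%R) by now apply exp_mono.
assert (HE1 : (1 <= exp M)%R).
{ rewrite <- exp_0. apply exp_mono. pose proof (Rabs_pos x). lra. }
assert (Hex : (exp x <= exp M)%R).
{ apply exp_mono. pose proof (Rle_abs x). lra. }
pose proof (Rabs_pos x) as Px. pose proof (Rabs_pos y) as Py.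
assert (Hx2 : (x ^ 2 <= M ^ 2)%R) by (rewrite <- (pow2_abs x); nra).
assert (Hy2 : (y ^ 2 <= M ^ 2)%R) by (rewrite <- (pow2_abs y); nra).
assert (B1 : (Rabs (exp x - 1 - x) <= M ^ 2 * exp M)%R).
{ eapply Rle_trans; [apply exp_sub_1_sub_x_bound|].
  pose proof (exp_pos (Rabs x)). nra. }
assert (B2 : (Rabs (exp x * (cos y - 1)) <= M ^ 2 * exp M)%R).
{ rewrite Rabs_mult, (Rabs_pos_eq (exp x)) by (left; apply exp_pos).
  destruct (Rabs_cos_sub_1 y) as [H _].
  pose proof (exp_pos x). pose proof (Rabs_pos (cos y - 1)). nra. }
assert (B3 : (Rabs ((exp x - 1) * sin y) <= M ^ 2 * exp M)%R).
{ rewrite Rabs_mult. pose proof (exp_sub_1_bound x) as H. pose proof (Rabs_sin_le y) as H'.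
  apply Rle_trans with ((Rabs x * exp (Rabs x)) * Rabs y)%R.
  - apply Rmult_le_compat; auto using Rabs_pos.
  - assert (Rabs x * Rabs y <= M ^ 2)%R by nra.
    pose proof (exp_pos (Rabs x)).
    assert (0 <= Rabs x * Rabs y)%R by nra. nra. }
assert (B4 : (Rabs (sin y - y) <= M ^ 2 * exp M)%R).
{ eapply Rle_trans; [apply Rabs_sin_sub_x|]. nra. }
pose proof (Rabs_triang (exp x - 1 - x) (exp x * (cos y - 1))).
pose proof (Rabs_triang ((exp x - 1) * sin y) (sin y - y)).
lra.
Qed.

(** * Complex powers, Pochhammer symbols and the approximants of 1/Gamma *)

Lemma Rpow_C_plus x z w : Rpow_C x (z + w) = Rpow_C x z * Rpow_C x w.
Proof. unfold Rpow_C. rewrite <- Cexp_plus. f_equal; ring. Qed.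

Lemma Rpow_C_neq_0 x z : Rpow_C x z <> 0.
Proof. apply Cexp_neq_0. Qed.

Lemma Rpow_C_opp x z : Rpow_C x (- z) = / Rpow_C x z.
Proof. unfold Rpow_C. rewrite <- Cexp_opp. f_equal; ring. Qed.

Lemma Rpow_C_mult x y z : (0 < x)%R -> (0 < y)%R ->
  Rpow_C (x * y) z = Rpow_C x z * Rpow_C y z.
Proof.
intros Hx Hy. unfold Rpow_C. rewrite ln_mult, RtoC_plus, <- Cexp_plus by auto.
f_equal; ring.
Qed.

Lemma Rpow_C_0 x : Rpow_C x 0 = 1.
Proof. unfold Rpow_C. rewrite Cmult_0_l. apply Cexp_0. Qed.

Lemma Rpow_C_INR x n : (0 < x)%R -> Rpow_C x (INR n) = (x ^ n)%R.
Proof.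
intros Hx. unfold Rpow_C. rewrite <- RtoC_mult, Cexp_RtoC.
f_equal. rewrite <- ln_pow by auto. apply exp_ln, pow_lt, Hx.
Qed.

Lemma Rpow_C_1 x : (0 < x)%R -> Rpow_C x 1 = x.
Proof. intros Hx. unfold Rpow_C. rewrite Cmult_1_l, Cexp_RtoC, exp_ln; auto. Qed.

Lemma Rpow_C_half x : (0 < x)%R -> Rpow_C x (1 / 2) = sqrt x.
Proof.
intros Hx. unfold Rpow_C. rewrite <- RtoC_div, <- RtoC_mult, Cexp_RtoC by lra.
f_equal. rewrite <- Rpower_sqrt by auto. unfold Rpower. f_equal. field.
Qed.

Lemma RtoC_neq_0 x : (x <> 0)%R -> RtoC x <> 0.
Proof. intros H E. apply H. now apply RtoC_inj in E. Qed.

Lemma RtoC_S n : RtoC (INR (S n)) = INR n + 1.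
Proof. now rewrite S_INR, RtoC_plus. Qed.

Lemma nonpos_int_plus_neq_0 z n : ~ nonpos_int z -> z + INR n <> 0.
Proof.
intros H E. apply H. exists n.
replace z with (z + INR n - INR n) by ring. rewrite E. ring.
Qed.

Lemma pochhammer_neq_0 z n : ~ nonpos_int z -> pochhammer z n <> 0.
Proof.
intros H. induction n as [|n IH]; simpl.
- exact C1_nz.
- apply Cmult_neq_0; [exact IH | now apply nonpos_int_plus_neq_0].
Qed.

(* The reciprocals [pochhammer z n * n^(1-z) / n!] of Gauss's approximants (up to the
   factor [(z + n) / n]) make sense, and converge to [1 / Gamma z], for every [z]. *)
Definition rgamma_approx (z : C) (n : nat) : C :=
  pochhammer z n * Rpow_C (INR n) (1 - z) / INR (fact n).

Lemma rgamma_approx_step z n : (1 <= n)%nat ->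
  rgamma_approx z (S n) = rgamma_approx z n *
    ((1 + z / INR n) * Cexp (- z * ln (1 + / INR n))).
Proof.
intros Hn. unfold rgamma_approx.
assert (Hn0 : (0 < INR n)%R) by (apply lt_0_INR; lia).
assert (Hnz := RtoC_neq_0 _ (Rgt_not_eq _ _ Hn0)).
assert (Hi : (0 < / INR n)%R) by now apply Rinv_0_lt_compat.
replace (INR (S n)) with (INR n * (1 + / INR n))%R by (rewrite S_INR; field; lra).
rewrite Rpow_C_mult by lra.
replace (Rpow_C (1 + / INR n) (1 - z)) with ((1 + / INR n) * Cexp (- z * ln (1 + / INR n))).
2:{ unfold Cminus; rewrite Rpow_C_plus, Rpow_C_1 by lra.
  rewrite RtoC_plus, RtoC_inv by lra. reflexivity. }
simpl pochhammer.
replace (RtoC (INR (fact (S n)))) with ((INR n + 1) * INR (fact n)).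
2:{ rewrite fact_simpl, mult_INR, RtoC_mult, RtoC_S. reflexivity. }
assert (Hf := RtoC_neq_0 _ (INR_fact_neq_0 n)).
assert (Hn1 : INR n + 1 <> 0).
{ rewrite <- RtoC_S. apply RtoC_neq_0, not_0_INR. lia. }
field; auto.
Qed.

Lemma ln_1_plus_inv_bounds n : (1 <= n)%nat ->
  (/ INR (S n) <= ln (1 + / INR n) <= / INR n)%R.
Proof.
intros Hn. assert (Hn0 : (0 < INR n)%R) by (apply lt_0_INR; lia).
assert (Hi : (0 < / INR n)%R) by now apply Rinv_0_lt_compat.
assert (L : forall t, (0 < t -> ln t <= t - 1)%R).
{ intros t Ht. pose proof (exp_ineq1_le (ln t)). rewrite exp_ln in H; lra. }
split.
- rewrite S_INR.
  assert (H := L (/ (1 + / INR n))%R ltac:(apply Rinv_0_lt_compat; lra)).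
  rewrite ln_Rinv in H by lra.
  replace (/ (1 + / INR n) - 1)%R with (- / (INR n + 1))%R in H by (field; lra).
  lra.
- specialize (L (1 + / INR n)%R). lra.
Qed.

(** In (1 + z/n) (1 + 1/n)^(-z) the terms of order 1/n cancel. This is what the exponent [1 - z] in
    [rgamma_approx] achieves. *)
Lemma rgamma_step_bound z : exists K, forall n, (1 <= n)%nat ->
  (Cmod ((1 + z / INR n) * Cexp (- z * ln (1 + / INR n)) - 1) <= K / INR n ^ 2)%R.
Proof.
set (M := Cmod z). assert (HM : (0 <= M)%R) by apply Cmod_ge_0.
exists (M + M ^ 2 + (1 + M) * (4 * M ^ 2 * exp M))%R.
intros n Hn. assert (Hn1 : (1 <= INR n)%R) by (now apply (le_INR 1)).
destruct (ln_1_plus_inv_bounds n Hn) as [HL1 HL2].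
set (L := ln (1 + / INR n)) in *. set (t := (/ INR n)%R) in *.
assert (Ht : (0 < t <= 1)%R).
{ unfold t; split; [apply Rinv_0_lt_compat; lra|].
  rewrite <- Rinv_1. apply Rinv_le_contravar; lra. }
assert (HL0 : (0 <= L)%R).
{ eapply Rle_trans; [|exact HL1]. left; apply Rinv_0_lt_compat, lt_0_INR; lia. }
assert (HtL : (0 <= t - L <= t ^ 2)%R).
{ split; [lra|]. apply Rle_trans with (t - / INR (S n))%R; [lra|].
  rewrite S_INR. unfold t.
  replace (/ INR n - / (INR n + 1))%R with (/ (INR n * (INR n + 1)))%R by (field; lra).
  rewrite pow_inv. apply Rinv_le_contravar; nra. }
set (E := Cexp (- z * L) - 1 - (- z * L)).
assert (HE : (Cmod E <= 4 * M ^ 2 * exp M * t ^ 2)%R).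
{ unfold E. eapply Rle_trans; [apply Cexp_second_order|].
  rewrite Cmod_mult, Cmod_opp, Cmod_R, (Rabs_pos_eq L) by auto. fold M.
  assert (HLt : (M * L <= M * t)%R) by (apply Rmult_le_compat_l; lra).
  assert (exp (M * L) <= exp M)%R by (apply exp_mono; nra).
  assert ((M * L) ^ 2 <= M ^ 2 * t ^ 2)%R.
  { rewrite Rpow_mult_distr. apply Rmult_le_compat_l; [nra|]. nra. }
  pose proof (exp_pos (M * L)).
  replace (4 * M ^ 2 * exp M * t ^ 2)%R with (4 * (M ^ 2 * t ^ 2) * exp M)%R by ring.
  assert (0 <= (M * L) ^ 2)%R by nra.
  apply Rmult_le_compat; nra. }
assert (Hz : z / INR n = z * t).
{ unfold t, Cdiv. rewrite RtoC_inv by lra. reflexivity. }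
(* Each of the three summands is O(t^2): the first by 0 <= t - L <= t^2, the second by L <= t, the
   third by the bound on [E]. *)
replace ((1 + z / INR n) * Cexp (- z * L) - 1) with
  (z * (t - L) + (- (z * z * (t * L))) + (1 + z * t) * E) by (rewrite Hz; unfold E; ring).
replace (((M + M ^ 2 + (1 + M) * (4 * M ^ 2 * exp M)) / INR n ^ 2)%R) with
  (M * t ^ 2 + M ^ 2 * t ^ 2 + (1 + M) * (4 * M ^ 2 * exp M * t ^ 2))%R
  by (unfold t; field; lra).
eapply Rle_trans; [apply Cmod_triangle|]. apply Rplus_le_compat.
- eapply Rle_trans; [apply Cmod_triangle|]. apply Rplus_le_compat.
  + rewrite Cmod_mult, <- RtoC_minus, Cmod_R, Rabs_pos_eq by lra.
    apply Rmult_le_compat_l; [auto | apply HtL].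
  + rewrite Cmod_opp, !Cmod_mult, !Cmod_R, !Rabs_pos_eq by lra. fold M.
    replace (M ^ 2)%R with (M * M)%R by ring. apply Rmult_le_compat_l; nra.
- rewrite Cmod_mult. apply Rmult_le_compat; auto using Cmod_ge_0.
  eapply Rle_trans; [apply Cmod_triangle|]. rewrite Cmod_1, Cmod_mult, Cmod_R, Rabs_pos_eq by lra.
  fold M. nra.
Qed.

(** * The reciprocal Gamma function *)

(** [Lim_seq] is total, so 1/Gamma can be defined before convergence is known; [rGamma_lim] supplies
    the convergence. *)
Definition rGamma (z : C) : C :=
  (real (Lim_seq (fun n => Re (rgamma_approx z n))),
   real (Lim_seq (fun n => Im (rgamma_approx z n)))).

(** From n + 1 <= 2n; it adapts [rgamma_step_bound] to the form expected by [Clim_product_ex]. *)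
Lemma inv_S_sq_bound n : (1 <= n)%nat -> (/ INR n ^ 2 <= 4 / INR (S n) ^ 2)%R.
Proof.
intros Hn. assert (Hn1 : (1 <= INR n)%R) by (now apply (le_INR 1)).
rewrite S_INR.
replace (4 / (INR n + 1) ^ 2)%R with (/ ((INR n + 1) ^ 2 / 4))%R by (field; lra).
apply Rinv_le_contravar; nra.
Qed.

Lemma rGamma_lim z : Clim (rgamma_approx z) (rGamma z).
Proof.
destruct (rgamma_step_bound z) as [K HK].
assert (HK0 : (0 <= K)%R).
{ specialize (HK 1%nat (le_n _)). simpl in HK.
  pose proof (Cmod_ge_0 ((1 + z / 1) * Cexp (- z * ln (1 + / 1)) - 1)). lra. }
destruct (Clim_product_ex (rgamma_approx z) (4 * K) 1) as [l Hl].
{ intros n Hn. rewrite rgamma_approx_step by auto.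
  set (q := (1 + z / INR n) * Cexp (- z * ln (1 + / INR n))) in *.
  replace (rgamma_approx z n * q - rgamma_approx z n) with (rgamma_approx z n * (q - 1)) by ring.
  rewrite Cmod_mult. apply Rmult_le_compat_l; [apply Cmod_ge_0|].
  eapply Rle_trans; [apply HK, Hn|].
  pose proof (inv_S_sq_bound n Hn). unfold Rdiv in *. nra. }
replace (rGamma z) with l; [exact Hl|].
apply Clim_Re_Im in Hl. destruct Hl as [H1 H2].
unfold rGamma. rewrite (is_lim_seq_unique _ _ H1), (is_lim_seq_unique _ _ H2).
now destruct l.
Qed.

Lemma rgamma_approx_neq_0 z n : ~ nonpos_int z -> rgamma_approx z n <> 0.
Proof.
intros H. unfold rgamma_approx, Cdiv.
apply Cmult_neq_0; [apply Cmult_neq_0|].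
- now apply pochhammer_neq_0.
- apply Rpow_C_neq_0.
- intros E. apply C1_nz.
  rewrite <- (Cinv_l (INR (fact n))), E; [ring | apply RtoC_neq_0, INR_fact_neq_0].
Qed.

(** The reciprocals of the approximants satisfy the same product criterion, hence converge; the
    product of the two limits is 1. *)
Lemma rGamma_neq_0 z : ~ nonpos_int z -> rGamma z <> 0.
Proof.
intros Hz.
assert (Hnz := fun n => rgamma_approx_neq_0 z n Hz).
destruct (rgamma_step_bound z) as [K HK].
assert (HK0 : (0 <= K)%R).
{ specialize (HK 1%nat (le_n _)). simpl in HK.
  pose proof (Cmod_ge_0 ((1 + z / 1) * Cexp (- z * ln (1 + / 1)) - 1)). lra. }
(* Beyond 2K the step [q] satisfies |q - 1| <= 1/2, so |q| >= 1/2. Dividing by q costs a factor 2,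
   which turns the 4K of [rGamma_lim] into 8K. *)
destruct (nfloor_ex (2 * K) ltac:(lra)) as [N0 [_ HN0]].
destruct (Clim_product_ex (fun n => / rgamma_approx z n) (8 * K) (S N0)) as [l Hl].
{ intros n Hn.
  assert (Hn1 : (1 <= n)%nat) by lia.
  pose proof (Hnz (S n)) as Hq. rewrite rgamma_approx_step in * by auto.
  specialize (HK n Hn1).
  set (q := (1 + z / INR n) * Cexp (- z * ln (1 + / INR n))) in *.
  assert (HnN : (2 * K <= INR n)%R).
  { apply le_INR in Hn. rewrite S_INR in Hn. lra. }
  assert (Hn2 : (1 <= INR n)%R) by (now apply (le_INR 1)).
  assert (Hsm : (K / INR n ^ 2 <= 1 / 2)%R).
  { apply Rle_div_l; [apply Rlt_gt, pow_lt; lra | nra]. }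
  assert (Hqm : (1 / 2 <= Cmod q)%R).
  { assert (1 <= Cmod q + Cmod (q - 1))%R; [|lra].
    pose proof (Cmod_triangle q (- (q - 1))) as H.
    replace (q + - (q - 1)) with (RtoC 1) in H by ring.
    rewrite Cmod_1, Cmod_opp in H. exact H. }
  assert (Hq0 : q <> 0) by (apply (proj2 (Cmod_gt_0 _)); lra).
  replace (/ (rgamma_approx z n * q) - / rgamma_approx z n) with
    (/ rgamma_approx z n * (- (q - 1) / q)) by (field; auto).
  rewrite Cmod_mult. apply Rmult_le_compat_l; [apply Cmod_ge_0|].
  rewrite Cmod_div, Cmod_opp by auto.
  apply Rle_div_l; [lra|].
  pose proof (inv_S_sq_bound n Hn1).
  assert (0 <= K / INR n ^ 2)%R by (eapply Rle_trans; [apply Cmod_ge_0|exact HK]).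
  apply Rle_trans with (8 * K / INR (S n) ^ 2 * (1 / 2))%R.
  - eapply Rle_trans; [exact HK|]. unfold Rdiv in *. nra.
  - apply Rmult_le_compat_l; [|exact Hqm].
    unfold Rdiv in *; nra. }
intros E.
assert (H := Clim_mult _ _ _ _ (rGamma_lim z) Hl). rewrite E, Cmult_0_l in H.
apply C1_nz. eapply Clim_unique; [|exact H].
apply Clim_ext with (fun _ => RtoC 1); [|apply Clim_const].
intros n. field; auto.
Qed.

Lemma is_lim_seq_inv_INR : is_lim_seq (fun n => / INR n)%R 0.
Proof. apply (is_lim_seq_inv _ p_infty); [apply is_lim_seq_INR | discriminate]. Qed.

Lemma CGamma_rGamma z : ~ nonpos_int z -> CGamma z = / rGamma z.
Proof.
intros Hz. unfold CGamma.
apply (@iota_filterlim_locally C_AbsRing C_CompleteNormedModule);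
  [apply Proper_StrongProper, eventually_filter|].
apply Clim_filterlim.
apply Clim_ext_loc with (fun n => / (rgamma_approx z n * (1 + z * RtoC (/ INR n)))).
- exists 1%nat; intros n Hn. unfold rgamma_approx.
  assert (Hn0 : INR n <> 0%R) by (apply not_0_INR; lia).
  assert (Hnz := RtoC_neq_0 _ Hn0).
  assert (Hf := RtoC_neq_0 _ (INR_fact_neq_0 n)).
  assert (Hp := pochhammer_neq_0 z n Hz).
  assert (Hp' := nonpos_int_plus_neq_0 z n Hz).
  unfold Cminus. rewrite Rpow_C_plus, Rpow_C_opp, Rpow_C_1 by (apply lt_0_INR; lia).
  assert (Hr := Rpow_C_neq_0 (INR n) z).
  rewrite RtoC_inv by auto. simpl pochhammer.
  field. repeat split; auto.
- apply Clim_inv; [now apply rGamma_neq_0|].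
  replace (rGamma z) with (rGamma z * (1 + z * 0)) by ring.
  apply Clim_mult; [apply rGamma_lim|].
  apply Clim_plus; [apply Clim_const|].
  apply Clim_mult; [apply Clim_const|].
  apply Clim_RtoC, is_lim_seq_inv_INR.
Qed.

(** * Cosine integrals and the reflection formula *)

Lemma Ccos_second_order z : (Cmod (Ccos z - 1) <= 4 * Cmod z ^ 2 * exp (Cmod z))%R.
Proof.
assert (H1 := Cexp_second_order (Ci * z)). assert (H2 := Cexp_second_order (- (Ci * z))).
rewrite Cmod_opp in H2. rewrite Cmod_mult, Cmod_Ci, Rmult_1_l in H1, H2.
replace (Ccos z - 1) with
  ((RtoC (/ 2)) * ((Cexp (Ci * z) - 1 - Ci * z) + (Cexp (- (Ci * z)) - 1 - - (Ci * z)))).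
2:{ unfold Ccos. rewrite RtoC_inv by lra. field. }
rewrite Cmod_mult, Cmod_R, Rabs_pos_eq by lra.
pose proof (Cmod_triangle (Cexp (Ci * z) - 1 - Ci * z) (Cexp (- (Ci * z)) - 1 - - (Ci * z))).
lra.
Qed.

(* With [z = al + i be], the integrals [I_n] of [cos (z x) (cos x)^n] over [[0, PI/2]] satisfy
   [(n^2 - z^2) I_n = n (n-1) I_{n-2}] and [(1 - z^2) I_1 = cos (PI z / 2)], so the odd ones
   are [cos (PI z / 2)] divided by the finite products [prod ((2k+1)^2 - z^2)], up to factors
   independent of [z]. Comparing with [z = 0], where [I_n] has the same asymptotics, gives the
   reflection formula. *)
Section CosineIntegrals.

Local Open Scope R_scope.

Variables al be : R.

(** With z = al + i be, these are the real and imaginary parts of cos (z x) and sin (z x), split so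
    that real integration and [auto_derive] apply. *)
Definition ccos_re (x : R) := cos (al * x) * ((exp (be * x) + exp (- (be * x))) / 2).
Definition ccos_im (x : R) := - (sin (al * x) * ((exp (be * x) - exp (- (be * x))) / 2)).
Definition csin_re (x : R) := sin (al * x) * ((exp (be * x) + exp (- (be * x))) / 2).
Definition csin_im (x : R) := cos (al * x) * ((exp (be * x) - exp (- (be * x))) / 2).

Lemma Ccos_Re_Im (x : R) : Ccos ((al, be) * x)%C = (ccos_re x, ccos_im x).
Proof.
unfold Ccos, Cdiv. rewrite <- RtoC_inv by lra.
replace (Ci * ((al, be) * x))%C with (((- (be * x))%R, (al * x)%R) : C)
  by (apply C_ext; simpl; ring).
replace (- ((- (be * x))%R, (al * x)%R))%C with (((be * x)%R, (- (al * x))%R) : C)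
  by (apply C_ext; simpl; ring).
unfold ccos_re, ccos_im, Cexp, RtoC, Cplus, Cmult; simpl.
rewrite cos_neg, sin_neg. f_equal; field.
Qed.

Definition cosine_integral_re n := RInt (fun x => ccos_re x * cos x ^ n) 0 (PI / 2).
Definition cosine_integral_im n := RInt (fun x => ccos_im x * cos x ^ n) 0 (PI / 2).

Lemma is_RInt_ccos_re n : is_RInt (fun x => ccos_re x * cos x ^ n) 0 (PI / 2) (cosine_integral_re n).
Proof.
apply (RInt_correct (V := R_CompleteNormedModule)), (ex_RInt_continuous (V := R_CompleteNormedModule)).
intros x _. apply (ex_derive_continuous (V := R_NormedModule)). unfold ccos_re. auto_derive; auto.
Qed.

Lemma is_RInt_ccos_im n : is_RInt (fun x => ccos_im x * cos x ^ n) 0 (PI / 2) (cosine_integral_im n).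
Proof.
apply (RInt_correct (V := R_CompleteNormedModule)), (ex_RInt_continuous (V := R_CompleteNormedModule)).
intros x _. apply (ex_derive_continuous (V := R_NormedModule)). unfold ccos_im. auto_derive; auto.
Qed.

Lemma is_RInt_lin3 (f g h : R -> R) (a b c F G H : R) :
  is_RInt f 0 (PI / 2) F -> is_RInt g 0 (PI / 2) G -> is_RInt h 0 (PI / 2) H ->
  is_RInt (fun x => a * f x + b * g x + c * h x) 0 (PI / 2) (a * F + b * G + c * H).
Proof.
intros HF HG HH.
apply (is_RInt_plus (V := R_NormedModule)).
- apply (is_RInt_plus (V := R_NormedModule)).
  + now apply (is_RInt_scal (V := R_NormedModule)).
  + now apply (is_RInt_scal (V := R_NormedModule)).
- now apply (is_RInt_scal (V := R_NormedModule)).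
Qed.

Lemma is_RInt_antiderivative (h f : R -> R) (a b : R) :
  (forall x, is_derive h x (f x)) -> (forall x, ex_derive f x) ->
  is_RInt f a b (h b - h a).
Proof.
intros H1 H2. apply (is_RInt_derive (V := R_CompleteNormedModule)).
- intros; apply H1.
- intros; apply (ex_derive_continuous (V := R_NormedModule)), H2.
Qed.

Lemma is_RInt_eq (f : R -> R) (a b u v : R) : is_RInt f a b u -> is_RInt f a b v -> u = v.
Proof.
intros Hu Hv. rewrite <- (is_RInt_unique (V := R_CompleteNormedModule) _ _ _ _ Hu).
exact (is_RInt_unique (V := R_CompleteNormedModule) _ _ _ _ Hv).
Qed.

Lemma cosine_integral_rec_re n :
  (INR (n + 2) ^ 2 - (al ^ 2 - be ^ 2)) * cosine_integral_re (n + 2) + 2 * al * be * cosine_integral_im (n + 2)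
  = INR (n + 2) * INR (n + 1) * cosine_integral_re n.
Proof.
set (N := INR (n + 2)).
assert (H := is_RInt_lin3 _ _ _ (N ^ 2 - (al ^ 2 - be ^ 2)) (2 * al * be) (- (N * INR (n + 1)))
  _ _ _ (is_RInt_ccos_re (n + 2)) (is_RInt_ccos_im (n + 2)) (is_RInt_ccos_re n)).
(* The primitive is the real part of N cos^(n+1) x sin x cos (z x) - z sin (z x) cos^(n+2) x with N
   = n + 2. It condenses two integrations by parts and vanishes at both ends. *)
assert (H' := is_RInt_antiderivative
  (fun x => N * cos x ^ (n + 1) * sin x * ccos_re x - (al * csin_re x - be * csin_im x) * cos x ^ (n + 2))
  (fun x => (N ^ 2 - (al ^ 2 - be ^ 2)) * (ccos_re x * cos x ^ (n + 2))
     + 2 * al * be * (ccos_im x * cos x ^ (n + 2))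
     + - (N * INR (n + 1)) * (ccos_re x * cos x ^ n)) 0 (PI / 2)).
apply (is_RInt_eq _ _ _ _ _ H) in H'.
- cbv beta in H'. rewrite cos_PI2, sin_0 in H'.
  unfold csin_re, csin_im in H'. rewrite !Rmult_0_r, sin_0, Ropp_0, exp_0 in H'.
  rewrite !pow_ne_zero in H' by lia. lra.
- intros x. unfold ccos_re, csin_re, csin_im, ccos_im. auto_derive; auto.
  replace (Init.Nat.pred (n + 1)) with n by lia.
  replace (Init.Nat.pred (n + 2)) with (n + 1)%nat by lia.
  fold N. rewrite !pow_add.
  replace N with (INR n + 2) by (unfold N; rewrite plus_INR; simpl; ring).
  rewrite plus_INR. simpl (INR 1).
  assert (E : sin x * sin x = 1 - cos x * cos x).
  { pose proof (sin2_cos2 x). unfold Rsqr in *; lra. }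
  match goal with |- ?l = ?r => ring_simplify l; ring_simplify r end.
  replace (sin x ^ 2) with (1 - cos x * cos x) by (rewrite <- E; ring). field.
- intros x. unfold ccos_re, ccos_im. auto_derive; auto.
Qed.

Lemma cosine_integral_rec_im n :
  (INR (n + 2) ^ 2 - (al ^ 2 - be ^ 2)) * cosine_integral_im (n + 2) - 2 * al * be * cosine_integral_re (n + 2)
  = INR (n + 2) * INR (n + 1) * cosine_integral_im n.
Proof.
set (N := INR (n + 2)).
assert (H := is_RInt_lin3 _ _ _ (N ^ 2 - (al ^ 2 - be ^ 2)) (- (2 * al * be)) (- (N * INR (n + 1)))
  _ _ _ (is_RInt_ccos_im (n + 2)) (is_RInt_ccos_re (n + 2)) (is_RInt_ccos_im n)).
assert (H' := is_RInt_antiderivative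
  (fun x => N * cos x ^ (n + 1) * sin x * ccos_im x - (al * csin_im x + be * csin_re x) * cos x ^ (n + 2))
  (fun x => (N ^ 2 - (al ^ 2 - be ^ 2)) * (ccos_im x * cos x ^ (n + 2))
     + - (2 * al * be) * (ccos_re x * cos x ^ (n + 2))
     + - (N * INR (n + 1)) * (ccos_im x * cos x ^ n)) 0 (PI / 2)).
apply (is_RInt_eq _ _ _ _ _ H) in H'.
- cbv beta in H'. rewrite cos_PI2, sin_0 in H'.
  unfold csin_re, csin_im in H'. rewrite !Rmult_0_r, sin_0, Ropp_0, exp_0 in H'.
  rewrite !pow_ne_zero in H' by lia. lra.
- intros x. unfold ccos_re, csin_re, csin_im, ccos_im. auto_derive; auto.
  replace (Init.Nat.pred (n + 1)) with n by lia.
  replace (Init.Nat.pred (n + 2)) with (n + 1)%nat by lia.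
  fold N. rewrite !pow_add.
  replace N with (INR n + 2) by (unfold N; rewrite plus_INR; simpl; ring).
  rewrite plus_INR. simpl (INR 1).
  assert (E : sin x * sin x = 1 - cos x * cos x).
  { pose proof (sin2_cos2 x). unfold Rsqr in *; lra. }
  match goal with |- ?l = ?r => ring_simplify l; ring_simplify r end.
  replace (sin x ^ 2) with (1 - cos x * cos x) by (rewrite <- E; ring). field.
- intros x. unfold ccos_re, ccos_im. auto_derive; auto.
Qed.

Lemma cosine_integral_1_re : (1 - (al ^ 2 - be ^ 2)) * cosine_integral_re 1 + 2 * al * be * cosine_integral_im 1 = ccos_re (PI / 2).
Proof.
assert (H := is_RInt_lin3 _ _ _ (1 - (al ^ 2 - be ^ 2)) (2 * al * be) 0
  _ _ _ (is_RInt_ccos_re 1) (is_RInt_ccos_im 1) (is_RInt_ccos_re 1)).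
(* The same primitive for N = 1, where the first term carries no power of cos x. Its value at
   [PI / 2] survives and is the source of cos (PI z / 2). *)
assert (H' := is_RInt_antiderivative
  (fun x => sin x * ccos_re x - (al * csin_re x - be * csin_im x) * cos x ^ 1)
  (fun x => (1 - (al ^ 2 - be ^ 2)) * (ccos_re x * cos x ^ 1)
     + 2 * al * be * (ccos_im x * cos x ^ 1)
     + 0 * (ccos_re x * cos x ^ 1)) 0 (PI / 2)).
apply (is_RInt_eq _ _ _ _ _ H) in H'.
- cbv beta in H'. rewrite cos_PI2, sin_0, sin_PI2 in H'.
  unfold csin_re, csin_im in H'. rewrite !Rmult_0_r, sin_0, Ropp_0, exp_0 in H'. lra.
- intros x. unfold ccos_re, csin_re, csin_im, ccos_im. auto_derive; auto. field.
- intros x. unfold ccos_re, ccos_im. auto_derive; auto.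
Qed.

Lemma cosine_integral_1_im : (1 - (al ^ 2 - be ^ 2)) * cosine_integral_im 1 - 2 * al * be * cosine_integral_re 1 = ccos_im (PI / 2).
Proof.
assert (H := is_RInt_lin3 _ _ _ (1 - (al ^ 2 - be ^ 2)) (- (2 * al * be)) 0
  _ _ _ (is_RInt_ccos_im 1) (is_RInt_ccos_re 1) (is_RInt_ccos_re 1)).
assert (H' := is_RInt_antiderivative
  (fun x => sin x * ccos_im x - (al * csin_im x + be * csin_re x) * cos x ^ 1)
  (fun x => (1 - (al ^ 2 - be ^ 2)) * (ccos_im x * cos x ^ 1)
     + - (2 * al * be) * (ccos_re x * cos x ^ 1)
     + 0 * (ccos_re x * cos x ^ 1)) 0 (PI / 2)).
apply (is_RInt_eq _ _ _ _ _ H) in H'.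
- cbv beta in H'. rewrite cos_PI2, sin_0, sin_PI2 in H'.
  unfold csin_re, csin_im in H'. rewrite !Rmult_0_r, sin_0, Ropp_0, exp_0 in H'. lra.
- intros x. unfold ccos_re, csin_re, csin_im, ccos_im. auto_derive; auto. field.
- intros x. unfold ccos_re, ccos_im. auto_derive; auto.
Qed.

End CosineIntegrals.

(** Squared, this gives x^2 cos^2 x <= 1 - cos^2 x, which converts an error of order x^2 under the
    integral into a difference of two powers of the cosine. *)
Lemma mul_cos_le_sin x : (0 <= x -> x <= PI / 2 -> 0 <= x * cos x <= sin x)%R.
Proof.
intros H0 H1. split.
{ apply Rmult_le_pos; [auto|]. apply cos_ge_0; lra. }
destruct (MVT_gen (fun t => sin t - t * cos t)%R 0 x (fun t => t * sin t)%R) as [c [Hc H]].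
- intros t _. auto_derive; auto. ring.
- intros t _. apply continuity_pt_filterlim.
  apply (ex_derive_continuous (V := R_NormedModule) (fun t => sin t - t * cos t)%R).
  auto_derive; auto.
- rewrite sin_0 in H. rewrite Rmin_left, Rmax_right in Hc by lra.
  assert (0 <= sin c)%R by (apply sin_ge_0; lra).
  assert (0 <= c * sin c * (x - 0))%R by (repeat apply Rmult_le_pos; lra). lra.
Qed.

(** The Wallis integrals, taken as the case z = 0 so that they inherit the recurrences above. *)
Definition wallis (n : nat) : R := cosine_integral_re 0 0 n.

Lemma is_RInt_wallis n : is_RInt (fun x => cos x ^ n)%R 0 (PI / 2) (wallis n).
Proof.
eapply is_RInt_ext; [|apply (is_RInt_ccos_re 0 0)].
intros x _. unfold ccos_re. rewrite !Rmult_0_l, Ropp_0, cos_0, exp_0. simpl. lra.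
Qed.

Lemma wallis_0 : wallis 0 = (PI / 2)%R.
Proof.
eapply is_RInt_eq; [apply is_RInt_wallis|].
evar_last; [apply (is_RInt_const (V := R_NormedModule) 0 (PI / 2) 1%R)|].
unfold scal; simpl; unfold mult; simpl; ring.
Qed.

Lemma wallis_1 : wallis 1 = 1%R.
Proof.
assert (H := cosine_integral_1_re 0 0). unfold ccos_re in H. rewrite !Rmult_0_l, Ropp_0, cos_0, exp_0 in H.
unfold wallis. lra.
Qed.

Lemma wallis_SS n : (INR (n + 2) * wallis (n + 2) = INR (n + 1) * wallis n)%R.
Proof.
assert (H := cosine_integral_rec_re 0 0 n). fold (wallis n) in H. fold (wallis (n + 2)) in H.
assert (0 < INR (n + 2))%R by (apply lt_0_INR; lia). nra.
Qed.

Lemma wallis_mul n : (INR (n + 1) * wallis n * wallis (n + 1) = PI / 2)%R.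
Proof.
induction n as [|n IH].
- simpl (0 + 1)%nat. rewrite wallis_0, wallis_1. simpl; ring.
- replace (S n + 1)%nat with (n + 2)%nat by lia. replace (S n) with (n + 1)%nat by lia.
  transitivity (wallis (n + 1) * (INR (n + 2) * wallis (n + 2)))%R; [ring|].
  rewrite wallis_SS, <- IH. ring.
Qed.

Lemma wallis_pos n : (0 < wallis n)%R.
Proof.
assert (H : (0 < wallis n /\ 0 < wallis (n + 1))%R); [|apply H].
induction n as [|n [IH1 IH2]].
- simpl (0 + 1)%nat. rewrite wallis_0, wallis_1. pose proof PI_RGT_0. lra.
- replace (S n + 1)%nat with (n + 2)%nat by lia. replace (S n) with (n + 1)%nat by lia.
  split; [auto|].
  assert (H := wallis_SS n).
  assert (0 < INR (n + 2))%R by (apply lt_0_INR; lia).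
  assert (0 < INR (n + 1))%R by (apply lt_0_INR; lia). nra.
Qed.

Lemma wallis_decr n : (wallis (n + 1) <= wallis n)%R.
Proof.
eapply is_RInt_le; [|apply is_RInt_wallis|apply is_RInt_wallis|].
- pose proof PI_RGT_0; lra.
- intros x Hx. cbv beta. rewrite pow_add, pow_1.
  assert (0 <= cos x)%R by (apply cos_ge_0; lra).
  pose proof (COS_bound x). pose proof (pow_le _ n H). nra.
Qed.

Lemma wallis_even n : RtoC (wallis (2 * n)) =
  RtoC (PI / 2) * pochhammer (1 / 2) n / INR (fact n).
Proof.
induction n as [|n IH].
- simpl (2 * 0)%nat. rewrite wallis_0. simpl. field.
- replace (2 * S n)%nat with (2 * n + 2)%nat by lia.
  assert (H : ((2 * INR n + 2) * wallis (2 * n + 2) = (2 * INR n + 1) * wallis (2 * n))%R).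
  { pose proof (wallis_SS (2 * n)) as H. rewrite !plus_INR, mult_INR in H. simpl (INR 2) in H.
    simpl (INR 1) in H. lra. }
  apply (f_equal RtoC) in H.
  rewrite !RtoC_mult, IH, !RtoC_plus, !RtoC_mult in H.
  assert (Hf := RtoC_neq_0 _ (INR_fact_neq_0 n)).
  assert (Hn1 : INR n + 1 <> 0).
  { rewrite <- RtoC_plus. apply RtoC_neq_0. pose proof (pos_INR n); lra. }
  assert (Hn : 2 * INR n + 2 <> 0).
  { replace (2 * INR n + 2) with (2 * (INR n + 1)) by ring.
    apply Cmult_neq_0; [apply RtoC_neq_0; lra | exact Hn1]. }
  replace (RtoC (INR (fact (S n)))) with ((INR n + 1) * INR (fact n)).
  2:{ rewrite fact_simpl, mult_INR, RtoC_mult, RtoC_S. reflexivity. }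
  simpl pochhammer.
  replace (RtoC (wallis (2 * n + 2))) with
    ((2 * INR n + 2) * wallis (2 * n + 2) / (2 * INR n + 2)) by (field; auto).
  rewrite H. field. repeat split; auto.
Qed.

(** On the interval, cos (z x) - 1 is O(x^2), and x^2 cos^(n+2) x <= cos^n x - cos^(n+2) x;
    integrate. The real and imaginary parts contribute one constant each. *)
Lemma cosine_integral_bound al be : exists K, (0 <= K)%R /\ forall n,
  (Cmod ((cosine_integral_re al be (n + 2), cosine_integral_im al be (n + 2)) - wallis (n + 2))
    <= K * (wallis n - wallis (n + 2)))%R.
Proof.
(* [M] bounds |z x| on the interval, since PI <= 4 gives x <= 2. *)
set (M := (Cmod (al, be) * 2)%R).
assert (HM : (0 <= M)%R) by (unfold M; pose proof (Cmod_ge_0 (al, be)); lra).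
set (K := (4 * M ^ 2 * exp M)%R).
assert (HK : (0 <= K)%R) by (unfold K; pose proof (exp_pos M); nra).
assert (HB : forall x, (0 <= x <= PI / 2)%R ->
  (Rabs (ccos_re al be x - 1) <= K * x ^ 2 /\ Rabs (ccos_im al be x) <= K * x ^ 2)%R).
{ intros x Hx.
  assert (H := Ccos_second_order ((al, be) * x)). rewrite Ccos_Re_Im in H.
  destruct (Re_Im_le_Cmod ((ccos_re al be x, ccos_im al be x) - 1)) as [H1 H2].
  rewrite Re_minus in H1. rewrite Im_minus in H2. simpl in H1, H2. rewrite Rminus_0_r in H2.
  rewrite Cmod_mult, Cmod_R, Rabs_pos_eq in H by apply Hx.
  assert (HP := PI_4).
  assert (Hc := Cmod_ge_0 (al, be)).
  assert (HMx : (Cmod (al, be) * x <= M)%R).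
  { unfold M. apply Rmult_le_compat_l; lra. }
  assert (HE := exp_mono _ _ HMx).
  assert (HF : (4 * (Cmod (al, be) * x) ^ 2 * exp (Cmod (al, be) * x) <= K * x ^ 2)%R).
  { unfold K. pose proof (exp_pos (Cmod (al, be) * x)).
    apply Rle_trans with (4 * (Cmod (al, be) * x) ^ 2 * exp M)%R.
    - apply Rmult_le_compat_l; [nra | auto].
    - replace (4 * M ^ 2 * exp M * x ^ 2)%R with (4 * (M * x) ^ 2 * exp M)%R by ring.
      apply Rmult_le_compat_r; [left; apply exp_pos|].
      apply Rmult_le_compat_l; [lra|]. apply pow_incr. unfold M. split; nra. }
  lra. }
exists (2 * K)%R; split; [lra|]. intros n.
eapply Rle_trans; [apply Cmod_le_Re_Im|].
rewrite Re_minus, Im_minus. simpl Re. simpl Im. rewrite Rminus_0_r.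
assert (HX : forall x, (0 < x < PI / 2)%R ->
  (0 <= cos x ^ (n + 2) /\ x ^ 2 * cos x ^ (n + 2) <= cos x ^ n - cos x ^ (n + 2))%R).
{ intros x Hx. destruct (mul_cos_le_sin x) as [H1 H2]; try lra.
  assert (Hc : (0 <= cos x)%R) by (apply cos_ge_0; lra).
  split; [now apply pow_le|].
  rewrite pow_add. assert (Hn := pow_le _ n Hc).
  replace (x ^ 2 * (cos x ^ n * cos x ^ 2))%R with (cos x ^ n * (x * cos x) ^ 2)%R by ring.
  replace (cos x ^ n - cos x ^ n * cos x ^ 2)%R with (cos x ^ n * (1 - cos x ^ 2))%R by ring.
  apply Rmult_le_compat_l; [auto|].
  pose proof (sin2_cos2 x) as HS. unfold Rsqr in HS. nra. }
assert (HPI := PI_RGT_0).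
assert (HD : is_RInt (fun x => K * (cos x ^ n - cos x ^ (n + 2)))%R 0 (PI / 2)
     (K * (wallis n - wallis (n + 2)))%R).
{ apply (is_RInt_scal (V := R_NormedModule)), (is_RInt_minus (V := R_NormedModule)); apply is_RInt_wallis. }
assert (HD' : is_RInt (fun x => - (K * (cos x ^ n - cos x ^ (n + 2))))%R 0 (PI / 2)
     (- (K * (wallis n - wallis (n + 2))))%R).
{ now apply (is_RInt_opp (V := R_NormedModule)). }
assert (H1 : is_RInt (fun x => ccos_re al be x * cos x ^ (n + 2) - cos x ^ (n + 2))%R 0 (PI / 2)
     (cosine_integral_re al be (n + 2) - wallis (n + 2))%R).
{ apply (is_RInt_minus (V := R_NormedModule)); [apply is_RInt_ccos_re | apply is_RInt_wallis]. }
assert (H2 := is_RInt_ccos_im al be (n + 2)).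
replace (2 * K * (wallis n - wallis (n + 2)))%R with
  (K * (wallis n - wallis (n + 2)) + K * (wallis n - wallis (n + 2)))%R by ring.
apply Rplus_le_compat; apply Rabs_le; split.
- eapply is_RInt_le; [|exact HD'|exact H1|]; [lra|]. intros x Hx.
  destruct (HX x Hx) as [P1 P2]. destruct (HB x) as [Q1 _]; [lra|].
  apply Rabs_le_between in Q1. nra.
- eapply is_RInt_le; [|exact H1|exact HD|]; [lra|]. intros x Hx.
  destruct (HX x Hx) as [P1 P2]. destruct (HB x) as [Q1 _]; [lra|].
  apply Rabs_le_between in Q1. nra.
- eapply is_RInt_le; [|exact HD'|exact H2|]; [lra|]. intros x Hx.
  destruct (HX x Hx) as [P1 P2]. destruct (HB x) as [_ Q1]; [lra|].
  apply Rabs_le_between in Q1. nra.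
- eapply is_RInt_le; [|exact H2|exact HD|]; [lra|]. intros x Hx.
  destruct (HX x Hx) as [P1 P2]. destruct (HB x) as [_ Q1]; [lra|].
  apply Rabs_le_between in Q1. nra.
Qed.

(** By the recurrence, [wallis n - wallis (n + 2)] equals [wallis (n + 2)] divided by n + 1, so the
    relative error in [cosine_integral_bound] is O(1/n). *)
Lemma cosine_integral_ratio_lim al be :
  Clim (fun n => (cosine_integral_re al be (n + 2), cosine_integral_im al be (n + 2)) / wallis (n + 2)) 1.
Proof.
destruct (cosine_integral_bound al be) as [K [HK H]].
apply Clim_dominated with (fun n => K * / INR (S n))%R.
- exists O; intros n _.
  assert (Hw := wallis_pos (n + 2)).
  assert (Hw0 : RtoC (wallis (n + 2)) <> 0) by (apply RtoC_neq_0; lra).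
  replace ((cosine_integral_re al be (n + 2), cosine_integral_im al be (n + 2)) / wallis (n + 2) - 1) with
    (((cosine_integral_re al be (n + 2), cosine_integral_im al be (n + 2)) - wallis (n + 2)) / wallis (n + 2)) by (field; auto).
  rewrite Cmod_div, Cmod_R, Rabs_pos_eq by (auto; lra).
  apply Rle_div_l; [lra|].
  eapply Rle_trans; [apply H|]. rewrite Rmult_assoc. apply Rmult_le_compat_l; [auto|].
  assert (E := wallis_SS n). rewrite !plus_INR in E. simpl (INR 1) in E. simpl (INR 2) in E.
  rewrite S_INR. pose proof (pos_INR n).
  apply Rmult_le_reg_l with (INR n + 1)%R; [lra|].
  replace ((INR n + 1) * (/ (INR n + 1) * wallis (n + 2)))%R with (wallis (n + 2)) by (field; lra).
  nra.
- evar_last; [apply is_lim_seq_mult'; [apply is_lim_seq_const|]|].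
  + apply (is_lim_seq_incr_1 (fun n => / INR n)%R), is_lim_seq_inv_INR.
  + simpl; f_equal; ring.
Qed.

Lemma INR_2m m : INR (2 * m + 1 + 2) = (2 * INR m + 3)%R.
Proof. rewrite !plus_INR, mult_INR; simpl; ring. Qed.

Lemma cosine_integral_rec al be n :
  ((INR (n + 2)) ^ 2 - (al, be) ^ 2) * (cosine_integral_re al be (n + 2), cosine_integral_im al be (n + 2)) =
  INR (n + 2) * INR (n + 1) * (cosine_integral_re al be n, cosine_integral_im al be n).
Proof.
apply C_ext.
- transitivity ((INR (n + 2) ^ 2 - (al ^ 2 - be ^ 2)) * cosine_integral_re al be (n + 2)
    + 2 * al * be * cosine_integral_im al be (n + 2))%R; [simpl; ring|].
  rewrite cosine_integral_rec_re. simpl; ring.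
- transitivity ((INR (n + 2) ^ 2 - (al ^ 2 - be ^ 2)) * cosine_integral_im al be (n + 2)
    - 2 * al * be * cosine_integral_re al be (n + 2))%R; [simpl; ring|].
  rewrite cosine_integral_rec_im. simpl; ring.
Qed.

Lemma cosine_integral_1 al be :
  (1 - (al, be) ^ 2) * (cosine_integral_re al be 1, cosine_integral_im al be 1) = Ccos ((al, be) * (PI / 2)%R).
Proof.
rewrite Ccos_Re_Im. apply C_ext.
- transitivity ((1 - (al ^ 2 - be ^ 2)) * cosine_integral_re al be 1 + 2 * al * be * cosine_integral_im al be 1)%R; [simpl; ring|].
  apply cosine_integral_1_re.
- transitivity ((1 - (al ^ 2 - be ^ 2)) * cosine_integral_im al be 1 - 2 * al * be * cosine_integral_re al be 1)%R; [simpl; ring|].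
  apply cosine_integral_1_im.
Qed.

(** The finite form of the reflection formula. With z = 2s, each factor (2k+1)^2 - z^2 of the
    recurrence is 4 (k + 1/2 + s) (k + 1/2 - s), so the products are Pochhammer symbols; the Wallis
    recurrence does the same with s = 0. *)
Lemma cosine_integral_odd (s : C) m :
  pochhammer (1 / 2 + s) (S m) * pochhammer (1 / 2 - s) (S m) *
    (cosine_integral_re (2 * Re s) (2 * Im s) (2 * m + 1), cosine_integral_im (2 * Re s) (2 * Im s) (2 * m + 1)) =
  pochhammer (1 / 2) (S m) ^ 2 * wallis (2 * m + 1) * Ccos (PI * s).
Proof.
assert (Es : ((2 * Re s)%R, (2 * Im s)%R) = 2 * s) by (destruct s; apply C_ext; simpl; ring).
induction m as [|m IH].
- simpl (2 * 0 + 1)%nat. rewrite wallis_1.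
  assert (H := cosine_integral_1 (2 * Re s) (2 * Im s)). rewrite Es in H.
  replace (2 * s * RtoC (PI / 2)) with (PI * s) in H by (rewrite RtoC_div by lra; field).
  rewrite <- H. simpl pochhammer. field.
- assert (H := cosine_integral_rec (2 * Re s) (2 * Im s) (2 * m + 1)). rewrite Es in H.
  assert (H0 := wallis_SS (2 * m + 1)). apply (f_equal RtoC) in H0.
  rewrite !RtoC_mult in H0.
  replace (2 * S m + 1)%nat with (2 * m + 1 + 2)%nat by lia.
  change (pochhammer ?z (S (S m))) with (pochhammer z (S m) * (z + INR (S m))).
  set (I := (cosine_integral_re _ _ (2 * m + 1 + 2), _)) in *.
  set (I' := (cosine_integral_re _ _ (2 * m + 1), _)) in *.
  set (p1 := pochhammer (1 / 2 + s) (S m)) in *.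
  set (p2 := pochhammer (1 / 2 - s) (S m)) in *.
  set (p3 := pochhammer (1 / 2) (S m)) in *.
  rewrite INR_2m in H, H0.
  replace (INR (2 * m + 1 + 1)) with (2 * INR m + 2)%R in H, H0
    by (rewrite !plus_INR, mult_INR; simpl; ring).
  rewrite !RtoC_plus, !RtoC_mult in H, H0. rewrite RtoC_S.
  transitivity (p1 * p2 * (((2 * INR m + 3) ^ 2 - (2 * s) ^ 2) * I) / 4); [field|].
  rewrite H.
  transitivity ((p1 * p2 * I') * ((2 * INR m + 3) * (2 * INR m + 2)) / 4); [field|].
  rewrite IH.
  transitivity (p3 ^ 2 * Ccos (PI * s) * (2 * INR m + 3) / 4 *
    ((2 * INR m + 2) * wallis (2 * m + 1))); [field|].
  rewrite <- H0. field.
Qed.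

Lemma rGamma_half_mul s :
  rGamma (1 / 2 + s) * rGamma (1 / 2 - s) = rGamma (1 / 2) ^ 2 * Ccos (PI * s).
Proof.
apply Clim_unique with (fun n => rgamma_approx (1 / 2 + s) n * rgamma_approx (1 / 2 - s) n).
{ apply Clim_mult; apply rGamma_lim. }
(* At order n + 2 the integral has index 2 (n + 1) + 1 = (2n + 1) + 2, the form covered by
   [cosine_integral_ratio_lim]. *)
apply Clim_incr_n with 2%nat.
set (J := fun n => (cosine_integral_re (2 * Re s) (2 * Im s) (n + 2), cosine_integral_im (2 * Re s) (2 * Im s) (n + 2)) : C).
assert (HJ : Clim (fun n => J (2 * n + 1)%nat / wallis (2 * n + 1 + 2)) 1).
{ assert (HJ0 := cosine_integral_ratio_lim (2 * Re s) (2 * Im s)).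
  assert (Hphi : forall n, (n <= 2 * n + 1)%nat) by (intros; lia).
  exact (Clim_subseq _ _ (fun n => (2 * n + 1)%nat) Hphi HJ0). }
assert (HL : Clim (fun n => rgamma_approx (1 / 2) (n + 2) ^ 2 * Ccos (PI * s)
   / (J (2 * n + 1)%nat / wallis (2 * n + 1 + 2))) (rGamma (1 / 2) ^ 2 * Ccos (PI * s) / 1)).
{ apply Clim_div; [exact C1_nz| |exact HJ].
  apply Clim_mult; [|apply Clim_const].
  assert (Hs := Clim_subseq _ _ (fun n => (n + 2)%nat) ltac:(intros; cbv beta; lia) (rGamma_lim (1 / 2))).
  simpl. apply Clim_mult; [exact Hs|]. apply Clim_mult; [exact Hs | apply Clim_const]. }
replace (rGamma (1 / 2) ^ 2 * Ccos (PI * s) / 1) with (rGamma (1 / 2) ^ 2 * Ccos (PI * s)) in HL by field.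
eapply Clim_ext_loc; [|exact HL].
(* The integrals are eventually nonzero because their ratio to the Wallis integrals tends to 1; this
   permits dividing by them. *)
assert (HJ0 : exists N, forall n, (N <= n)%nat -> J (2 * n + 1)%nat <> 0).
{ destruct (proj1 (Clim_eps _ _) HJ (mkposreal 1 Rlt_0_1)) as [N HN]. exists N.
  intros n Hn E. specialize (HN n Hn). simpl pos in HN. cbv beta in HN. rewrite E in HN.
  replace (0 / wallis (2 * n + 1 + 2) - 1) with (- (1)) in HN.
  - rewrite Cmod_m1 in HN; lra.
  - field. apply RtoC_neq_0. pose proof (wallis_pos (2 * n + 1 + 2)); lra. }
destruct HJ0 as [N HN]. exists N. intros n Hn. specialize (HN n Hn).
assert (H := cosine_integral_odd s (n + 1)).
replace (2 * (n + 1) + 1)%nat with (2 * n + 1 + 2)%nat in H by lia.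
fold (J (2 * n + 1)%nat) in H.
replace (S (n + 1)) with (n + 2)%nat in H by lia.
unfold rgamma_approx.
assert (Hn0 : (0 < INR (n + 2))%R) by (apply lt_0_INR; lia).
replace (1 - (1 / 2 + s)) with (1 / 2 + - s) by field.
replace (1 - (1 / 2 - s)) with (1 / 2 + s) by field.
replace (1 - 1 / 2) with (RtoC 1 / 2) by field.
rewrite !Rpow_C_plus, Rpow_C_opp.
assert (Hr := Rpow_C_neq_0 (INR (n + 2)) s).
assert (Hf := RtoC_neq_0 _ (INR_fact_neq_0 (n + 2))).
assert (Hw : RtoC (wallis (2 * n + 1 + 2)) <> 0).
{ apply RtoC_neq_0. pose proof (wallis_pos (2 * n + 1 + 2)); lra. }
set (p3 := pochhammer (1 / 2) (n + 2)) in *.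
set (r := Rpow_C (INR (n + 2)) (1 / 2)) in *.
clearbody p3.
transitivity ((p3 ^ 2 * wallis (2 * n + 1 + 2) * Ccos (PI * s)) *
   (r ^ 2 / INR (fact (n + 2)) ^ 2 / J (2 * n + 1)%nat)).
- field. auto.
- rewrite <- H.
  generalize dependent (RtoC (INR (fact (n + 2)))).
  generalize dependent (J (2 * n + 1)%nat).
  generalize dependent (Rpow_C (INR (n + 2)) s).
  intros r1 Hr j HN _ f Hf. clearbody r. field. auto.
Qed.

(** Wallis' product. The approximant at 1/2 is W_(2n) sqrt n / (PI/2), and (2n+1) W_(2n) W_(2n+1) =
    PI/2 turns its square into [x n], whose limit 1/PI follows from W_(2n) / W_(2n+1) -> 1. *)
Lemma rGamma_half : rGamma (1 / 2) = / sqrt PI.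
Proof.
assert (HPI := PI_RGT_0).
set (x := fun n => ((2 * INR n / (2 * INR n + 1)) / PI * (wallis (2 * n) / wallis (2 * n + 1)))%R).
assert (Hx : is_lim_seq x (/ PI)%R).
{ assert (Hq : is_lim_seq (fun n => wallis (2 * n) / wallis (2 * n + 1))%R 1).
  { apply is_lim_seq_le_le_loc with (fun _ => 1%R) (fun n => 1 + / INR n)%R.
    - exists 1%nat; intros n Hn.
      assert (Hn1 : (1 <= INR n)%R) by (now apply (le_INR 1)).
      assert (H1 := wallis_decr (2 * n)). assert (H2 := wallis_decr (2 * n + 1)).
      assert (H3 := wallis_SS (2 * n)). assert (H4 := wallis_pos (2 * n + 1)).
      replace (2 * n + 1 + 1)%nat with (2 * n + 2)%nat in H2 by lia.
      rewrite !plus_INR, mult_INR in H3. simpl (INR 1) in H3. simpl (INR 2) in H3.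
      split.
      + apply Rle_div_r; lra.
      + apply Rle_div_l; [lra|].
        apply Rmult_le_reg_l with (2 * INR n + 1)%R; [lra|].
        replace ((2 * INR n + 1) * wallis (2 * n))%R with ((2 * INR n + 2) * wallis (2 * n + 2))%R by lra.
        apply Rle_trans with ((2 * INR n + 2) * wallis (2 * n + 1))%R; [nra|].
        rewrite <- Rmult_assoc. apply Rmult_le_compat_r; [lra|].
        replace ((2 * INR n + 1) * (1 + / INR n))%R with (2 * INR n + 1 + 2 + / INR n)%R by (field; lra).
        assert (0 < / INR n)%R by (apply Rinv_0_lt_compat; lra). lra.
    - apply is_lim_seq_const.
    - evar_last; [apply is_lim_seq_plus'; [apply is_lim_seq_const | apply is_lim_seq_inv_INR]|].
      simpl; f_equal; ring. }
  assert (Hr : is_lim_seq (fun n => 2 * INR n / (2 * INR n + 1))%R 1).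
  { apply is_lim_seq_le_le_loc with (fun n => 1 - / INR n)%R (fun _ => 1%R).
    - exists 1%nat; intros n Hn.
      assert (Hn1 : (1 <= INR n)%R) by (now apply (le_INR 1)).
      split.
      + apply Rle_div_r; [lra|].
        replace ((1 - / INR n) * (2 * INR n + 1))%R with (2 * INR n - 1 - / INR n)%R by (field; lra).
        assert (0 < / INR n)%R by (apply Rinv_0_lt_compat; lra). lra.
      + apply Rle_div_l; lra.
    - evar_last; [apply is_lim_seq_minus'; [apply is_lim_seq_const | apply is_lim_seq_inv_INR]|].
      simpl; f_equal; ring.
    - apply is_lim_seq_const. }
  unfold x. evar_last; [apply is_lim_seq_mult'; [|exact Hq]|].
  - apply is_lim_seq_mult'; [exact Hr | apply is_lim_seq_const].
  - simpl; f_equal; field; lra. }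
rewrite <- RtoC_inv by (apply Rgt_not_eq, sqrt_lt_R0; lra).
rewrite <- sqrt_inv.
apply Clim_unique with (rgamma_approx (1 / 2)); [apply rGamma_lim|].
apply Clim_ext_loc with (fun n => RtoC (sqrt (x n))).
2:{ apply Clim_RtoC. apply is_lim_seq_continuous; [|exact Hx].
    apply continuity_pt_sqrt. left. now apply Rinv_0_lt_compat. }
exists 1%nat; intros n Hn. unfold rgamma_approx.
replace (1 - 1 / 2) with (RtoC 1 / 2) by field.
assert (Hn0 : (0 < INR n)%R) by (apply lt_0_INR; lia).
rewrite Rpow_C_half by auto.
assert (Hf := RtoC_neq_0 _ (INR_fact_neq_0 n)).
assert (HPI0 : RtoC (PI / 2) <> 0) by (apply RtoC_neq_0; lra).
transitivity (wallis (2 * n) / (PI / 2)%R * sqrt (INR n)).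
2:{ rewrite wallis_even. field. auto. }
rewrite <- RtoC_div, <- RtoC_mult by lra. f_equal.
assert (HW := wallis_pos (2 * n)). assert (HW1 := wallis_pos (2 * n + 1)).
rewrite <- (sqrt_square (wallis (2 * n) / (PI / 2))).
2:{ apply Rlt_le, Rdiv_lt_0_compat; lra. }
rewrite <- sqrt_mult_alt by nra. f_equal. unfold x.
assert (H := wallis_mul (2 * n)). rewrite plus_INR, mult_INR in H. simpl (INR 2) in H. simpl (INR 1) in H.
assert (E : (2 * INR n + 1 = PI / 2 / (wallis (2 * n) * wallis (2 * n + 1)))%R).
{ rewrite <- H. field. lra. }
rewrite E. field. lra.
Qed.

Lemma rGamma_reflection_half s :
  rGamma (1 / 2 + s) * rGamma (1 / 2 - s) = Ccos (PI * s) / PI.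
Proof.
rewrite rGamma_half_mul, rGamma_half.
assert (HPI := PI_RGT_0).
assert (H : RtoC (sqrt PI) <> 0) by (apply RtoC_neq_0, Rgt_not_eq, sqrt_lt_R0, HPI).
replace (RtoC PI) with (sqrt PI * sqrt PI) at 3.
- field. exact H.
- rewrite <- RtoC_mult, sqrt_sqrt; auto; lra.
Qed.

(** * Convergence of hypergeometric series at 3/4 *)

Notation Csum_n := (sum_n (G := C_AbelianMonoid)).

Lemma is_series_Clim (u : nat -> C) (l : C) :
  @is_series C_AbsRing C_NormedModule u l <-> Clim (Csum_n u) l.
Proof. exact (Clim_filterlim (Csum_n u) l). Qed.

Lemma ratio_geometric (v : nat -> R) (q : R) (N : nat) :
  (0 <= q)%R -> (forall n, (N <= n)%nat -> (v (S n) <= q * v n)%R) ->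
  forall k, (v (N + k)%nat <= v N * q ^ k)%R.
Proof.
intros Hq H k. induction k as [|k IH].
- rewrite Nat.add_0_r. simpl; lra.
- rewrite Nat.add_succ_r. eapply Rle_trans; [apply H; lia|]. simpl. nra.
Qed.

Lemma ex_series_Cmod_ratio (u : nat -> C) (q : R) (N : nat) :
  (0 <= q < 1)%R -> (forall n, (N <= n)%nat -> (Cmod (u (S n)) <= q * Cmod (u n))%R) ->
  ex_series (fun n => Cmod (u n)).
Proof.
intros Hq H. apply (ex_series_incr_n _ N).
apply (ex_series_le (K := R_AbsRing) (V := R_CompleteNormedModule)) with (fun k => Cmod (u N) * q ^ k)%R.
- intros k. unfold norm; simpl. unfold abs; simpl. rewrite Rabs_pos_eq by apply Cmod_ge_0.
  apply (ratio_geometric (fun n => Cmod (u n))); [lra | auto].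
- apply (ex_series_scal_l (K := R_AbsRing) (V := R_NormedModule)).
  apply ex_series_geom. rewrite Rabs_pos_eq; lra.
Qed.

Lemma ex_series_C (u : nat -> C) : ex_series (fun n => Cmod (u n)) ->
  @ex_series C_AbsRing C_NormedModule u.
Proof.
intros H. apply (ex_series_le (K := C_AbsRing) (V := C_CompleteNormedModule)) with (fun n => Cmod (u n)).
- intros n. exact (Rle_refl (Cmod (u n))).
- exact H.
Qed.

Lemma hyp3F2_term_S a1 a2 a3 b1 b2 w n :
  ~ nonpos_int b1 -> ~ nonpos_int b2 ->
  hyp3F2_term a1 a2 a3 b1 b2 w (S n) = hyp3F2_term a1 a2 a3 b1 b2 w n *
    ((a1 + INR n) * (a2 + INR n) * (a3 + INR n) * w /
      ((b1 + INR n) * (b2 + INR n) * (INR n + 1))).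
Proof.
intros H1 H2. unfold hyp3F2_term.
assert (P1 := pochhammer_neq_0 b1 n H1). assert (P2 := pochhammer_neq_0 b2 n H2).
assert (Q1 := nonpos_int_plus_neq_0 b1 n H1). assert (Q2 := nonpos_int_plus_neq_0 b2 n H2).
assert (Hf := RtoC_neq_0 _ (INR_fact_neq_0 n)).
replace (RtoC (INR (fact (S n)))) with ((INR n + 1) * INR (fact n)).
2:{ rewrite fact_simpl, mult_INR, RtoC_mult, RtoC_S. reflexivity. }
assert (Hn1 : INR n + 1 <> 0).
{ rewrite <- RtoC_plus. apply RtoC_neq_0. pose proof (pos_INR n); lra. }
simpl pochhammer. simpl Cpow. field. repeat split; auto.
Qed.

Lemma Cmod_plus_INR_bounds z M n : (Cmod z <= M)%R ->
  (INR n - M <= Cmod (z + INR n) <= INR n + M)%R.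
Proof.
intros H.
assert (E : Cmod (INR n) = INR n) by (rewrite Cmod_R; apply Rabs_pos_eq, pos_INR).
split.
- pose proof (Cmod_triangle (z + INR n) (- z)) as T.
  replace (z + INR n + - z) with (RtoC (INR n)) in T by ring. rewrite Cmod_opp, E in T. lra.
- pose proof (Cmod_triangle z (INR n)). lra.
Qed.

(** Past the threshold, n + M <= 1.02 (n - M), and 1.02^3 times 3/4 is below 7/8. The threshold
    depends on the parameters only through [M], so the decay is uniform for nearby parameters;
    continuity of the sum relies on this. *)
Lemma hyp3F2_term_ratio_le M n a1 a2 a3 b1 b2 :
  ~ nonpos_int b1 -> ~ nonpos_int b2 ->
  (Cmod a1 <= M)%R -> (Cmod a2 <= M)%R -> (Cmod a3 <= M)%R ->
  (Cmod b1 <= M)%R -> (Cmod b2 <= M)%R -> (200 * (M + 1) <= INR n)%R ->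
  (Cmod (hyp3F2_term a1 a2 a3 b1 b2 (3 / 4) (S n)) <=
    7 / 8 * Cmod (hyp3F2_term a1 a2 a3 b1 b2 (3 / 4) n))%R.
Proof.
intros h1 h2 H1 H2 H3 H4 H5 Hn.
rewrite hyp3F2_term_S, Cmod_mult, Rmult_comm by auto.
apply Rmult_le_compat_r; [apply Cmod_ge_0|].
assert (Hn1 : INR n + 1 <> 0).
{ rewrite <- RtoC_plus. apply RtoC_neq_0. pose proof (pos_INR n); lra. }
rewrite Cmod_div by
  (repeat apply Cmult_neq_0; auto using nonpos_int_plus_neq_0).
rewrite !Cmod_mult.
assert (HM : (0 <= M)%R) by (eapply Rle_trans; [apply Cmod_ge_0 | exact H1]).
assert (E : Cmod (3 / 4) = (3 / 4)%R).
{ rewrite <- RtoC_div, Cmod_R, Rabs_pos_eq; lra. }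
assert (E1 : Cmod (INR n + 1) = (INR n + 1)%R).
{ rewrite <- RtoC_plus, Cmod_R, Rabs_pos_eq; [auto|]. pose proof (pos_INR n); lra. }
rewrite E, E1.
destruct (Cmod_plus_INR_bounds _ _ n H1) as [_ B1].
destruct (Cmod_plus_INR_bounds _ _ n H2) as [_ B2].
destruct (Cmod_plus_INR_bounds _ _ n H3) as [_ B3].
destruct (Cmod_plus_INR_bounds _ _ n H4) as [B4 _].
destruct (Cmod_plus_INR_bounds _ _ n H5) as [B5 _].
set (r := (102 / 100 * (INR n - M))%R).
assert (Hr : (INR n + M <= r)%R) by (unfold r; lra).
assert (D : (0 < INR n - M)%R) by lra.
assert (D3 : ((INR n - M) * (INR n - M) * (INR n - M) <=
   Cmod (b1 + INR n) * Cmod (b2 + INR n) * (INR n + 1))%R).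
{ apply Rmult_le_compat; [apply Rmult_le_pos; lra | lra | | lra].
  apply Rmult_le_compat; lra. }
assert (D0 : (0 < (INR n - M) * (INR n - M) * (INR n - M))%R)
  by (repeat apply Rmult_lt_0_compat; lra).
apply Rle_div_l; [lra|].
apply Rle_trans with (r * r * r * (3 / 4))%R.
- apply Rmult_le_compat_r; [lra|].
  apply Rmult_le_compat; [apply Rmult_le_pos; apply Cmod_ge_0 | apply Cmod_ge_0 | | lra].
  apply Rmult_le_compat; try apply Cmod_ge_0; lra.
- unfold r. lra.
Qed.

Lemma ex_nat_ge (x : R) : exists N : nat, forall n, (N <= n)%nat -> (x <= INR n)%R.
Proof.
destruct (nfloor_ex (Rmax x 0)) as [N [_ HN]]; [apply Rmax_r|].
exists (S N). intros n Hn. apply le_INR in Hn. rewrite S_INR in Hn.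
pose proof (Rmax_l x 0). lra.
Qed.

Lemma hyp3F2_terms_decay a1 a2 a3 b1 b2 :
  ~ nonpos_int b1 -> ~ nonpos_int b2 ->
  exists N, forall n, (N <= n)%nat ->
  (Cmod (hyp3F2_term a1 a2 a3 b1 b2 (3 / 4) (S n)) <=
    7 / 8 * Cmod (hyp3F2_term a1 a2 a3 b1 b2 (3 / 4) n))%R.
Proof.
intros h1 h2.
pose proof (Cmod_ge_0 a1). pose proof (Cmod_ge_0 a2). pose proof (Cmod_ge_0 a3).
pose proof (Cmod_ge_0 b1). pose proof (Cmod_ge_0 b2).
set (M := (Cmod a1 + Cmod a2 + Cmod a3 + Cmod b1 + Cmod b2)%R).
destruct (ex_nat_ge (200 * (M + 1))) as [N HN].
exists N. intros n Hn. apply hyp3F2_term_ratio_le with M; auto; unfold M; lra.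
Qed.

Lemma is_series_hyp3F2 a1 a2 a3 b1 b2 :
  ~ nonpos_int b1 -> ~ nonpos_int b2 ->
  @is_series C_AbsRing C_NormedModule (hyp3F2_term a1 a2 a3 b1 b2 (3 / 4))
    (hyp3F2 a1 a2 a3 b1 b2 (3 / 4)).
Proof.
intros h1 h2. destruct (hyp3F2_terms_decay a1 a2 a3 b1 b2 h1 h2) as [N HN].
destruct (ex_series_C _ (ex_series_Cmod_ratio _ (7 / 8) N ltac:(lra) HN)) as [l Hl].
replace (hyp3F2 a1 a2 a3 b1 b2 (3 / 4)) with l; [exact Hl|].
symmetry. apply (@iota_unique C_AbsRing C_CompleteNormedModule); [|exact Hl].
intros y Hy. apply is_series_Clim in Hy. apply is_series_Clim in Hl.
exact (Clim_unique _ _ _ Hy Hl).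
Qed.

(** * The recurrence from a to a + 3 *)

Lemma pochhammer_shift z n : pochhammer z n * (z + INR n) = z * pochhammer (z + 1) n.
Proof.
induction n as [|n IH].
- simpl. ring.
- change (pochhammer z (S n)) with (pochhammer z n * (z + INR n)).
  rewrite IH, RtoC_S. simpl. ring.
Qed.

Lemma pochhammer_shift2 z n :
  pochhammer z n * (z + INR n) * (z + 1 + INR n) = z * (z + 1) * pochhammer (z + 2) n.
Proof.
rewrite pochhammer_shift.
transitivity (z * (pochhammer (z + 1) n * (z + 1 + INR n))); [ring|].
rewrite pochhammer_shift. replace (z + 1 + 1) with (z + 2) by ring. ring.
Qed.

Lemma pochhammer_shift3 z n :
  pochhammer z n * (z + INR n) * (z + 1 + INR n) * (z + 2 + INR n) =
  z * (z + 1) * (z + 2) * pochhammer (z + 3) n.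
Proof.
rewrite pochhammer_shift2.
transitivity (z * (z + 1) * (pochhammer (z + 2) n * (z + 2 + INR n))); [ring|].
rewrite pochhammer_shift. replace (z + 2 + 1) with (z + 3) by ring. ring.
Qed.

Definition strange_term (a : C) : nat -> C :=
  hyp3F2_term a (a + 1 / 2) ((4 * a + 1) / 6) (a + 1 / 4) (a + 3 / 4) (3 / 4).

Definition strange_sum (a : C) : C :=
  hyp3F2 a (a + 1 / 2) ((4 * a + 1) / 6) (a + 1 / 4) (a + 3 / 4) (3 / 4).

(** Numerator of the certificate in the variables A = 2a and N = n + 1, written in Horner form in N
    to suit the growth bound [wz_poly_bound]. *)
Definition wz_poly (A N : C) : C :=
  ((((- 576 * N + (- 3360 - 2112 * A)) * N
   + (- 6880 - 9312 * A - 2784 * A ^ 2)) * N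
   + (- 6000 - 13632 * A - 8928 * A ^ 2 - 1728 * A ^ 3)) * N
   + (- 2084 - 7572 * A - 8472 * A ^ 2 - 3624 * A ^ 3 - 516 * A ^ 4)) * N
   + (- 210 - 1252 * A - 2286 * A ^ 2 - 1688 * A ^ 3 - 534 * A ^ 4 - 60 * A ^ 5).

(** The product (a + 1/4)_3 (a + 3/4)_3 without the factors a + 1/4 and a + 7/4. These two are 3/2
    times c and c + 1 and cancel against the shift of the upper parameter c. *)
Definition wz_factor (a : C) : C :=
  (a + 3 / 4) * (a + 5 / 4) * (a + 9 / 4) * (a + 11 / 4).

Definition wz_base (a : C) : nat -> C :=
  hyp3F2_term (a + 1) (a + 3 / 2) ((4 * a + 1) / 6) (a + 1 / 4) (a + 3 / 4) (3 / 4).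

(* The certificate: the rational function was found by Gosper's algorithm, and is
   multiplied by terms shifted in [a] so that no factor of [a (a + 1/2)] remains in a
   denominator. *)
Definition wz_cert (a : C) (n : nat) : C :=
  3 / 16 * wz_factor a * wz_poly (2 * a) (INR n + 1) * ((4 * a + 1) / 6 + INR n) /
   ((a + 1 / 4 + INR n) * (a + 3 / 4 + INR n) * (a + 5 / 4 + INR n) *
    (a + 7 / 4 + INR n) * (a + 9 / 4 + INR n) * (a + 11 / 4 + INR n)) * wz_base a n.

Lemma nonpos_int_shift z k : ~ nonpos_int z -> ~ nonpos_int (z + INR k).
Proof.
intros H [m E]. apply H. exists (k + m)%nat. rewrite plus_INR, RtoC_plus.
replace z with (z + INR k - INR k) by ring. rewrite E. ring.
Qed.

Lemma INR_3 : RtoC (INR 3) = 3.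
Proof. f_equal; simpl; ring. Qed.

Lemma admissible_factors_neq_0 a N :
  ~ nonpos_int (a + 1 / 4) -> ~ nonpos_int (a + 3 / 4) -> (exists n, N = RtoC (INR n)) ->
  a + 1 / 4 + N <> 0 /\ a + 3 / 4 + N <> 0 /\ a + 5 / 4 + N <> 0 /\ a + 7 / 4 + N <> 0 /\
  a + 9 / 4 + N <> 0 /\ a + 11 / 4 + N <> 0 /\ a + 13 / 4 + N <> 0 /\ a + 15 / 4 + N <> 0.
Proof.
intros h1 h2 [n ->].
assert (H1 := fun k => nonpos_int_plus_neq_0 _ (n + k)%nat h1).
assert (H2 := fun k => nonpos_int_plus_neq_0 _ (n + k)%nat h2).
assert (E : forall x y k, x = y + RtoC (INR k) -> x + INR n = y + INR (n + k)).
{ intros x y k ->. rewrite plus_INR, RtoC_plus. ring. }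
repeat split.
- rewrite (E _ (a + 1 / 4) 0%nat) by (simpl INR; field). apply H1.
- rewrite (E _ (a + 3 / 4) 0%nat) by (simpl INR; field). apply H2.
- rewrite (E _ (a + 1 / 4) 1%nat) by (simpl INR; field). apply H1.
- rewrite (E _ (a + 3 / 4) 1%nat) by (simpl INR; field). apply H2.
- rewrite (E _ (a + 1 / 4) 2%nat) by (rewrite INR_IZR_INZ; simpl IZR; field). apply H1.
- rewrite (E _ (a + 3 / 4) 2%nat) by (rewrite INR_IZR_INZ; simpl IZR; field). apply H2.
- rewrite (E _ (a + 1 / 4) 3%nat) by (rewrite INR_IZR_INZ; simpl IZR; field). apply H1.
- rewrite (E _ (a + 3 / 4) 3%nat) by (rewrite INR_IZR_INZ; simpl IZR; field). apply H2.
Qed.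

(* [field] asks for [l <> 0] where [l] is the left side of [H] with cleared denominators. *)
Ltac nz_by H :=
  apply H; match goal with E : ?l = RtoC 0 |- ?g = _ =>
    first [ transitivity l; [field | exact E]
          | transitivity (l / 2); [field | rewrite E; field]
          | transitivity (l / 4); [field | rewrite E; field]
          | transitivity (l / 6); [field | rewrite E; field] ] end.

(** Shifts the upper parameters by 2 and the lower ones by 3. The prefactor is 16 (a+1) (a+3/2)
    (a+2) (a+5/2), and c (c+1) = (4/9) (a + 1/4) (a + 7/4) changes 16 into 36. *)
Lemma strange_term_shift a n :
  ~ nonpos_int (a + 1 / 4) -> ~ nonpos_int (a + 3 / 4) ->
  (2 * a + 2) * (2 * a + 3) * (2 * a + 4) * (2 * a + 5) * strange_term (a + 3) n =
  36 * wz_factor a * wz_base a n *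
   ((a + 1 + INR n) * (a + 2 + INR n) * (a + 3 / 2 + INR n) * (a + 5 / 2 + INR n) *
    ((4 * a + 1) / 6 + INR n) * ((4 * a + 1) / 6 + 1 + INR n)) /
   ((a + 1 / 4 + INR n) * (a + 3 / 4 + INR n) * (a + 5 / 4 + INR n) *
    (a + 7 / 4 + INR n) * (a + 9 / 4 + INR n) * (a + 11 / 4 + INR n)).
Proof.
intros h1 h2. unfold strange_term, wz_base, hyp3F2_term, wz_factor.
replace (a + 3 + 1 / 2) with (a + 3 / 2 + 2) by field.
replace ((4 * (a + 3) + 1) / 6) with ((4 * a + 1) / 6 + 2) by field.
replace (a + 3 + 1 / 4) with (a + 1 / 4 + 3) by field.
replace (a + 3 + 3 / 4) with (a + 3 / 4 + 3) by field.
replace (a + 3) with (a + 1 + 2) by ring.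
assert (E1 := pochhammer_shift2 (a + 1) n).
assert (E2 := pochhammer_shift2 (a + 3 / 2) n).
assert (E3 := pochhammer_shift2 ((4 * a + 1) / 6) n).
assert (E4 := pochhammer_shift3 (a + 1 / 4) n).
assert (E5 := pochhammer_shift3 (a + 3 / 4) n).
assert (P4 : pochhammer (a + 1 / 4 + 3) n <> 0).
{ apply pochhammer_neq_0. apply (nonpos_int_shift _ 3) in h1. now rewrite INR_3 in h1. }
assert (P5 : pochhammer (a + 3 / 4 + 3) n <> 0).
{ apply pochhammer_neq_0. apply (nonpos_int_shift _ 3) in h2. now rewrite INR_3 in h2. }
assert (P1 := pochhammer_neq_0 _ n h1). assert (P2 := pochhammer_neq_0 _ n h2).
assert (Hf := RtoC_neq_0 _ (INR_fact_neq_0 n)).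
destruct (admissible_factors_neq_0 a (INR n) h1 h2 ltac:(eexists; reflexivity))
  as (N1 & N2 & N3 & N4 & N5 & N6 & _).
destruct (admissible_factors_neq_0 a (INR 0) h1 h2 ltac:(eexists; reflexivity))
  as (M1 & M2 & M3 & M4 & M5 & M6 & _).
simpl INR in M1, M2, M3, M4, M5, M6. rewrite Cplus_0_r in M1, M2, M3, M4, M5, M6.
set (w := (3 / 4) ^ n / INR (fact n)). clearbody w.
revert E1 E2 E3 E4 E5 P1 P2 P4 P5.
generalize (pochhammer (a + 1) n) (pochhammer (a + 1 + 2) n).
generalize (pochhammer (a + 3 / 2) n) (pochhammer (a + 3 / 2 + 2) n).
generalize (pochhammer ((4 * a + 1) / 6) n) (pochhammer ((4 * a + 1) / 6 + 2) n).
generalize (pochhammer (a + 1 / 4) n) (pochhammer (a + 1 / 4 + 3) n).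
generalize (pochhammer (a + 3 / 4) n) (pochhammer (a + 3 / 4 + 3) n).
generalize dependent (RtoC (INR n)). intros N N1 N2 N3 N4 N5 N6.
intros p5 q5 p4 q4 p3 q3 p2 q2 p1 q1 E1 E2 E3 E4 E5 P1 P2 P4 P5.
transitivity (36 * ((a + 1) * (a + 1 + 1) * q1) * ((a + 3 / 2) * (a + 3 / 2 + 1) * q2) *
  ((4 * a + 1) / 6 * ((4 * a + 1) / 6 + 1) * q3) * w * wz_factor a /
  (((a + 1 / 4) * (a + 1 / 4 + 1) * (a + 1 / 4 + 2) * q4) *
   ((a + 3 / 4) * (a + 3 / 4 + 1) * (a + 3 / 4 + 2) * q5))).
- unfold wz_factor. field.
  repeat split; auto; intros E;
    first [nz_by M1 | nz_by M2 | nz_by M3 | nz_by M4 | nz_by M5 | nz_by M6].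
- rewrite <- E1, <- E2, <- E3, <- E4, <- E5. unfold wz_factor.
  replace (a + 1 / 4 + 1 + N) with (a + 5 / 4 + N) by field.
  replace (a + 1 / 4 + 2 + N) with (a + 9 / 4 + N) by field.
  replace (a + 3 / 4 + 1 + N) with (a + 7 / 4 + N) by field.
  replace (a + 3 / 4 + 2 + N) with (a + 11 / 4 + N) by field.
  replace (a + 1 + 1 + N) with (a + 2 + N) by field.
  replace (a + 3 / 2 + 1 + N) with (a + 5 / 2 + N) by field.
  clear E1 E2 E3 E4 E5 M1 M2 M3 M4 M5 M6.
  generalize dependent (a + 1 / 4 + N). generalize dependent (a + 5 / 4 + N).
  generalize dependent (a + 9 / 4 + N). generalize dependent (a + 3 / 4 + N).
  generalize dependent (a + 7 / 4 + N). generalize dependent (a + 11 / 4 + N).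
  intros. field. repeat split; auto.
Qed.

(** Since (a)_(n+1) = a (a+1)_n, the factor a (a + 1/2) appears in the numerator over [wz_base],
    whose first two parameters are raised by one for this purpose. *)
Lemma strange_term_S a n :
  ~ nonpos_int (a + 1 / 4) -> ~ nonpos_int (a + 3 / 4) ->
  strange_term a (S n) = wz_base a n *
   (a * (a + 1 / 2) * ((4 * a + 1) / 6 + INR n) * (3 / 4) /
     ((a + 1 / 4 + INR n) * (a + 3 / 4 + INR n) * (INR n + 1))).
Proof.
intros h1 h2. unfold strange_term. rewrite hyp3F2_term_S by auto.
unfold wz_base, hyp3F2_term.
assert (P1 := pochhammer_neq_0 _ n h1). assert (P2 := pochhammer_neq_0 _ n h2).
assert (Hf := RtoC_neq_0 _ (INR_fact_neq_0 n)).
destruct (admissible_factors_neq_0 a (INR n) h1 h2 ltac:(eexists; reflexivity))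
  as (N1 & N2 & _).
assert (Hn1 : INR n + 1 <> 0).
{ rewrite <- RtoC_plus. apply RtoC_neq_0. pose proof (pos_INR n); lra. }
assert (E1 := pochhammer_shift a n). assert (E2 := pochhammer_shift (a + 1 / 2) n).
replace (a + 1 / 2 + 1) with (a + 3 / 2) in E2 by field.
set (w := (3 / 4) ^ n / INR (fact n)). clearbody w.
transitivity ((pochhammer a n * (a + INR n)) * (pochhammer (a + 1 / 2) n * (a + 1 / 2 + INR n)) *
  pochhammer ((4 * a + 1) / 6) n * ((4 * a + 1) / 6 + INR n) * (3 / 4) * w /
  (pochhammer (a + 1 / 4) n * pochhammer (a + 3 / 4) n *
    ((a + 1 / 4 + INR n) * (a + 3 / 4 + INR n) * (INR n + 1)))).
- revert P1 P2 N1 N2 Hn1.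
  generalize (pochhammer (a + 1 / 4) n) (pochhammer (a + 3 / 4) n)
    (a + 1 / 4 + INR n) (a + 3 / 4 + INR n) (pochhammer ((4 * a + 1) / 6) n).
  intros. field. repeat split; auto.
- rewrite E1, E2.
  revert P1 P2 N1 N2 Hn1.
  generalize (pochhammer (a + 1 / 4) n) (pochhammer (a + 3 / 4) n)
    (a + 1 / 4 + INR n) (a + 3 / 4 + INR n) (pochhammer ((4 * a + 1) / 6) n).
  intros. field. repeat split; auto.
Qed.

Definition wz_den (a N : C) : C :=
  (a + 1 / 4 + N) * (a + 3 / 4 + N) * (a + 5 / 4 + N) * (a + 7 / 4 + N) *
  (a + 9 / 4 + N) * (a + 11 / 4 + N) * (a + 13 / 4 + N) * (a + 15 / 4 + N) * (N + 1).

(** The certificate equation with its common factors and denominators cleared. The variable [c] is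
    separate so that the identity can be rewritten where [c] is opaque. *)
Lemma wz_polynomial_identity (a N c : C) : c = (4 * a + 1) / 6 ->
  36 * (a + 1 + N) * (a + 3 / 2 + N) * (3 / 4) *
    ((a + 2 + N) * (a + 3 + N) * (a + 5 / 2 + N) * (a + 7 / 2 + N) * (c + N + 1) * (c + N + 2))
  - 256 * (a * (a + 1 / 2)) * (3 / 4) *
    ((a + 5 / 4 + N) * (a + 7 / 4 + N) * (a + 9 / 4 + N) * (a + 11 / 4 + N) *
     (a + 13 / 4 + N) * (a + 15 / 4 + N)) =
  3 / 16 * wz_poly (2 * a) (N + 1 + 1) * (c + N + 1) * (a + 1 + N) * (a + 3 / 2 + N) * (3 / 4)
  - 3 / 16 * wz_poly (2 * a) (N + 1) * ((a + 13 / 4 + N) * (a + 15 / 4 + N)) * (N + 1).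
Proof. intros ->. unfold wz_poly. field. Qed.

Lemma wz_step a n :
  ~ nonpos_int (a + 1 / 4) -> ~ nonpos_int (a + 3 / 4) ->
  (2 * a + 2) * (2 * a + 3) * (2 * a + 4) * (2 * a + 5) * strange_term (a + 3) (S n)
   - 256 * wz_factor a * strange_term a (S n) = wz_cert a (S n) - wz_cert a n.
Proof.
intros h1 h2.
rewrite strange_term_shift, strange_term_S by auto. unfold wz_cert.
replace (wz_base a (S n)) with (wz_base a n * ((a + 1 + INR n) * (a + 3 / 2 + INR n) *
  ((4 * a + 1) / 6 + INR n) * (3 / 4) /
      ((a + 1 / 4 + INR n) * (a + 3 / 4 + INR n) * (INR n + 1))))
  by (symmetry; now apply hyp3F2_term_S).
rewrite RtoC_S.
destruct (admissible_factors_neq_0 a (INR n) h1 h2 ltac:(eexists; reflexivity))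
  as (N1 & N2 & N3 & N4 & N5 & N6 & N7 & N8).
assert (N9 : INR n + 1 <> 0).
{ rewrite <- RtoC_plus. apply RtoC_neq_0. pose proof (pos_INR n); lra. }
generalize dependent (RtoC (INR n)). intros N N1 N2 N3 N4 N5 N6 N7 N8 N9.
assert (HI := wz_polynomial_identity a N _ eq_refl).
replace (a + 1 / 4 + (N + 1)) with (a + 5 / 4 + N) by field.
replace (a + 3 / 4 + (N + 1)) with (a + 7 / 4 + N) by field.
replace (a + 5 / 4 + (N + 1)) with (a + 9 / 4 + N) by field.
replace (a + 7 / 4 + (N + 1)) with (a + 11 / 4 + N) by field.
replace (a + 9 / 4 + (N + 1)) with (a + 13 / 4 + N) by field.
replace (a + 11 / 4 + (N + 1)) with (a + 15 / 4 + N) by field.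
replace (a + 1 + (N + 1)) with (a + 2 + N) by ring.
replace (a + 2 + (N + 1)) with (a + 3 + N) by ring.
replace (a + 3 / 2 + (N + 1)) with (a + 5 / 2 + N) by field.
replace (a + 5 / 2 + (N + 1)) with (a + 7 / 2 + N) by field.
set (c := (4 * a + 1) / 6) in *. clearbody c.
replace (c + (N + 1)) with (c + N + 1) by ring.
replace (c + 1 + (N + 1)) with (c + N + 2) by ring.
set (F := wz_factor a) in *. clearbody F.
set (U := wz_base a n) in *. clearbody U.
(* Over the common denominator the claim becomes the polynomial identity [HI]. No relation between
   the linear factors is used afterwards, so they are all generalised and [field] only sees
   atoms. *)
transitivity (F * U * (c + N) / wz_den a N * (
36 * (a + 1 + N) * (a + 3 / 2 + N) * (3 / 4) *
    ((a + 2 + N) * (a + 3 + N) * (a + 5 / 2 + N) * (a + 7 / 2 + N) * (c + N + 1) * (c + N + 2))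
  - 256 * (a * (a + 1 / 2)) * (3 / 4) *
    ((a + 5 / 4 + N) * (a + 7 / 4 + N) * (a + 9 / 4 + N) * (a + 11 / 4 + N) *
     (a + 13 / 4 + N) * (a + 15 / 4 + N)))).
2: rewrite HI.
all: clear HI; unfold wz_den;
  generalize (wz_poly (2 * a) (N + 1 + 1)) (wz_poly (2 * a) (N + 1));
  revert N1 N2 N3 N4 N5 N6 N7 N8 N9;
  generalize (a + 1 / 4 + N) (a + 3 / 4 + N) (a + 5 / 4 + N) (a + 7 / 4 + N)
    (a + 9 / 4 + N) (a + 11 / 4 + N) (a + 13 / 4 + N) (a + 15 / 4 + N)
    (a + 1 + N) (a + 3 / 2 + N) (a + 2 + N) (a + 3 + N) (a + 5 / 2 + N) (a + 7 / 2 + N)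
    (c + N + 1) (c + N + 2) (c + N) (N + 1);
  intros; field; repeat split; auto.
Qed.

(** The start of the telescoping: together with [wz_step] it makes the partial sums up to n equal to
    [wz_cert a n], with no boundary term left over. *)
Lemma wz_0 a :
  ~ nonpos_int (a + 1 / 4) -> ~ nonpos_int (a + 3 / 4) ->
  (2 * a + 2) * (2 * a + 3) * (2 * a + 4) * (2 * a + 5) * strange_term (a + 3) 0
   - 256 * wz_factor a * strange_term a 0 = wz_cert a 0.
Proof.
intros h1 h2.
destruct (admissible_factors_neq_0 a (INR 0) h1 h2 ltac:(eexists; reflexivity))
  as (M1 & M2 & M3 & M4 & M5 & M6 & _).
rewrite strange_term_shift by auto. unfold wz_cert, wz_base, strange_term, hyp3F2_term.
simpl pochhammer. simpl (fact 0). simpl INR in *.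
rewrite !Cplus_0_r in *. unfold wz_factor, wz_poly. field.
repeat split; auto; intros E; first [nz_by M1 | nz_by M2 | nz_by M3 | nz_by M4 | nz_by M5 | nz_by M6 | idtac].
Qed.

Lemma sum_n_C_S (u : nat -> C) n :
  Csum_n u (S n) = Csum_n u n + u (S n).
Proof. apply (sum_Sn (G := C_AbelianMonoid)). Qed.

Lemma sum_n_C_0 (u : nat -> C) : Csum_n u 0 = u 0%nat.
Proof. apply (sum_O (G := C_AbelianMonoid)). Qed.

(** The exponent 6 is the degree 5 of [wz_poly] in n plus one for the linear factor in the numerator
    of [wz_cert]. *)
Lemma wz_base_pow_lim a :
  ~ nonpos_int (a + 1 / 4) -> ~ nonpos_int (a + 3 / 4) ->
  is_lim_seq (fun n => (INR n + 1) ^ 6 * Cmod (wz_base a n))%R 0.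
Proof.
intros h1 h2.
destruct (hyp3F2_terms_decay (a + 1) (a + 3 / 2) ((4 * a + 1) / 6) _ _ h1 h2) as [N HN].
fold (wz_base a) in HN.
assert (E : forall n, Cmod (RtoC ((INR n + 1) ^ 6) * wz_base a n) =
   ((INR n + 1) ^ 6 * Cmod (wz_base a n))%R).
{ intros n. rewrite Cmod_mult, Cmod_R, Rabs_pos_eq; [auto|].
  apply pow_le. pose proof (pos_INR n); lra. }
eapply is_lim_seq_ext; [exact E|].
(* For n >= 100 one has n + 2 <= 1.01 (n + 1), and 1.01^6 times 7/8 is below 19/20. *)
apply ex_series_lim_0, ex_series_Cmod_ratio with (19 / 20)%R (N + 100)%nat; [lra|].
intros n Hn. rewrite !E.
assert (Hn1 : (100 <= INR n)%R).
{ replace 100%R with (INR 100) by (simpl; ring). apply le_INR; lia. }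
specialize (HN n ltac:(lia)).
assert (H6 : ((INR (S n) + 1) ^ 6 <= (101 / 100 * (INR n + 1)) ^ 6)%R).
{ apply pow_incr. rewrite S_INR. lra. }
rewrite Rpow_mult_distr in H6.
assert (P : (0 < (INR n + 1) ^ 6)%R) by (apply pow_lt; lra).
pose proof (Cmod_ge_0 (wz_base a n)). pose proof (Cmod_ge_0 (wz_base a (S n))).
apply Rle_trans with ((101 / 100) ^ 6 * (INR n + 1) ^ 6 * (7 / 8 * Cmod (wz_base a n)))%R.
- apply Rmult_le_compat; auto. apply pow_le. pose proof (pos_INR (S n)). lra.
- replace ((101 / 100) ^ 6 * (INR n + 1) ^ 6 * (7 / 8 * Cmod (wz_base a n)))%R with
   ((101 / 100) ^ 6 * (7 / 8) * ((INR n + 1) ^ 6 * Cmod (wz_base a n)))%R by ring.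
  apply Rmult_le_compat_r; [apply Rmult_le_pos; lra|]. simpl; lra.
Qed.

Lemma Cmod_horner_step (x N y : C) (B : R) k :
  (1 <= Cmod N)%R -> (Cmod y <= B * Cmod N ^ k)%R ->
  (Cmod (y * N + x) <= (B + Cmod x) * Cmod N ^ (S k))%R.
Proof.
intros HN Hy. eapply Rle_trans; [apply Cmod_triangle|]. rewrite Cmod_mult.
assert (P := pow_R1_Rle _ k HN). pose proof (Cmod_ge_0 x).
assert (1 <= Cmod N ^ S k)%R by now apply pow_R1_Rle.
rewrite Rmult_plus_distr_r. apply Rplus_le_compat.
- simpl. nra.
- nra.
Qed.

Lemma wz_poly_bound A : exists B, (0 <= B)%R /\
  forall N : C, (1 <= Cmod N)%R -> (Cmod (wz_poly A N) <= B * Cmod N ^ 5)%R.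
Proof.
(* The bound is left open and assembled by the Horner steps, one coefficient modulus at a time. *)
eexists. split.
2:{ intros N HN. unfold wz_poly.
  do 4 (apply Cmod_horner_step; [exact HN|]).
  apply (Cmod_horner_step _ N (- 576) (Cmod (- 576)) 0); [exact HN|]. simpl; lra. }
repeat apply Rplus_le_le_0_compat; apply Cmod_ge_0.
Qed.

Lemma wz_cert_lim a :
  ~ nonpos_int (a + 1 / 4) -> ~ nonpos_int (a + 3 / 4) -> Clim (wz_cert a) 0.
Proof.
intros h1 h2.
destruct (wz_poly_bound (2 * a)) as [B [HB0 HB]].
set (c := (4 * a + 1) / 6).
set (K := (Cmod (3 / 16 * wz_factor a) * B * (Cmod c + 1))%R).
assert (HK : (0 <= K)%R).
{ unfold K. repeat apply Rmult_le_pos; auto using Cmod_ge_0. pose proof (Cmod_ge_0 c); lra. }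
destruct (ex_nat_ge (Cmod a + 4)) as [N0 HN0].
apply Clim_dominated with (fun n => K * ((INR n + 1) ^ 6 * Cmod (wz_base a n)))%R.
2:{ evar_last; [apply is_lim_seq_mult'; [apply is_lim_seq_const | now apply wz_base_pow_lim]|].
  simpl; f_equal; ring. }
exists N0; intros n Hn. specialize (HN0 n Hn).
replace (wz_cert a n - 0) with (wz_cert a n) by ring.
assert (HL : forall x : R, (0 <= x <= 3)%R -> (1 <= Cmod (a + x + INR n))%R).
{ intros x Hx. destruct (Cmod_plus_INR_bounds (a + x) (Cmod a + 3) n) as [H _]; [|lra].
  eapply Rle_trans; [apply Cmod_triangle|]. rewrite (Cmod_R x), Rabs_pos_eq; lra. }
assert (HL1 := HL (1 / 4)%R ltac:(lra)). assert (HL2 := HL (3 / 4)%R ltac:(lra)).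
assert (HL3 := HL (5 / 4)%R ltac:(lra)). assert (HL4 := HL (7 / 4)%R ltac:(lra)).
assert (HL5 := HL (9 / 4)%R ltac:(lra)). assert (HL6 := HL (11 / 4)%R ltac:(lra)).
rewrite !RtoC_div in HL1, HL2, HL3, HL4, HL5, HL6 by lra.
unfold wz_cert. fold c.
rewrite Cmod_mult, Cmod_div.
2:{ apply (proj2 (Cmod_gt_0 _)). rewrite !Cmod_mult.
  repeat apply Rmult_lt_0_compat; lra. }
rewrite <- Rmult_assoc. apply Rmult_le_compat_r; [apply Cmod_ge_0|].
apply Rle_div_l.
{ rewrite !Cmod_mult. apply Rlt_gt. repeat apply Rmult_lt_0_compat; lra. }
apply Rle_trans with (K * (INR n + 1) ^ 6 * 1)%R.
- rewrite Rmult_1_r. rewrite (Cmod_mult _ (c + INR n)), (Cmod_mult _ (wz_poly _ _)).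
  assert (EN : Cmod (INR n + 1) = (INR n + 1)%R).
  { rewrite <- RtoC_plus, Cmod_R, Rabs_pos_eq; [auto|]. pose proof (pos_INR n); lra. }
  assert (H1 := HB (INR n + 1)). rewrite EN in H1.
  pose proof (pos_INR n). specialize (H1 ltac:(lra)).
  assert (H2 : (Cmod (c + INR n) <= (Cmod c + 1) * (INR n + 1))%R).
  { destruct (Cmod_plus_INR_bounds c (Cmod c) n) as [_ H2]; [lra|].
    pose proof (Cmod_ge_0 c). nra. }
  unfold K.
  replace (Cmod (3 / 16 * wz_factor a) * B * (Cmod c + 1) * (INR n + 1) ^ 6)%R with
    (Cmod (3 / 16 * wz_factor a) * (B * (INR n + 1) ^ 5) * ((Cmod c + 1) * (INR n + 1)))%R by ring.
  apply Rmult_le_compat; auto using Cmod_ge_0.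
  + apply Rmult_le_pos; apply Cmod_ge_0.
  + apply Rmult_le_compat_l; auto using Cmod_ge_0.
- apply Rmult_le_compat_l.
  + apply Rmult_le_pos; [auto|]. apply pow_le. pose proof (pos_INR n); lra.
  + rewrite !Cmod_mult.
    assert (L : forall x y, (1 <= x -> 1 <= y -> 1 <= x * y)%R) by (intros; nra).
    repeat apply L; assumption.
Qed.

Lemma strange_sum_is_series a :
  ~ nonpos_int (a + 1 / 4) -> ~ nonpos_int (a + 3 / 4) ->
  Clim (Csum_n (strange_term a)) (strange_sum a).
Proof. intros h1 h2. apply is_series_Clim. now apply is_series_hyp3F2. Qed.

Lemma nonpos_int_shift_frac a x k : ~ nonpos_int (a + x) -> ~ nonpos_int (a + INR k + x).
Proof.
intros H. replace (a + INR k + x) with (a + x + INR k) by ring. now apply nonpos_int_shift.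
Qed.

(** The partial sums of the difference of the two sides are [wz_cert a n], which tends to 0. The
    left prefactor may vanish, so the relation is not divided by it. *)
Lemma strange_sum_rec a :
  ~ nonpos_int (a + 1 / 4) -> ~ nonpos_int (a + 3 / 4) ->
  (2 * a + 2) * (2 * a + 3) * (2 * a + 4) * (2 * a + 5) * strange_sum (a + 3) =
  256 * wz_factor a * strange_sum a.
Proof.
intros h1 h2.
assert (h1' := nonpos_int_shift_frac a _ 3 h1). assert (h2' := nonpos_int_shift_frac a _ 3 h2).
rewrite INR_3 in h1', h2'.
set (d := (2 * a + 2) * (2 * a + 3) * (2 * a + 4) * (2 * a + 5)).
apply Ceq_minus.
apply Clim_unique with (wz_cert a); [|now apply wz_cert_lim].
replace (d * strange_sum (a + 3) - 256 * wz_factor a * strange_sum a) with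
  (d * strange_sum (a + 3) + - (256 * wz_factor a) * strange_sum a) by ring.
eapply Clim_ext.
2:{ apply Clim_plus; (apply Clim_mult; [apply Clim_const|]).
  - apply (strange_sum_is_series (a + 3)); auto.
  - apply (strange_sum_is_series a); auto. }
intros n. induction n as [|n IH].
- rewrite !sum_n_C_0, <- wz_0 by auto. unfold d. ring.
- rewrite !sum_n_C_S.
  replace (wz_cert a (S n)) with (wz_cert a n + (wz_cert a (S n) - wz_cert a n)) by ring.
  rewrite <- wz_step, <- IH by auto. unfold d. ring.
Qed.

(** * The binomial series *)

(** The coefficient of x^n in (1 - x)^(-c). *)
Definition rising_binomial (c : C) (n : nat) : C := pochhammer c n / INR (fact n).

Lemma rising_binomial_S c n :
  (INR n + 1) * rising_binomial c (S n) = (c + INR n) * rising_binomial c n.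
Proof.
unfold rising_binomial.
replace (RtoC (INR (fact (S n)))) with ((INR n + 1) * INR (fact n)).
2:{ rewrite fact_simpl, mult_INR, RtoC_mult, RtoC_S. reflexivity. }
assert (Hf := RtoC_neq_0 _ (INR_fact_neq_0 n)).
assert (Hn1 : INR n + 1 <> 0).
{ rewrite <- RtoC_plus. apply RtoC_neq_0. pose proof (pos_INR n); lra. }
simpl pochhammer. field. auto.
Qed.

Lemma Cmod_INR_1 n : Cmod (INR n + 1) = (INR n + 1)%R.
Proof.
rewrite <- RtoC_plus, Cmod_R, Rabs_pos_eq; [auto|]. pose proof (pos_INR n); lra.
Qed.

Lemma ex_series_rising_binomial c (x : R) : (0 <= x < 1)%R ->
  ex_series (fun n => Cmod (rising_binomial c n * x ^ n)).
Proof.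
intros Hx.
set (q := ((1 + x) / 2)%R).
destruct (ex_nat_ge (Cmod c * x / (q - x))) as [N HN].
apply ex_series_Cmod_ratio with q N; [unfold q; lra|].
intros n Hn. specialize (HN n Hn). apply Rle_div_l in HN; [|unfold q; lra].
assert (Hn1 : INR n + 1 <> 0).
{ rewrite <- RtoC_plus. apply RtoC_neq_0. pose proof (pos_INR n); lra. }
replace (rising_binomial c (S n) * x ^ S n) with
  ((rising_binomial c n * x ^ n) * ((c + INR n) * x / (INR n + 1))).
2:{ transitivity (((c + INR n) * rising_binomial c n) * x ^ S n / (INR n + 1)).
    - simpl. field. auto.
    - rewrite <- rising_binomial_S. field. auto. }
rewrite Cmod_mult, Rmult_comm. apply Rmult_le_compat_r; [apply Cmod_ge_0|].
rewrite Cmod_div, Cmod_mult, Cmod_INR_1, Cmod_R, Rabs_pos_eq by (auto; lra).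
pose proof (pos_INR n).
apply Rle_div_l; [lra|].
destruct (Cmod_plus_INR_bounds c (Cmod c) n) as [_ H2]; [lra|].
assert (0 <= q)%R by (unfold q; lra). nra.
Qed.

Section BinomialSeries.

Local Open Scope R_scope.

Variable c : C.

Definition binom_re (n : nat) : R := Re (rising_binomial c n).
Definition binom_im (n : nat) : R := Im (rising_binomial c n).

Lemma Re_mult_pow z (x : R) n : Re (z * x ^ n)%C = Re z * x ^ n.
Proof. rewrite <- RtoC_pow. apply re_scal_r. Qed.

Lemma Im_mult_pow z (x : R) n : Im (z * x ^ n)%C = Im z * x ^ n.
Proof. rewrite <- RtoC_pow. apply im_scal_r. Qed.

(** If the radius were smaller than the midpoint of |x| and 1, the terms at that midpoint could not
    tend to 0. *)
Lemma CV_radius_ge_1 (a : nat -> R) :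
  (forall x, 0 <= x < 1 -> ex_series (fun n => a n * x ^ n)) ->
  forall x, Rabs x < 1 -> Rbar_lt (Rabs x) (CV_radius a).
Proof.
intros H x Hx.
apply Rbar_lt_le_trans with ((Rabs x + 1) / 2); [simpl; lra|].
apply Rbar_not_lt_le. intros Hlt.
pose proof (Rabs_pos x).
rewrite <- (Rabs_pos_eq ((Rabs x + 1) / 2)) in Hlt by lra.
apply CV_disk_outside in Hlt. apply Hlt.
apply ex_series_lim_0, H. lra.
Qed.

Lemma ex_series_binom_re x : 0 <= x < 1 -> ex_series (fun n => binom_re n * x ^ n).
Proof.
intros Hx. eapply (ex_series_le (K := R_AbsRing) (V := R_CompleteNormedModule));
  [|apply (ex_series_rising_binomial c x Hx)].
intros n. unfold binom_re. rewrite <- Re_mult_pow. apply Re_Im_le_Cmod.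
Qed.

Lemma ex_series_binom_im x : 0 <= x < 1 -> ex_series (fun n => binom_im n * x ^ n).
Proof.
intros Hx. eapply (ex_series_le (K := R_AbsRing) (V := R_CompleteNormedModule));
  [|apply (ex_series_rising_binomial c x Hx)].
intros n. unfold binom_im. rewrite <- Im_mult_pow. apply Re_Im_le_Cmod.
Qed.

(** Real part of the differential equation f' = c f + x f', read on coefficients. *)
Lemma binom_derive_re n :
  PS_derive binom_re n = PS_plus (PS_plus (PS_scal (Re c) binom_re) (PS_scal (- Im c) binom_im))
    (PS_incr_1 (PS_derive binom_re)) n.
Proof.
assert (H := f_equal Re (rising_binomial_S c n)).
replace (Re ((INR n + 1) * rising_binomial c (S n))%C) with ((INR n + 1) * binom_re (S n)) in H
  by (rewrite <- RtoC_plus, re_scal_l; reflexivity).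
replace (Re ((c + INR n) * rising_binomial c n)%C) with
  ((Re c + INR n) * binom_re n - Im c * binom_im n) in H
  by (unfold binom_re, binom_im; destruct c, (rising_binomial _ n); simpl; ring).
unfold PS_plus, PS_scal, plus, scal; simpl; unfold mult; simpl.
transitivity ((INR n + 1) * binom_re (S n)).
{ unfold PS_derive. now rewrite S_INR. }
rewrite H. destruct n as [|n].
- unfold PS_incr_1, zero; simpl. ring.
- unfold PS_incr_1, PS_derive. ring.
Qed.

Lemma binom_derive_im n :
  PS_derive binom_im n = PS_plus (PS_plus (PS_scal (Re c) binom_im) (PS_scal (Im c) binom_re))
    (PS_incr_1 (PS_derive binom_im)) n.
Proof.
assert (H := f_equal Im (rising_binomial_S c n)).
replace (Im ((INR n + 1) * rising_binomial c (S n))%C) with ((INR n + 1) * binom_im (S n)) in H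
  by (rewrite <- RtoC_plus, im_scal_l; reflexivity).
replace (Im ((c + INR n) * rising_binomial c n)%C) with
  ((Re c + INR n) * binom_im n + Im c * binom_re n) in H
  by (unfold binom_re, binom_im; destruct c, (rising_binomial _ n); simpl; ring).
unfold PS_plus, PS_scal, plus, scal; simpl; unfold mult; simpl.
transitivity ((INR n + 1) * binom_im (S n)).
{ unfold PS_derive. now rewrite S_INR. }
rewrite H. destruct n as [|n].
- unfold PS_incr_1, zero; simpl. ring.
- unfold PS_incr_1, PS_derive. ring.
Qed.

Lemma ex_pseries_inside (a : nat -> R) x :
  Rbar_lt (Rabs x) (CV_radius a) -> ex_pseries a x.
Proof. intros H. now apply CV_radius_inside. Qed.

Lemma is_derive_binom_re x : Rabs x < 1 ->
  is_derive (PSeries binom_re) x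
    ((Re c * PSeries binom_re x - Im c * PSeries binom_im x) / (1 - x)).
Proof.
intros Hx.
assert (H1 := CV_radius_ge_1 _ ex_series_binom_re x Hx).
assert (H2 := CV_radius_ge_1 _ ex_series_binom_im x Hx).
assert (E1 := ex_pseries_inside _ _ H1). assert (E2 := ex_pseries_inside _ _ H2).
assert (E3 : ex_pseries (PS_derive binom_re) x).
{ apply ex_pseries_inside. now rewrite CV_radius_derive. }
evar_last; [apply is_derive_PSeries, H1|].
assert (E : PSeries (PS_derive binom_re) x = Re c * PSeries binom_re x
   + - Im c * PSeries binom_im x + x * PSeries (PS_derive binom_re) x).
{ rewrite (PSeries_ext _ _ _ binom_derive_re) at 1.
  assert (S1 : forall k, ex_pseries (PS_scal k binom_re) x).
  { intros k. apply (ex_pseries_scal (V := R_NormedModule)); [apply Rmult_comm | exact E1]. }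
  assert (S2 : forall k, ex_pseries (PS_scal k binom_im) x).
  { intros k. apply (ex_pseries_scal (V := R_NormedModule)); [apply Rmult_comm | exact E2]. }
  rewrite PSeries_plus; [|now apply (ex_pseries_plus (V := R_NormedModule))
    |now apply (ex_pseries_incr_1 (V := R_NormedModule))].
  rewrite PSeries_plus, !PSeries_scal, PSeries_incr_1; auto. }
apply Rabs_def2 in Hx.
apply Rmult_eq_reg_r with (1 - x); [|lra].
transitivity (Re c * PSeries binom_re x - Im c * PSeries binom_im x); [lra | field; lra].
Qed.

Lemma is_derive_binom_im x : Rabs x < 1 ->
  is_derive (PSeries binom_im) x
    ((Re c * PSeries binom_im x + Im c * PSeries binom_re x) / (1 - x)).
Proof.
intros Hx.
assert (H1 := CV_radius_ge_1 _ ex_series_binom_re x Hx).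
assert (H2 := CV_radius_ge_1 _ ex_series_binom_im x Hx).
assert (E1 := ex_pseries_inside _ _ H1). assert (E2 := ex_pseries_inside _ _ H2).
assert (E3 : ex_pseries (PS_derive binom_im) x).
{ apply ex_pseries_inside. now rewrite CV_radius_derive. }
evar_last; [apply is_derive_PSeries, H2|].
assert (E : PSeries (PS_derive binom_im) x = Re c * PSeries binom_im x
   + Im c * PSeries binom_re x + x * PSeries (PS_derive binom_im) x).
{ rewrite (PSeries_ext _ _ _ binom_derive_im) at 1.
  assert (S1 : forall k, ex_pseries (PS_scal k binom_im) x).
  { intros k. apply (ex_pseries_scal (V := R_NormedModule)); [apply Rmult_comm | exact E2]. }
  assert (S2 : forall k, ex_pseries (PS_scal k binom_re) x).
  { intros k. apply (ex_pseries_scal (V := R_NormedModule)); [apply Rmult_comm | exact E1]. }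
  rewrite PSeries_plus; [|now apply (ex_pseries_plus (V := R_NormedModule))
    |now apply (ex_pseries_incr_1 (V := R_NormedModule))].
  rewrite PSeries_plus, !PSeries_scal, PSeries_incr_1; auto. }
apply Rabs_def2 in Hx.
apply Rmult_eq_reg_r with (1 - x); [|lra].
transitivity (Re c * PSeries binom_im x + Im c * PSeries binom_re x); [lra | field; lra].
Qed.

Lemma is_derive_0_eq (f : R -> R) (b : R) : 0 <= b ->
  (forall x, 0 <= x <= b -> is_derive f x 0) -> f b = f 0.
Proof.
intros Hb H.
destruct (MVT_gen f 0 b (fun _ => 0)) as [t [_ E]].
- intros x Hx. rewrite Rmin_left, Rmax_right in Hx by lra. apply H; lra.
- intros x Hx. rewrite Rmin_left, Rmax_right in Hx by lra.
  apply continuity_pt_filterlim.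
  apply (ex_derive_continuous (V := R_NormedModule) f). exists 0. apply H; lra.
- lra.
Qed.

(* [(1-x)^c (U + i V)] has zero derivative, where [U + i V] is the sum of the series. *)
Lemma binom_closed_form x : 0 <= x < 1 ->
  PSeries binom_re x = exp (- (Re c * ln (1 - x))) * cos (Im c * ln (1 - x)) /\
  PSeries binom_im x = - (exp (- (Re c * ln (1 - x))) * sin (Im c * ln (1 - x))).
Proof.
intros Hx.
set (G1 := fun x => exp (Re c * ln (1 - x)) *
  (PSeries binom_re x * cos (Im c * ln (1 - x)) - PSeries binom_im x * sin (Im c * ln (1 - x)))).
set (G2 := fun x => exp (Re c * ln (1 - x)) *
  (PSeries binom_re x * sin (Im c * ln (1 - x)) + PSeries binom_im x * cos (Im c * ln (1 - x)))).
assert (D : forall y, 0 <= y <= x -> is_derive G1 y 0 /\ is_derive G2 y 0).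
{ intros y Hy.
  assert (Hy1 : Rabs y < 1) by (rewrite Rabs_pos_eq; lra).
  assert (D1 := is_derive_binom_re y Hy1). assert (D2 := is_derive_binom_im y Hy1).
  split.
  - unfold G1. auto_derive.
    + repeat split; try lra; eexists; eassumption.
    + replace (Derive (fun x => PSeries binom_re x) y) with
        ((Re c * PSeries binom_re y - Im c * PSeries binom_im y) / (1 - y))
        by (symmetry; now apply is_derive_unique).
      replace (Derive (fun x => PSeries binom_im x) y) with
        ((Re c * PSeries binom_im y + Im c * PSeries binom_re y) / (1 - y))
        by (symmetry; now apply is_derive_unique).
      field; lra.
  - unfold G2. auto_derive.
    + repeat split; try lra; eexists; eassumption.
    + replace (Derive (fun x => PSeries binom_re x) y) with
        ((Re c * PSeries binom_re y - Im c * PSeries binom_im y) / (1 - y))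
        by (symmetry; now apply is_derive_unique).
      replace (Derive (fun x => PSeries binom_im x) y) with
        ((Re c * PSeries binom_im y + Im c * PSeries binom_re y) / (1 - y))
        by (symmetry; now apply is_derive_unique).
      field; lra. }
assert (A1 : G1 x = G1 0) by (apply is_derive_0_eq; [lra|]; intros; now apply D).
assert (A2 : G2 x = G2 0) by (apply is_derive_0_eq; [lra|]; intros; now apply D).
unfold G1, G2 in A1, A2.
assert (B1 : PSeries binom_re 0 = 1).
{ rewrite PSeries_0. unfold binom_re, rising_binomial; simpl. field. }
assert (B2 : PSeries binom_im 0 = 0).
{ rewrite PSeries_0. unfold binom_im, rising_binomial; simpl. field. }
rewrite B1, B2, Rminus_0_r, ln_1, !Rmult_0_r, exp_0, cos_0, sin_0 in A1, A2.
set (L := ln (1 - x)) in *.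
assert (Ee : exp (- (Re c * L)) * exp (Re c * L) = 1).
{ rewrite <- exp_plus, Rplus_opp_l. apply exp_0. }
pose proof (sin2_cos2 (Im c * L)) as S. unfold Rsqr in S.
set (U := PSeries binom_re x) in *. set (V := PSeries binom_im x) in *.
set (e := exp (Re c * L)) in *. set (e' := exp (- (Re c * L))) in *.
set (co := cos (Im c * L)) in *. set (si := sin (Im c * L)) in *.
assert (F1 : U * co - V * si = e').
{ transitivity (e' * e * (U * co - V * si)); [rewrite Ee; ring|].
  rewrite Rmult_assoc, A1. ring. }
assert (F2 : U * si + V * co = 0).
{ transitivity (e' * e * (U * si + V * co)); [rewrite Ee; ring|].
  rewrite Rmult_assoc, A2. ring. }
split.
- transitivity (U * (si * si + co * co)); [rewrite S; ring|].
  rewrite <- F1. transitivity ((U * co - V * si) * co + (U * si + V * co) * si); [ring|].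
  rewrite F2; ring.
- transitivity (V * (si * si + co * co)); [rewrite S; ring|].
  rewrite <- F1. transitivity (- ((U * co - V * si) * si) + (U * si + V * co) * co); [ring|].
  rewrite F2; ring.
Qed.

End BinomialSeries.

Lemma Re_sum_n (u : nat -> C) n :
  Re (Csum_n u n) = sum_n (fun k => Re (u k)) n.
Proof.
induction n as [|n IH].
- now rewrite sum_n_C_0, sum_O.
- rewrite sum_n_C_S, sum_Sn, <- IH. reflexivity.
Qed.

Lemma Im_sum_n (u : nat -> C) n :
  Im (Csum_n u n) = sum_n (fun k => Im (u k)) n.
Proof.
induction n as [|n IH].
- now rewrite sum_n_C_0, sum_O.
- rewrite sum_n_C_S, sum_Sn, <- IH. reflexivity.
Qed.

Lemma binomial_series c :
  Clim (Csum_n (fun n => rising_binomial c n * (3 / 4) ^ n)) (Rpow_C 4 c).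
Proof.
assert (Hx : (0 <= 3 / 4 < 1)%R) by lra.
destruct (binom_closed_form c (3 / 4) Hx) as [H1 H2].
assert (EL : ln (1 - 3 / 4) = (- ln 4)%R).
{ rewrite <- ln_Rinv by lra. f_equal; field. }
rewrite EL in H1, H2.
assert (E : RtoC 3 / 4 = RtoC (3 / 4)%R) by (rewrite RtoC_div; [auto|lra]).
assert (R1 : Re (Rpow_C 4 c) = PSeries (binom_re c) (3 / 4)).
{ rewrite H1. unfold Rpow_C, Cexp. cbn [Re Im fst snd]. rewrite re_scal_r, im_scal_r.
  rewrite !Ropp_mult_distr_r_reverse, cos_neg, Ropp_involutive. reflexivity. }
assert (R2 : Im (Rpow_C 4 c) = PSeries (binom_im c) (3 / 4)).
{ rewrite H2. unfold Rpow_C, Cexp. cbn [Re Im fst snd]. rewrite re_scal_r, im_scal_r.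
  rewrite !Ropp_mult_distr_r_reverse, sin_neg, Ropp_involutive. ring. }
apply Clim_Re_Im. rewrite R1, R2. split.
- eapply is_lim_seq_ext.
  { intros n. symmetry. etransitivity; [apply Re_sum_n|].
    apply sum_n_ext. intros k. rewrite E, Re_mult_pow. reflexivity. }
  apply Series_correct. now apply ex_series_binom_re.
- eapply is_lim_seq_ext.
  { intros n. symmetry. etransitivity; [apply Im_sum_n|].
    apply sum_n_ext. intros k. rewrite E, Im_mult_pow. reflexivity. }
  apply Series_correct. now apply ex_series_binom_im.
Qed.

(** * Concentration of the negative binomial weights *)

Lemma Cmod_rising_binomial_le c n :
  (Cmod (rising_binomial c n) <= Cmod (rising_binomial (Cmod c) n))%R.
Proof.
induction n as [|n IH].
- unfold rising_binomial; simpl; lra.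
- assert (E : forall z, Cmod (rising_binomial z (S n)) =
    (Cmod (z + INR n) * Cmod (rising_binomial z n) / (INR n + 1))%R).
  { intros z. pose proof (pos_INR n).
    rewrite <- Cmod_mult, <- rising_binomial_S, Cmod_mult, Cmod_INR_1. field; lra. }
  rewrite !E. pose proof (pos_INR n).
  unfold Rdiv. apply Rmult_le_compat_r; [left; apply Rinv_0_lt_compat; lra|].
  apply Rmult_le_compat; auto using Cmod_ge_0.
  rewrite <- RtoC_plus, (Cmod_R (_ + _)).
  rewrite Rabs_pos_eq by (pose proof (Cmod_ge_0 c); lra).
  eapply Rle_trans; [apply Cmod_triangle|].
  rewrite (Cmod_R (INR n)), (Rabs_pos_eq (INR n)); lra.
Qed.

(* Up to the factor [4 ^ g], the negative binomial distribution of parameters [g] and [1/4]. *)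
Definition negbin (g : R) (n : nat) : R := (Cmod (rising_binomial g n) * (3 / 4) ^ n)%R.

Lemma negbin_S g n : (0 <= g)%R ->
  ((INR n + 1) * negbin g (S n) = 3 / 4 * ((g + INR n) * negbin g n))%R.
Proof.
intros Hg. pose proof (pos_INR n).
assert (H1 := f_equal Cmod (rising_binomial_S g n)).
rewrite !Cmod_mult, Cmod_INR_1, <- RtoC_plus, (Cmod_R (_ + _)), Rabs_pos_eq in H1 by lra.
unfold negbin. simpl pow.
transitivity ((INR n + 1) * Cmod (rising_binomial g (S n)) * (3 / 4 * (3 / 4) ^ n))%R; [ring|].
rewrite H1. ring.
Qed.

Lemma negbin_shift g n : (0 <= g)%R ->
  (g * negbin (g + 1) n = (g + INR n) * negbin g n)%R.
Proof.
intros Hg. pose proof (pos_INR n).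
assert (H1 := f_equal Cmod (pochhammer_shift g n)).
rewrite !Cmod_mult, <- !RtoC_plus, (Cmod_R (_ + _)), (Cmod_R g), !Rabs_pos_eq in H1 by lra.
unfold negbin, rising_binomial.
assert (Hf := RtoC_neq_0 _ (INR_fact_neq_0 n)).
rewrite !Cmod_div by auto. rewrite Cmod_R, Rabs_pos_eq by apply pos_INR.
unfold Rdiv at 1 4.
transitivity (g * Cmod (pochhammer (g + 1)%R n) * (/ INR (fact n) * (3 / 4) ^ n))%R.
- unfold Rdiv; ring.
- rewrite <- H1. unfold Rdiv; ring.
Qed.

Lemma RtoC_negbin g n : (0 <= g)%R -> RtoC (negbin g n) = rising_binomial g n * (3 / 4) ^ n.
Proof.
intros Hg.
assert (P : exists x, (0 <= x)%R /\ rising_binomial g n = RtoC x).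
{ induction n as [|n [x [Hx E]]].
  - exists 1%R. split; [lra|]. unfold rising_binomial; simpl. field.
  - pose proof (pos_INR n). exists ((g + INR n) * x / (INR n + 1))%R. split.
    + apply Rmult_le_pos; [nra | left; apply Rinv_0_lt_compat; lra].
    + assert (Hn1 : INR n + 1 <> 0) by (rewrite <- RtoC_plus; apply RtoC_neq_0; lra).
      assert (H1 := rising_binomial_S g n). rewrite E in H1.
      rewrite RtoC_div, RtoC_mult, !RtoC_plus by lra. rewrite <- H1. field. auto. }
destruct P as [x [Hx E]]. unfold negbin. rewrite E, Cmod_R, Rabs_pos_eq by auto.
rewrite RtoC_mult, RtoC_pow, RtoC_div by lra. reflexivity.
Qed.

Lemma sum_n_RtoC (u : nat -> R) n :
  Csum_n (fun k => RtoC (u k)) n = RtoC (sum_n u n).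
Proof.
induction n as [|n IH].
- now rewrite sum_n_C_0, sum_O.
- rewrite sum_n_C_S, sum_Sn, IH, <- RtoC_plus. reflexivity.
Qed.

Lemma is_series_negbin g : (0 <= g)%R -> is_series (negbin g) (exp (g * ln 4)).
Proof.
intros Hg. assert (H := binomial_series g).
unfold Rpow_C in H. rewrite <- RtoC_mult, Cexp_RtoC in H.
apply Clim_Re_Im in H. destruct H as [H _]. simpl Re in H.
unfold is_series. apply (is_lim_seq_ext (fun n => Re (Csum_n
  (fun n => rising_binomial g n * (3 / 4) ^ n) n)) (sum_n (negbin g)) (exp (g * ln 4))); [|exact H].
intros n. transitivity (Re (Csum_n (fun n => RtoC (negbin g n)) n)).
- f_equal. apply (sum_n_ext (G := C_AbelianMonoid)). intros k. symmetry. now apply RtoC_negbin.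
- rewrite sum_n_RtoC. reflexivity.
Qed.

Lemma is_series_shift (u : nat -> R) l :
  u O = 0%R -> is_series (fun n => u (S n)) l -> is_series u l.
Proof.
intros H0 H. apply (is_series_decr_1 (K := R_AbsRing) (V := R_NormedModule)).
rewrite H0. eapply is_series_ext; [reflexivity|].
match goal with |- is_series _ ?x => replace x with l; [exact H|] end.
exact (eq_sym (eq_trans (f_equal (Rplus l) Ropp_0) (Rplus_0_r l))).
Qed.

Lemma exp_ln4_S g : exp ((g + 1) * ln 4) = (4 * exp (g * ln 4))%R.
Proof.
rewrite Rmult_plus_distr_r, exp_plus, Rmult_1_l, exp_ln by lra. ring.
Qed.

Lemma is_series_R_ext (u v : nat -> R) (l m : R) :
  (forall n, u n = v n) -> l = m -> is_series u l -> is_series v m.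
Proof. intros H <- Hu. eapply is_series_ext; [exact H | exact Hu]. Qed.

Lemma is_series_R_scal (k : R) (u : nat -> R) (l : R) :
  is_series u l -> is_series (fun n => k * u n)%R (k * l)%R.
Proof. apply (is_series_scal_l (K := R_AbsRing) (V := R_NormedModule)). Qed.

Lemma is_series_R_plus (u v : nat -> R) (l m : R) :
  is_series u l -> is_series v m -> is_series (fun n => u n + v n)%R (l + m)%R.
Proof. apply (is_series_plus (K := R_AbsRing) (V := R_NormedModule)). Qed.

(** Absorption: n times the weight at (g, n) is 3g/4 times the weight at (g + 1, n - 1), so a moment
    for g reduces to a lower one for g + 1. *)
Lemma negbin_moment_1 g : (0 <= g)%R ->
  is_series (fun n => INR n * negbin g n)%R (3 * g * exp (g * ln 4))%R.
Proof.
intros Hg. apply is_series_shift; [simpl; ring|].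
eapply is_series_R_ext; [| |apply (is_series_R_scal (3 / 4 * g)), (is_series_negbin (g + 1)); lra].
- intros n. cbv beta. rewrite S_INR, negbin_S, Rmult_assoc, negbin_shift by auto. reflexivity.
- rewrite exp_ln4_S. field.
Qed.

Lemma negbin_moment_2 g : (0 <= g)%R ->
  is_series (fun n => INR n * (INR n - 1) * negbin g n)%R (9 * g * (g + 1) * exp (g * ln 4))%R.
Proof.
intros Hg. apply is_series_shift; [simpl; ring|].
eapply is_series_R_ext; [| |apply (is_series_R_scal (3 / 4 * g)), (negbin_moment_1 (g + 1)); lra].
- intros n. cbv beta. rewrite S_INR.
  transitivity (INR n * ((INR n + 1) * negbin g (S n)))%R; [|ring].
  rewrite negbin_S by auto. rewrite <- negbin_shift by auto. ring.
- rewrite exp_ln4_S. field.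
Qed.

(** The mean is 3g and the variance 12g. The centre [t] is free because the weights are later
    centred at 6N, which is only near the mean. *)
Lemma negbin_variance g t : (0 <= g)%R ->
  is_series (fun n => negbin g n * (INR n - t) ^ 2)%R
    (exp (g * ln 4) * ((3 * g - t) ^ 2 + 12 * g))%R.
Proof.
intros Hg.
eapply is_series_R_ext; [| |apply is_series_R_plus;
  [apply is_series_R_plus; [apply (negbin_moment_2 g Hg) |
     apply (is_series_R_scal (1 - 2 * t)), (negbin_moment_1 g Hg)]
  |apply (is_series_R_scal (t ^ 2)), (is_series_negbin g Hg)]].
- intros n. cbv beta. ring.
- ring.
Qed.

Lemma Cmod_sum_n_le (u : nat -> C) (v : nat -> R) :
  (forall n, (Cmod (u n) <= v n)%R) ->
  forall n, (Cmod (Csum_n u n) <= sum_n v n)%R.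
Proof.
intros H n. induction n as [|n IH].
- rewrite sum_n_C_0, sum_O. apply H.
- rewrite sum_n_C_S, sum_Sn. eapply Rle_trans; [apply Cmod_triangle|].
  unfold plus; simpl. specialize (H (S n)). lra.
Qed.

Lemma Cmod_series_le (u : nat -> C) (v : nat -> R) l L :
  (forall n, (Cmod (u n) <= v n)%R) -> Clim (Csum_n u) l ->
  is_series v L -> (Cmod l <= L)%R.
Proof.
intros H Hu Hv.
assert (HL : is_lim_seq (fun n => Cmod (Csum_n u n - l) + sum_n v n)%R (0 + L)%R).
{ apply is_lim_seq_plus'; [exact Hu | exact Hv]. }
rewrite Rplus_0_l in HL.
apply (is_lim_seq_le (fun _ => Cmod l) _ (Cmod l) L) in HL; [exact HL| |apply is_lim_seq_const].
intros n. pose proof (Cmod_sum_n_le u v H n).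
pose proof (Cmod_triangle (- (Csum_n u n - l)) (Csum_n u n)) as T.
replace (- (Csum_n u n - l) + Csum_n u n) with l in T by ring.
rewrite Cmod_opp in T. lra.
Qed.

(** * Pochhammer quotients with parameters differing by 1/2 *)

Lemma pochhammer_add z m n :
  pochhammer z (m + n) = pochhammer z m * pochhammer (z + INR m) n.
Proof.
induction n as [|n IH].
- rewrite Nat.add_0_r. simpl. ring.
- rewrite Nat.add_succ_r. simpl. rewrite IH, plus_INR, RtoC_plus. ring.
Qed.

Lemma RtoC_INR_double n : RtoC (INR (2 * n)) = 2 * INR n.
Proof. rewrite mult_INR, RtoC_mult. reflexivity. Qed.

Lemma pochhammer_double z n :
  pochhammer (2 * z) (2 * n) = 4 ^ n * pochhammer z n * pochhammer (z + 1 / 2) n.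
Proof.
induction n as [|n IH].
- simpl. ring.
- replace (2 * S n)%nat with (S (S (2 * n))) by lia.
  change (pochhammer (2 * z) (2 * n) * (2 * z + INR (2 * n)) * (2 * z + INR (S (2 * n))) =
    4 ^ S n * (pochhammer z n * (z + INR n)) * (pochhammer (z + 1 / 2) n * (z + 1 / 2 + INR n))).
  rewrite IH, RtoC_S, RtoC_INR_double. simpl. field.
Qed.

Lemma nonpos_int_double z :
  ~ nonpos_int z -> ~ nonpos_int (z + 1 / 2) -> ~ nonpos_int (2 * z).
Proof.
intros H1 H2 [k E].
destruct (Nat.Even_or_Odd k) as [[j ->]|[j ->]].
- apply H1. exists j. rewrite RtoC_INR_double in E.
  transitivity (2 * z / 2); [field|]. rewrite E. field.
- apply H2. exists j. rewrite plus_INR, RtoC_plus, RtoC_INR_double in E. simpl (INR 1) in E.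
  transitivity ((2 * z + 1) / 2); [field|]. rewrite E. field.
Qed.

Lemma admissible_double a :
  ~ nonpos_int (a + 1 / 4) -> ~ nonpos_int (a + 3 / 4) -> ~ nonpos_int (2 * a + 1 / 2).
Proof.
intros h1 h2. replace (2 * a + 1 / 2) with (2 * (a + 1 / 4)) by field.
apply nonpos_int_double; auto. now replace (a + 1 / 4 + 1 / 2) with (a + 3 / 4) by field.
Qed.

Definition half_ratio (z : C) (M : nat) : C :=
  pochhammer z M * sqrt (INR M) / pochhammer (z + 1 / 2) M.

(** The limit is Gamma (z + 1/2) / Gamma z, but only its being nonzero matters: quotients of
    [half_ratio] at two large indices then tend to 1. *)
Lemma half_ratio_lim z : ~ nonpos_int z -> ~ nonpos_int (z + 1 / 2) ->
  exists l : C, l <> 0 /\ Clim (half_ratio z) l.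
Proof.
intros Hz Hz'. exists (rGamma z / rGamma (z + 1 / 2)).
assert (N1 := rGamma_neq_0 z Hz). assert (N2 := rGamma_neq_0 _ Hz').
split.
- intros E. apply N1.
  transitivity (rGamma z / rGamma (z + 1 / 2) * rGamma (z + 1 / 2)); [field; auto|].
  rewrite E; ring.
- eapply Clim_ext_loc; [|apply Clim_div; [exact N2 | apply rGamma_lim | apply rGamma_lim]].
  exists 1%nat; intros n Hn. unfold rgamma_approx, half_ratio.
  assert (Hn0 : (0 < INR n)%R) by (apply lt_0_INR; lia).
  replace (1 - z) with (1 - (z + 1 / 2) + 1 / 2) by field.
  rewrite Rpow_C_plus, Rpow_C_half by auto.
  assert (Hr := Rpow_C_neq_0 (INR n) (1 - (z + 1 / 2))).
  assert (Hf := RtoC_neq_0 _ (INR_fact_neq_0 n)).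
  assert (Hp := pochhammer_neq_0 _ n Hz').
  revert Hr Hf Hp. generalize (pochhammer (z + 1 / 2) n) (Rpow_C (INR n) (1 - (z + 1 / 2))).
  generalize (RtoC (INR (fact n))). intros. field. auto.
Qed.

(** One threshold serves for all [m'], which gives an estimate uniform over all terms of a single
    series. *)
Lemma half_ratio_quotient z : ~ nonpos_int z -> ~ nonpos_int (z + 1 / 2) ->
  forall eps : posreal, exists M0, forall m m', (M0 <= m)%nat -> (M0 <= m')%nat ->
   (Cmod (half_ratio z m' / half_ratio z m - 1) < eps)%R.
Proof.
intros Hz Hz' eps.
destruct (half_ratio_lim z Hz Hz') as [l [Hl H]].
assert (Hl0 : (0 < Cmod l)%R) by exact (proj1 (Cmod_gt_0 l) Hl).
assert (He : (0 < Rmin (Cmod l / 2) (eps * (Cmod l / 2) / 2))%R).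
{ destruct eps as [e He]; simpl. apply Rmin_pos; [lra|]. nra. }
destruct (proj1 (Clim_eps _ _) H (mkposreal _ He)) as [M0 HM]. simpl in HM.
exists M0. intros m m' Hm Hm'.
assert (A := HM m Hm). assert (B := HM m' Hm').
assert (A1 := Rlt_le_trans _ _ _ A (Rmin_l _ _)).
assert (A2 := Rlt_le_trans _ _ _ A (Rmin_r _ _)).
assert (B2 := Rlt_le_trans _ _ _ B (Rmin_r _ _)).
set (x := half_ratio z m) in *. set (y := half_ratio z m') in *.
assert (Hx : (Cmod l / 2 < Cmod x)%R).
{ pose proof (Cmod_triangle x (- (x - l))) as T.
  replace (x + - (x - l)) with l in T by ring. rewrite Cmod_opp in T. lra. }
assert (Hx0 : x <> 0) by (apply (proj2 (Cmod_gt_0 _)); lra).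
replace (y / x - 1) with (((y - l) + - (x - l)) / x) by (field; auto).
rewrite Cmod_div by auto.
apply Rlt_div_l; [lra|].
eapply Rle_lt_trans; [apply Cmod_triangle|]. rewrite Cmod_opp.
destruct eps as [e He']; simpl in *. nra.
Qed.

(** By duplication, (b)_n (b + 1/2)_n and (b + 1/4)_n (b + 3/4)_n become Pochhammer symbols of
    length 2n at 2b and 2b + 1/2; the powers of 4 cancel. *)
Lemma strange_term_negbin b n :
  ~ nonpos_int (b + 1 / 4) -> ~ nonpos_int (b + 3 / 4) ->
  strange_term b n = rising_binomial ((4 * b + 1) / 6) n * (3 / 4) ^ n *
    (pochhammer (2 * b) (2 * n) / pochhammer (2 * b + 1 / 2) (2 * n)).
Proof.
intros h1 h2. unfold strange_term, hyp3F2_term, rising_binomial.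
replace (2 * b + 1 / 2) with (2 * (b + 1 / 4)) by field.
rewrite !pochhammer_double.
replace (b + 1 / 4 + 1 / 2) with (b + 3 / 4) by field.
assert (P1 := pochhammer_neq_0 _ n h1). assert (P2 := pochhammer_neq_0 _ n h2).
assert (Hf := RtoC_neq_0 _ (INR_fact_neq_0 n)).
assert (H4 : RtoC 4 ^ n <> 0) by (apply Cpow_nz, RtoC_neq_0; lra).
generalize dependent (pochhammer (b + 1 / 4) n).
generalize dependent (pochhammer (b + 3 / 4) n).
generalize dependent (RtoC (INR (fact n))).
generalize dependent (RtoC 4 ^ n). generalize ((3 / 4) ^ n).
intros. field. auto.
Qed.

(** Both symbols are tails of Pochhammer symbols starting at z and z + 1/2, and the square root is
    what the normalisation of [half_ratio] leaves behind. *)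
Lemma shifted_ratio_eq z N n : ~ nonpos_int z -> ~ nonpos_int (z + 1 / 2) -> (1 <= N)%nat ->
  pochhammer (z + INR N) n / pochhammer (z + INR N + 1 / 2) n =
  half_ratio z (N + n) / half_ratio z N * (sqrt (INR N / INR (N + n)))%R.
Proof.
intros Hz Hz' HN. unfold half_ratio. rewrite !pochhammer_add.
replace (z + INR N + 1 / 2) with (z + 1 / 2 + INR N) by ring.
assert (P1 := pochhammer_neq_0 _ N Hz). assert (P2 := pochhammer_neq_0 _ N Hz').
assert (P3 := pochhammer_neq_0 _ n (nonpos_int_shift _ N Hz')).
assert (HN0 : (0 < INR N)%R) by (apply lt_0_INR; lia).
assert (HN1 : (0 < INR (N + n))%R) by (apply lt_0_INR; lia).
rewrite sqrt_div_alt by auto.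
assert (S1 := sqrt_lt_R0 _ HN0). assert (S2 := sqrt_lt_R0 _ HN1).
rewrite RtoC_div by lra.
assert (S1' := RtoC_neq_0 _ (Rgt_not_eq _ _ S1)). assert (S2' := RtoC_neq_0 _ (Rgt_not_eq _ _ S2)).
generalize dependent (RtoC (sqrt (INR N))). generalize dependent (RtoC (sqrt (INR (N + n)))).
generalize dependent (pochhammer z N). generalize dependent (pochhammer (z + 1 / 2) N).
generalize dependent (pochhammer (z + 1 / 2 + INR N) n).
intros. field. repeat split; auto.
Qed.

(** With s^2 = 1 + y and t^2 = 3, the difference 1/s - 1/t equals (t^2 - s^2) / (s t (s + t)), whose
    denominator is at least 1. The point y = 2 corresponds to n = 6N. *)
Lemma sqrt_ratio_lipschitz y : (0 <= y)%R ->
  (sqrt (1 / (1 + y)) <= 1 /\ Rabs (sqrt (1 / (1 + y)) - 1 / sqrt 3) <= Rabs (y - 2))%R.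
Proof.
intros Hy.
rewrite sqrt_div_alt, sqrt_1 by lra.
assert (A1 : (1 <= sqrt (1 + y))%R).
{ rewrite <- sqrt_1 at 1. apply sqrt_le_1_alt. lra. }
assert (A2 : (1 <= sqrt 3)%R).
{ rewrite <- sqrt_1 at 1. apply sqrt_le_1_alt. lra. }
assert (E1 : (sqrt (1 + y) * sqrt (1 + y) = 1 + y)%R) by (apply sqrt_sqrt; lra).
assert (E2 : (sqrt 3 * sqrt 3 = 3)%R) by (apply sqrt_sqrt; lra).
set (s := sqrt (1 + y)) in *. set (t := sqrt 3) in *.
split.
- apply Rle_div_l; lra.
- replace (1 / s - 1 / t)%R with (- (y - 2) * / (s * t * (s + t)))%R.
  2:{ replace (- (y - 2))%R with (t * t - s * s)%R by lra. field. repeat split; lra. }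
  rewrite Rabs_mult, Rabs_Ropp. rewrite <- (Rmult_1_r (Rabs (y - 2))) at 2.
  apply Rmult_le_compat_l; [apply Rabs_pos|].
  assert (1 <= s * t)%R by nra.
  rewrite Rabs_pos_eq.
  + rewrite <- Rinv_1. apply Rinv_le_contravar; nra.
  + left. apply Rinv_0_lt_compat. nra.
Qed.

Lemma sum_n_C_lin (u v : nat -> C) (k : C) n :
  Csum_n u n - k * Csum_n v n =
  Csum_n (fun j => u j - k * v j) n.
Proof.
induction n as [|n IH].
- now rewrite !sum_n_C_0.
- rewrite !sum_n_C_S, <- IH. ring.
Qed.

(* The terms are negative binomial weights times a ratio close to [sqrt (1 / (1 + y))] with
   [y = n / (3 N)]; the deviation of that factor from its value at [y = 2] is controlled by the
   second moment of the weights about [6 N], after [|y - 2| <= eps + (y - 2)^2 / eps]. *)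
Lemma strange_sum_near a (eps : posreal) :
  ~ nonpos_int (a + 1 / 4) -> ~ nonpos_int (a + 3 / 4) -> ~ nonpos_int (2 * a) ->
  let c := (4 * a + 1) / 6 in
  exists N0, forall N, (N0 <= N)%nat ->
  (Cmod (strange_sum (a + INR (3 * N)) - (1 / sqrt 3)%R * Rpow_C 4 (c + INR (2 * N))) <=
   exp ((Cmod c + INR (2 * N)) * ln 4) *
     (2 * eps + (9 * Cmod c ^ 2 + 12 * (Cmod c + INR (2 * N))) / (9 * INR N ^ 2 * eps)))%R.
Proof.
intros h1 h2 h0 c.
assert (h3 := admissible_double a h1 h2).
destruct (half_ratio_quotient (2 * a) h0 h3 eps) as [M0 HM0].
exists (M0 + 1)%nat. intros N HN.
assert (HN1 : (1 <= INR N)%R) by (apply (le_INR 1); lia).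
set (b := a + INR (3 * N)).
assert (hb1 := nonpos_int_shift_frac a _ (3 * N) h1).
assert (hb2 := nonpos_int_shift_frac a _ (3 * N) h2).
fold b in hb1, hb2.
(* The real parameter of the dominating weights. It differs from 2N by at most |c|, so their mean 3g
   stays within 3|c| of the centre 6N. *)
set (g := Cmod (c + INR (2 * N))).
assert (Hg0 : (0 <= g)%R) by apply Cmod_ge_0.
assert (EN2 : Cmod (INR (2 * N)) = INR (2 * N)) by (rewrite Cmod_R; apply Rabs_pos_eq, pos_INR).
assert (Hg1 : (INR (2 * N) - Cmod c <= g <= INR (2 * N) + Cmod c)%R)
  by (apply Cmod_plus_INR_bounds; lra).
assert (Ecb : (4 * b + 1) / 6 = c + INR (2 * N)).
{ unfold b, c. rewrite !mult_INR, !RtoC_mult, !INR_IZR_INZ. simpl IZR. field. }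
set (p := fun n => rising_binomial (c + INR (2 * N)) n * (3 / 4) ^ n).
set (kap := (1 / sqrt 3)%R).
set (v := fun n => (2 * eps * negbin g n + / (9 * INR N ^ 2 * eps) * (negbin g n * (INR n - 6 * INR N) ^ 2))%R).
assert (Heps := cond_pos eps).
assert (Hv : is_series v (2 * eps * exp (g * ln 4) + / (9 * INR N ^ 2 * eps) *
   (exp (g * ln 4) * ((3 * g - 6 * INR N) ^ 2 + 12 * g)))%R).
{ apply is_series_R_plus; apply is_series_R_scal.
  - now apply is_series_negbin.
  - now apply negbin_variance. }
assert (HU : Clim (Csum_n (fun n => strange_term b n - kap * p n))
   (strange_sum b - kap * Rpow_C 4 (c + INR (2 * N)))).
{ eapply Clim_ext; [intros n; apply sum_n_C_lin|].
  apply Clim_plus; [now apply strange_sum_is_series|].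
  apply Clim_opp, Clim_mult; [apply Clim_const|]. apply binomial_series. }
assert (HB : forall n, (Cmod (strange_term b n - kap * p n) <= v n)%R).
{ intros n.
  rewrite strange_term_negbin, Ecb by auto. fold (p n).
  replace (2 * b) with (2 * a + INR (6 * N)).
  2:{ unfold b. rewrite !mult_INR, !RtoC_mult, !INR_IZR_INZ. simpl IZR. ring. }
  rewrite shifted_ratio_eq by (auto; lia).
  assert (HQ := HM0 (6 * N)%nat (6 * N + 2 * n)%nat ltac:(lia) ltac:(lia)).
  set (e := half_ratio (2 * a) (6 * N + 2 * n) / half_ratio (2 * a) (6 * N)) in *.
  set (y := (INR n / (3 * INR N))%R).
  assert (Hy : (0 <= y)%R).
  { unfold y. apply Rmult_le_pos; [apply pos_INR | left; apply Rinv_0_lt_compat; lra]. }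
  replace (INR (6 * N) / INR (6 * N + 2 * n))%R with (1 / (1 + y))%R.
  2:{ unfold y. rewrite plus_INR, !mult_INR, !(INR_IZR_INZ 6), !(INR_IZR_INZ 2). simpl IZR.
      pose proof (pos_INR n). field. split; lra. }
  destruct (sqrt_ratio_lipschitz y Hy) as [L1 L2].
  set (s := sqrt (1 / (1 + y))) in *. fold kap in L2.
  assert (Hs0 : (0 <= s)%R) by apply sqrt_pos.
  replace (p n * (e * s) - kap * p n) with (p n * ((e - 1) * s + (s - kap)%R))
    by (rewrite RtoC_minus; ring).
  rewrite Cmod_mult.
  assert (Hp : (Cmod (p n) <= negbin g n)%R).
  { unfold p, negbin. rewrite Cmod_mult, Cmod_pow.
    replace (Cmod (3 / 4)) with (3 / 4)%R by (rewrite <- RtoC_div, Cmod_R, Rabs_pos_eq; lra).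
    apply Rmult_le_compat_r; [apply pow_le; lra|]. apply Cmod_rising_binomial_le. }
  assert (Hx : (Cmod ((e - 1) * s + (s - kap)%R) <= eps + Rabs (y - 2))%R).
  { eapply Rle_trans; [apply Cmod_triangle|]. rewrite Cmod_mult, !Cmod_R, (Rabs_pos_eq s) by auto.
    apply Rplus_le_compat; [|exact L2]. pose proof (Cmod_ge_0 (e - 1)). nra. }
  assert (Hx2 : (Rabs (y - 2) <= eps + (y - 2) ^ 2 / eps)%R).
  { rewrite <- pow2_abs. set (t := Rabs (y - 2)).
    apply Rmult_le_reg_r with (pos eps); [auto|].
    replace ((eps + t ^ 2 / eps) * eps)%R with (eps * eps + t ^ 2)%R by (field; lra).
    assert (0 <= t)%R by apply Rabs_pos. nra. }
  unfold v.
  replace (2 * eps * negbin g n + / (9 * INR N ^ 2 * eps) * (negbin g n * (INR n - 6 * INR N) ^ 2))%R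
    with (negbin g n * (eps + (eps + (y - 2) ^ 2 / eps)))%R by (unfold y; field; lra).
  apply Rmult_le_compat; auto using Cmod_ge_0. lra. }
assert (HF := Cmod_series_le _ _ _ _ HB HU Hv).
eapply Rle_trans; [exact HF|].
assert (Hexp : (exp (g * ln 4) <= exp ((Cmod c + INR (2 * N)) * ln 4))%R).
{ apply exp_mono. apply Rmult_le_compat_r; [|lra].
  rewrite <- ln_1. apply Rlt_le, ln_increasing; lra. }
replace (2 * eps * exp (g * ln 4) + / (9 * INR N ^ 2 * eps) *
   (exp (g * ln 4) * ((3 * g - 6 * INR N) ^ 2 + 12 * g)))%R with
  (exp (g * ln 4) * (2 * eps + ((3 * g - 6 * INR N) ^ 2 + 12 * g) / (9 * INR N ^ 2 * eps)))%R
  by (field; lra).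
assert (HD : (0 < 9 * INR N ^ 2 * eps)%R) by (apply Rmult_lt_0_compat; nra).
assert (HG : ((3 * g - 6 * INR N) ^ 2 + 12 * g <= 9 * Cmod c ^ 2 + 12 * (Cmod c + INR (2 * N)))%R).
{ assert (E : INR (2 * N) = (2 * INR N)%R) by (rewrite mult_INR; simpl; ring).
  rewrite E in *. pose proof (Cmod_ge_0 c). nra. }
apply Rmult_le_compat; [left; apply exp_pos | | exact Hexp |].
- apply Rplus_le_le_0_compat; [lra|]. apply Rmult_le_pos; [|left; now apply Rinv_0_lt_compat].
  pose proof (pow2_ge_0 (3 * g - 6 * INR N)); lra.
- apply Rplus_le_compat_l. apply Rmult_le_compat_r; [left; now apply Rinv_0_lt_compat | exact HG].
Qed.

(** * The sum in terms of the reciprocal Gamma function *)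

Lemma Rpow_C_4_double c N : Rpow_C 4 (c + INR (2 * N)) = Rpow_C 4 c * 16 ^ N.
Proof.
rewrite Rpow_C_plus, Rpow_C_INR by lra. f_equal.
rewrite <- RtoC_pow. f_equal. rewrite pow_mult. f_equal. ring.
Qed.

Lemma strange_sum_lim_aux a :
  ~ nonpos_int (a + 1 / 4) -> ~ nonpos_int (a + 3 / 4) -> ~ nonpos_int (2 * a) ->
  Clim (fun N => strange_sum (a + INR (3 * N)) / 16 ^ N)
    ((1 / sqrt 3)%R * Rpow_C 4 ((4 * a + 1) / 6)).
Proof.
intros h1 h2 h0.
set (c := (4 * a + 1) / 6). set (kap := (1 / sqrt 3)%R).
apply Clim_eps; intros eta.
set (E := exp (Cmod c * ln 4)).
assert (HE : (0 < E)%R) by apply exp_pos.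
assert (Heta := cond_pos eta).
(* This choice makes the first error term E (2 eps) equal to eta/4; the second one is at most eta/2
   for large N. *)
assert (He : (0 < eta / (8 * E))%R) by (apply Rdiv_lt_0_compat; lra).
set (eps := mkposreal _ He).
destruct (strange_sum_near a eps h1 h2 h0) as [N0 HN0]. fold c in HN0.
assert (Hc := Cmod_ge_0 c).
set (K := (9 * Cmod c ^ 2 + 12 * Cmod c + 24)%R).
assert (HK : (0 < K)%R) by (unfold K; nra).
destruct (ex_nat_ge (E * K / (9 * eps) * (2 / eta))) as [N1 HN1].
exists (N0 + N1 + 1)%nat. intros N HN.
specialize (HN0 N ltac:(lia)). specialize (HN1 N ltac:(lia)).
assert (HNr : (1 <= INR N)%R) by (apply (le_INR 1); lia).
assert (P16 : (0 < 16 ^ N)%R) by (apply pow_lt; lra).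
assert (C16 : RtoC 16 ^ N <> 0) by (apply Cpow_nz, RtoC_neq_0; lra).
replace (strange_sum (a + INR (3 * N)) / 16 ^ N - kap * Rpow_C 4 c) with
  ((strange_sum (a + INR (3 * N)) - kap * Rpow_C 4 (c + INR (2 * N))) / 16 ^ N).
2:{ rewrite Rpow_C_4_double. field. auto. }
rewrite Cmod_div, Cmod_pow, Cmod_R, Rabs_pos_eq by (auto; lra).
apply Rlt_div_l; [lra|].
eapply Rle_lt_trans; [exact HN0|].
assert (E2 : exp ((Cmod c + INR (2 * N)) * ln 4) = (E * 16 ^ N)%R).
{ unfold E. rewrite Rmult_plus_distr_r, exp_plus. f_equal.
  rewrite <- ln_pow, exp_ln by (try apply pow_lt; lra). rewrite pow_mult. f_equal. ring. }
rewrite E2, (Rmult_comm E), Rmult_assoc, (Rmult_comm eta).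
apply Rmult_lt_compat_l; [auto|].
assert (Heps := cond_pos eps).
assert (B : ((9 * Cmod c ^ 2 + 12 * (Cmod c + INR (2 * N))) / (9 * INR N ^ 2 * eps) <=
   K / (9 * INR N * eps))%R).
{ replace (K / (9 * INR N * eps))%R with ((K * INR N) / (9 * INR N ^ 2 * eps))%R by (field; lra).
  apply Rmult_le_compat_r; [left; apply Rinv_0_lt_compat; apply Rmult_lt_0_compat; nra|].
  rewrite mult_INR. simpl (INR 2). unfold K. nra. }
assert (B2 : (E * (K / (9 * INR N * eps)) <= eta / 2)%R).
{ replace (E * (K / (9 * INR N * eps)))%R with ((E * K / (9 * eps)) / INR N)%R by (field; lra).
  apply Rle_div_l; [lra|].
  apply Rmult_le_reg_r with (2 / eta)%R; [apply Rdiv_lt_0_compat; lra|].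
  eapply Rle_trans; [exact HN1|]. apply Req_le. field. lra. }
assert (B3 : (E * (2 * eps) = eta / 4)%R) by (unfold eps; simpl; field; lra).
apply Rle_lt_trans with (E * (2 * eps) + E * (K / (9 * INR N * eps)))%R; [|lra].
rewrite <- Rmult_plus_distr_l. apply Rmult_le_compat_l; lra.
Qed.

(** When 2a is a nonpositive integer, [half_ratio (2 * a)] is eventually zero and the previous
    argument breaks down. Only large N matter, so [a] is replaced by [a + 3 N1] with positive real
    part, and both sides pick up the factor 16^N1. *)
Lemma strange_sum_lim a :
  ~ nonpos_int (a + 1 / 4) -> ~ nonpos_int (a + 3 / 4) ->
  Clim (fun N => strange_sum (a + INR (3 * N)) / 16 ^ N)
    ((1 / sqrt 3)%R * Rpow_C 4 ((4 * a + 1) / 6)).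
Proof.
intros h1 h2.
destruct (ex_nat_ge (1 - Re a)) as [N1 HN1]. specialize (HN1 N1 (le_n _)).
apply Clim_incr_n with N1.
set (b := a + INR (3 * N1)).
assert (hb0 : ~ nonpos_int (2 * b)).
{ intros [k E]. apply (f_equal Re) in E. unfold b in E.
  rewrite re_scal_l in E. rewrite mult_INR in E. simpl in E.
  pose proof (pos_INR k). pose proof (pos_INR N1). unfold Re in HN1. lra. }
assert (hb1 := nonpos_int_shift_frac a _ (3 * N1) h1).
assert (hb2 := nonpos_int_shift_frac a _ (3 * N1) h2).
assert (H := strange_sum_lim_aux b hb1 hb2 hb0).
assert (C16 : forall N, RtoC 16 ^ N <> 0) by (intros; apply Cpow_nz, RtoC_neq_0; lra).
assert (H2 := Clim_mult _ _ _ _ H (Clim_const (/ 16 ^ N1))).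
replace (Rpow_C 4 ((4 * b + 1) / 6)) with (Rpow_C 4 ((4 * a + 1) / 6) * 16 ^ N1) in H2.
2:{ rewrite <- Rpow_C_4_double. f_equal. unfold b.
    rewrite !mult_INR, !RtoC_mult, !INR_IZR_INZ. simpl IZR. field. }
replace ((1 / sqrt 3)%R * (Rpow_C 4 ((4 * a + 1) / 6) * 16 ^ N1) * / 16 ^ N1) with
  ((1 / sqrt 3)%R * Rpow_C 4 ((4 * a + 1) / 6)) in H2 by (field; auto).
eapply Clim_ext; [|exact H2].
intros n. unfold b. cbv beta.
replace (a + INR (3 * N1) + INR (3 * n)) with (a + INR (3 * (n + N1))).
2:{ rewrite !mult_INR, plus_INR, Rmult_plus_distr_l, RtoC_plus. ring. }
rewrite Cpow_add_r. field. auto.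
Qed.

Lemma pochhammer_2_S z N :
  pochhammer z (2 * S N) = pochhammer z (2 * N) * ((z + 2 * INR N) * (z + 2 * INR N + 1)).
Proof.
replace (2 * S N)%nat with (2 * N + 2)%nat by lia.
rewrite pochhammer_add. f_equal. rewrite mult_INR, RtoC_mult.
rewrite (INR_IZR_INZ 2). simpl IZR. simpl. ring.
Qed.

Lemma pochhammer_6_S z N :
  pochhammer z (6 * S N) = pochhammer z (6 * N) *
    ((z + 6 * INR N) * (z + 6 * INR N + 1) * (z + 6 * INR N + 2) * (z + 6 * INR N + 3) *
     (z + 6 * INR N + 4) * (z + 6 * INR N + 5)).
Proof.
replace (6 * S N)%nat with (6 * N + 6)%nat by lia.
rewrite pochhammer_add. f_equal. rewrite mult_INR, RtoC_mult.
rewrite (INR_IZR_INZ 6). unfold pochhammer. rewrite !INR_IZR_INZ. simpl IZR. ring.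
Qed.

(** The four factors on the left of the recurrence at a + 3X become six consecutive ones through
    (2a+6X+1) (2a+6X+6) = 36 ((2a+1)/6 + X) (1 + a/3 + X). Those of [wz_factor] are completed by
    a+3X+1/4 and a+3X+7/4, which are 3/2 times c+2X and c+2X+1. The product form tolerates vanishing
    factors. *)
Lemma strange_sum_iter a N :
  ~ nonpos_int (a + 1 / 4) -> ~ nonpos_int (a + 3 / 4) ->
  strange_sum a * 64 ^ N * pochhammer ((2 * a + 1) / 6) N * pochhammer (1 + a / 3) N *
    pochhammer (2 * a + 1 / 2) (6 * N) =
  strange_sum (a + INR (3 * N)) * pochhammer ((4 * a + 1) / 6) (2 * N) *
    pochhammer (2 * a + 1) (6 * N).
Proof.
intros h1 h2. induction N as [|N IH].
- simpl. rewrite Cplus_0_r. ring.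
- assert (HR := strange_sum_rec _ (nonpos_int_shift_frac a _ (3 * N) h1)
    (nonpos_int_shift_frac a _ (3 * N) h2)).
  replace (a + INR (3 * N) + 3) with (a + INR (3 * S N)) in HR.
  2:{ rewrite <- INR_3, <- Cplus_assoc, <- RtoC_plus, <- plus_INR. do 3 f_equal. lia. }
  rewrite pochhammer_2_S, !pochhammer_6_S.
  replace (RtoC (INR (3 * N))) with (3 * INR N) in HR
    by (rewrite mult_INR, RtoC_mult, (INR_IZR_INZ 3); reflexivity).
  simpl Cpow.
  change (pochhammer ?z (S N)) with (pochhammer z N * (z + INR N)).
  replace (RtoC (INR (3 * N))) with (3 * INR N) in IH
    by (rewrite mult_INR, RtoC_mult, (INR_IZR_INZ 3); reflexivity).
  set (S1 := strange_sum (a + INR (3 * S N))) in *.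
  set (S0 := strange_sum (a + 3 * INR N)) in *. set (Sa := strange_sum a) in *.
  clearbody S1 S0 Sa. revert IH.
  generalize (pochhammer ((2 * a + 1) / 6) N) (pochhammer (1 + a / 3) N)
    (pochhammer (2 * a + 1 / 2) (6 * N)) (pochhammer ((4 * a + 1) / 6) (2 * N))
    (pochhammer (2 * a + 1) (6 * N)) (RtoC 64 ^ N).
  generalize dependent (RtoC (INR N)). intros X HR p1 p2 p3 p4 p5 q IH.
  transitivity ((Sa * q * p1 * p2 * p3) * (64 * ((2 * a + 1) / 6 + X) * (1 + a / 3 + X) *
    ((2 * a + 1 / 2 + 6 * X) * (2 * a + 1 / 2 + 6 * X + 1) * (2 * a + 1 / 2 + 6 * X + 2) *
     (2 * a + 1 / 2 + 6 * X + 3) * (2 * a + 1 / 2 + 6 * X + 4) * (2 * a + 1 / 2 + 6 * X + 5)))).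
  { ring. }
  rewrite IH.
  transitivity (p4 * p5 * ((4 * a + 1) / 6 + 2 * X) * ((4 * a + 1) / 6 + 2 * X + 1) *
    (2 * a + 6 * X + 1) * (2 * a + 6 * X + 6) * (256 * wz_factor (a + 3 * X) * S0)).
  { unfold wz_factor. field. }
  rewrite <- HR. ring.
Qed.

Lemma pochhammer_1 n : pochhammer 1 n = INR (fact n).
Proof.
induction n as [|n IH]; [reflexivity|].
rewrite fact_simpl, mult_INR, RtoC_mult, RtoC_S, <- IH. simpl. ring.
Qed.

Lemma INR_fact_double n :
  RtoC (INR (fact (2 * n))) = 4 ^ n * pochhammer (1 / 2) n * INR (fact n).
Proof.
rewrite <- !pochhammer_1. replace (pochhammer 1 (2 * n)) with (pochhammer (2 * (1 / 2)) (2 * n))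
  by (f_equal; field).
rewrite pochhammer_double. replace (1 / 2 + 1 / 2) with (RtoC 1) by field. reflexivity.
Qed.

Lemma Rpow_C_sum_0 x z w : z + w = 0 -> Rpow_C x z * Rpow_C x w = 1.
Proof. intros H. rewrite <- Rpow_C_plus, H. apply Rpow_C_0. Qed.

(** After normalisation all powers of N cancel. The quotient of (2N)! by N! is 4^N (1/2)_N, which
    introduces the approximant at 1/2 and hence the [sqrt PI] of the formula; the last factor
    collects what remains of the powers of 2N and 6N. *)
Lemma strange_sum_approx a N : (1 <= N)%nat ->
  ~ nonpos_int (a + 1 / 4) -> ~ nonpos_int (a + 3 / 4) ->
  strange_sum a * rgamma_approx ((2 * a + 1) / 6) N * rgamma_approx (1 + a / 3) N *
    rgamma_approx (2 * a + 1 / 2) (6 * N) =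
  strange_sum (a + INR (3 * N)) / 16 ^ N * rgamma_approx ((4 * a + 1) / 6) (2 * N) *
    rgamma_approx (2 * a + 1) (6 * N) * rgamma_approx (1 / 2) N *
    (Rpow_C 2 ((4 * a + 1) / 6 - 1) * sqrt 6).
Proof.
intros HN h1 h2.
assert (HI := strange_sum_iter a N h1 h2).
assert (HF := INR_fact_double N).
assert (HN0 : (0 < INR N)%R) by (apply lt_0_INR; lia).
assert (F1 := RtoC_neq_0 _ (INR_fact_neq_0 N)).
assert (F2 := RtoC_neq_0 _ (INR_fact_neq_0 (2 * N))).
assert (F6 := RtoC_neq_0 _ (INR_fact_neq_0 (6 * N))).
assert (C4 : RtoC 4 ^ N <> 0) by (apply Cpow_nz, RtoC_neq_0; lra).
assert (C16 : RtoC 16 ^ N = 4 ^ N * 4 ^ N).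
{ rewrite <- Cpow_mult_l. f_equal. ring. }
assert (C64 : RtoC 64 ^ N = 4 ^ N * 4 ^ N * 4 ^ N).
{ rewrite <- !Cpow_mult_l. f_equal. ring. }
unfold rgamma_approx.
replace (INR (6 * N)) with (6 * INR N)%R by (rewrite mult_INR, (INR_IZR_INZ 6); reflexivity).
replace (INR (2 * N)) with (2 * INR N)%R by (rewrite mult_INR, (INR_IZR_INZ 2); reflexivity).
rewrite (Rpow_C_mult 2), !(Rpow_C_mult 6) by lra.
rewrite C16. rewrite C64 in HI.
replace (1 - (2 * a + 1 / 2)) with ((1 - (2 * a + 1)) + 1 / 2) by field.
rewrite !(Rpow_C_plus _ (1 - (2 * a + 1)) (1 / 2)).
replace (1 - 1 / 2) with (RtoC 1 / 2) by field.
rewrite (Rpow_C_half 6) by lra.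
assert (Q1 : Rpow_C 2 (1 - (4 * a + 1) / 6) * Rpow_C 2 ((4 * a + 1) / 6 - 1) = 1)
  by (apply Rpow_C_sum_0; ring).
assert (Q2 : Rpow_C (INR N) (1 - (2 * a + 1) / 6) * Rpow_C (INR N) (1 - (1 + a / 3)) =
   Rpow_C (INR N) (1 - (4 * a + 1) / 6)).
{ rewrite <- Rpow_C_plus. f_equal. field. }
rewrite <- Q2.
set (S0 := strange_sum (a + INR (3 * N))) in *. set (Sa := strange_sum a) in *.
clearbody S0 Sa. clear Q2.
generalize dependent (Rpow_C 2 (1 - (4 * a + 1) / 6)).
generalize dependent (Rpow_C 2 ((4 * a + 1) / 6 - 1)).
generalize (Rpow_C (INR N) (1 - (2 * a + 1) / 6)) (Rpow_C (INR N) (1 - (1 + a / 3)))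
  (Rpow_C (INR N) (1 - (2 * a + 1))) (Rpow_C 6 (1 - (2 * a + 1))) (Rpow_C (INR N) (1 / 2))
  (RtoC (sqrt 6)).
generalize dependent (pochhammer (1 / 2) N).
generalize dependent (pochhammer ((2 * a + 1) / 6) N).
generalize dependent (pochhammer (1 + a / 3) N).
generalize dependent (pochhammer (2 * a + 1 / 2) (6 * N)).
generalize dependent (pochhammer ((4 * a + 1) / 6) (2 * N)).
generalize dependent (pochhammer (2 * a + 1) (6 * N)).
generalize dependent (RtoC (INR (fact N))). generalize dependent (RtoC (INR (fact (2 * N)))).
generalize dependent (RtoC (INR (fact (6 * N)))). clear C16 C64.
generalize dependent (RtoC 4 ^ N).
intros q Hq f6 Hf6 f2 Hf2 f1 Hf1 p5 p4 p3 p2 p1 HI ph HF r1 r2 r3 r4 r5 s6 t t' Q1.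
transitivity ((Sa * (q * q * q) * p1 * p2 * p3) * (r1 * r2 * r3 * r4 * r5 * s6) /
  (q * q * q * f1 * f1 * f6)); [field; auto|].
rewrite HI.
transitivity (S0 * p4 * p5 * (r1 * r2 * r3 * r4 * r5 * s6) * (t' * t) * f2 /
  (q * q * q * f1 * f1 * f6 * f2)); [rewrite Q1; field; auto|].
rewrite HF at 1. field. auto.
Qed.

(** The evaluation in a form without divisions, valid at every admissible [a], including the
    singular points of the closed form. *)
Lemma strange_sum_rGamma a :
  ~ nonpos_int (a + 1 / 4) -> ~ nonpos_int (a + 3 / 4) ->
  strange_sum a * rGamma ((2 * a + 1) / 6) * rGamma (1 + a / 3) * rGamma (2 * a + 1 / 2) * sqrt PI =
  Rpow_C 2 (2 * a) * rGamma ((4 * a + 1) / 6) * rGamma (2 * a + 1).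
Proof.
intros h1 h2.
assert (HPI : RtoC (sqrt PI) <> 0) by (apply RtoC_neq_0, Rgt_not_eq, sqrt_lt_R0, PI_RGT_0).
set (c := (4 * a + 1) / 6).
assert (HL : strange_sum a * rGamma ((2 * a + 1) / 6) * rGamma (1 + a / 3) * rGamma (2 * a + 1 / 2) =
  (1 / sqrt 3)%R * Rpow_C 4 c * rGamma c * rGamma (2 * a + 1) * rGamma (1 / 2) *
    (Rpow_C 2 (c - 1) * sqrt 6)).
{ eapply Clim_unique.
  - apply Clim_mult; [apply Clim_mult; [apply Clim_mult; [apply Clim_const|]|]|].
    + apply rGamma_lim.
    + apply rGamma_lim.
    + apply (Clim_subseq (rgamma_approx (2 * a + 1 / 2)) _ (fun N => (6 * N)%nat)); [intros; lia | apply rGamma_lim].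
  - eapply Clim_ext_loc.
    { exists 1%nat. intros n Hn. symmetry. apply (strange_sum_approx a n Hn h1 h2). }
    apply Clim_mult; [|apply Clim_const].
    apply Clim_mult; [|apply rGamma_lim].
    apply Clim_mult; [apply Clim_mult|].
    + now apply strange_sum_lim.
    + apply (Clim_subseq (rgamma_approx c) _ (fun N => (2 * N)%nat)); [intros; lia | apply rGamma_lim].
    + apply (Clim_subseq (rgamma_approx (2 * a + 1)) _ (fun N => (6 * N)%nat)); [intros; lia | apply rGamma_lim]. }
rewrite HL, rGamma_half.
(* The total exponent of 2 is 2c + (c - 1) + 1/2, which equals 2a because 3c = 2a + 1/2. *)
assert (E : (1 / sqrt 3)%R * Rpow_C 4 c * (Rpow_C 2 (c - 1) * sqrt 6) = Rpow_C 2 (2 * a)).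
{ replace 4%R with (2 * 2)%R by ring. rewrite Rpow_C_mult by lra.
  replace (2 * a) with (c + c + (c - 1) + 1 / 2) by (unfold c; field).
  rewrite !Rpow_C_plus, Rpow_C_half by lra.
  replace (RtoC (sqrt 2)) with ((1 / sqrt 3)%R * sqrt 6); [ring|].
  rewrite <- RtoC_mult. f_equal.
  replace 6%R with (3 * 2)%R by ring. rewrite sqrt_mult_alt by lra. field.
  apply Rgt_not_eq, sqrt_lt_R0; lra. }
rewrite <- E. field. auto.
Qed.

(** * Comparison with the closed form *)

(** The minimal equation of a primitive sixth root of unity; besides being nonzero, this is all that
    the triple angle formula uses about it. *)
Lemma Cexp_sixth : Cexp (Ci * (PI / 3)) * Cexp (Ci * (PI / 3)) = Cexp (Ci * (PI / 3)) - 1.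
Proof.
assert (E : Cexp (Ci * (PI / 3)) = ((1 / 2)%R, (sqrt 3 / 2)%R)).
{ rewrite <- RtoC_div by lra. unfold Cexp. rewrite re_scal_r, im_scal_r. cbn [Ci Re Im fst snd].
  rewrite Rmult_0_l, Rmult_1_l, exp_0, cos_PI3, sin_PI3. f_equal; ring. }
rewrite E. assert (S : (sqrt 3 * sqrt 3 = 3)%R) by (apply sqrt_sqrt; lra).
apply C_ext; simpl; [|field].
replace (1 / 2 * (1 / 2) - sqrt 3 / 2 * (sqrt 3 / 2))%R with (1 / 4 - sqrt 3 * sqrt 3 / 4)%R by field.
rewrite S. field.
Qed.

Lemma Ccos_triple x :
  Ccos (3 * x) = 4 * Ccos x * Ccos (x + PI / 3) * Ccos (x - PI / 3).
Proof.
unfold Ccos.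
assert (H3 : Cexp (Ci * (3 * x)) = Cexp (Ci * x) * Cexp (Ci * x) * Cexp (Ci * x)).
{ rewrite <- !Cexp_plus. f_equal; ring. }
assert (Hp : Cexp (Ci * (x + PI / 3)) = Cexp (Ci * x) * Cexp (Ci * (PI / 3))).
{ rewrite <- !Cexp_plus. f_equal; ring. }
assert (Hm : Cexp (Ci * (x - PI / 3)) = Cexp (Ci * x) * / Cexp (Ci * (PI / 3))).
{ rewrite <- Cexp_opp, <- !Cexp_plus. f_equal; ring. }
rewrite !Cexp_opp, H3, Hp, Hm.
assert (HW := Cexp_sixth).
assert (Nw := Cexp_neq_0 (Ci * (PI / 3))). assert (Ne := Cexp_neq_0 (Ci * x)).
clear H3 Hp Hm.
set (e := Cexp (Ci * x)) in *. set (w := Cexp (Ci * (PI / 3))) in *. clearbody e w.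
assert (HW2 : w * w + / (w * w) = - (1)).
{ assert (w * w * w = - (1)).
  { rewrite HW. transitivity (w * w - w); [ring|]. rewrite HW. ring. }
  assert (I : / (w * w) = - w).
  { transitivity (- (w * w * w) / (w * w)); [rewrite H; field; auto | field; auto]. }
  rewrite I, HW. ring. }
transitivity ((e + / e) * (e * e + / (e * e) + (w * w + / (w * w))) / 2).
- rewrite HW2. field. auto.
- field. auto.
Qed.

(** The reflection formula locates the zeros of the complex cosine: [rGamma] does not vanish off the
    nonpositive integers. *)
Lemma Ccos_neq_0 s : ~ nonpos_int (1 / 2 + s) -> ~ nonpos_int (1 / 2 - s) -> Ccos (PI * s) <> 0.
Proof.
intros H1 H2 E. assert (H := rGamma_reflection_half s). rewrite E in H.
apply (Cmult_neq_0 _ _ (rGamma_neq_0 _ H1) (rGamma_neq_0 _ H2)). rewrite H.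
field. apply RtoC_neq_0. pose proof PI_RGT_0; lra.
Qed.

(** Reflection at 2a trades 2a + 1/2 for 1/2 - 2a, and reflection at (2a - 1)/3 trades c for (5 -
    4a)/6. The triple angle formula at x = 2 PI a / 3 splits the first cosine; its factor cos (x -
    PI/3) cancels the second cosine, and the other two are those of the closed form. *)
Lemma closed_form_strange_sum a :
  ~ nonpos_int (a + 1 / 4) -> ~ nonpos_int (a + 3 / 4) -> closed_form_regular a ->
  closed_form a = strange_sum a.
Proof.
intros h1 h2 (D1 & D2 & D3 & D4 & D5 & D6 & D7).
assert (HM := strange_sum_rGamma a h1 h2).
unfold closed_form. rewrite !CGamma_rGamma by assumption.
assert (G1 := rGamma_neq_0 _ D1). assert (G2 := rGamma_neq_0 _ D2). assert (G3 := rGamma_neq_0 _ D3).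
assert (G4 := rGamma_neq_0 _ D4). assert (G5 := rGamma_neq_0 _ D5).
assert (G6 := rGamma_neq_0 _ (admissible_double a h1 h2)).
replace (2 * a + 1) with (1 + 2 * a) in HM by ring.
assert (R1 := rGamma_reflection_half (2 * a)).
replace (1 / 2 + 2 * a) with (2 * a + 1 / 2) in R1 by ring.
assert (R2 := rGamma_reflection_half ((2 * a - 1) / 3)).
replace (1 / 2 + (2 * a - 1) / 3) with ((4 * a + 1) / 6) in R2 by field.
replace (1 / 2 - (2 * a - 1) / 3) with ((5 - 4 * a) / 6) in R2 by field.
assert (T := Ccos_triple (2 * PI * a / 3)).
replace (3 * (2 * PI * a / 3)) with (PI * (2 * a)) in T by field.
replace (2 * PI * a / 3 + PI / 3) with (PI * (1 + 2 * a) / 3) in T by field.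
replace (2 * PI * a / 3 - PI / 3) with (PI * ((2 * a - 1) / 3)) in T by field.
rewrite T in R1.
(* This 4 is the one in the triple angle formula, which explains the power 2^(2-2a) of the closed
   form. *)
assert (P2 : Rpow_C 2 (2 - 2 * a) * Rpow_C 2 (2 * a) = 4).
{ rewrite <- Rpow_C_plus. replace (2 - 2 * a + 2 * a) with (RtoC (INR 2)) by (rewrite (INR_IZR_INZ 2); simpl IZR; ring).
  rewrite Rpow_C_INR by lra. f_equal; ring. }
assert (Np := Rpow_C_neq_0 2 (2 - 2 * a)).
assert (HPI : RtoC PI <> 0) by (apply RtoC_neq_0; pose proof PI_RGT_0; lra).
assert (HsP : RtoC (sqrt PI) <> 0) by (apply RtoC_neq_0, Rgt_not_eq, sqrt_lt_R0, PI_RGT_0).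
clear D1 D2 D3 D4 D5 T.
set (S0 := strange_sum a) in *.
set (c1 := Ccos (2 * PI * a / 3)) in *. set (c2 := Ccos (PI * (1 + 2 * a) / 3)) in *.
set (c3 := Ccos (PI * ((2 * a - 1) / 3))) in *.
set (p' := Rpow_C 2 (2 - 2 * a)) in *. set (p := Rpow_C 2 (2 * a)) in *.
set (g1 := rGamma ((5 - 4 * a) / 6)) in *.
replace ((2 * a + 1) / 6) with ((1 + 2 * a) / 6) in HM by (field).
set (g2 := rGamma ((1 + 2 * a) / 6)) in *. set (g3 := rGamma (1 + a / 3)) in *.
set (g4 := rGamma (1 / 2 - 2 * a)) in *. set (g5 := rGamma (1 + 2 * a)) in *.
set (g6 := rGamma (2 * a + 1 / 2)) in *. set (gc := rGamma ((4 * a + 1) / 6)) in *.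
set (sp := RtoC (sqrt PI)) in *. set (pi := RtoC PI) in *.
clearbody S0 c1 c2 c3 p p' g1 g2 g3 g4 g5 g6 gc sp pi.
transitivity ((g6 * g4) * g5 / (g6 * g1 * g2 * g3 * p' * sp * c1 * c2)).
{ field. repeat split; auto. }
rewrite R1.
transitivity (4 * g5 / (g6 * g1 * g2 * g3 * p' * sp) * (c3 / pi)).
{ field. repeat split; auto. }
rewrite <- R2, <- P2.
transitivity ((p * gc * g5) / (g6 * g2 * g3 * sp)).
{ field. repeat split; auto. }
rewrite <- HM. field. repeat split; auto.
Qed.

(** * Continuity of the sum and isolation of the singular points *)

Definition Ccont (f : C -> C) (a : C) : Prop :=
  forall eps : posreal, exists d : posreal, forall x, (Cmod (x - a) < d)%R ->
    (Cmod (f x - f a) < eps)%R.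

Lemma Ccont_const k a : Ccont (fun _ => k) a.
Proof.
intros eps. exists (mkposreal 1 Rlt_0_1). intros x _.
replace (k - k) with (RtoC 0) by ring. rewrite Cmod_0. apply cond_pos.
Qed.

Lemma Ccont_id a : Ccont (fun x => x) a.
Proof. intros eps. exists eps. auto. Qed.

Lemma Ccont_plus f g a : Ccont f a -> Ccont g a -> Ccont (fun x => f x + g x) a.
Proof.
intros Hf Hg eps.
destruct (Hf (pos_div_2 eps)) as [d1 H1]. destruct (Hg (pos_div_2 eps)) as [d2 H2].
exists (mkposreal _ (Rmin_stable_in_posreal d1 d2)). simpl. intros x Hx.
specialize (H1 x (Rlt_le_trans _ _ _ Hx (Rmin_l _ _))).
specialize (H2 x (Rlt_le_trans _ _ _ Hx (Rmin_r _ _))). simpl in *.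
replace (f x + g x - (f a + g a)) with ((f x - f a) + (g x - g a)) by ring.
eapply Rle_lt_trans; [apply Cmod_triangle|]. lra.
Qed.

Lemma Ccont_mult f g a : Ccont f a -> Ccont g a -> Ccont (fun x => f x * g x) a.
Proof.
intros Hf Hg eps.
set (K := (1 + Cmod (f a) + Cmod (g a))%R).
pose proof (Cmod_ge_0 (f a)). pose proof (Cmod_ge_0 (g a)).
assert (HK : (1 <= K)%R) by (unfold K; lra).
assert (He : (0 < Rmin 1 (eps / K))%R).
{ apply Rmin_pos; [lra|]. apply Rdiv_lt_0_compat; [apply cond_pos | lra]. }
destruct (Hf (pos_div_2 (mkposreal _ He))) as [d1 H1].
destruct (Hg (pos_div_2 (mkposreal _ He))) as [d2 H2].
exists (mkposreal _ (Rmin_stable_in_posreal d1 d2)). simpl. intros x Hx.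
specialize (H1 x (Rlt_le_trans _ _ _ Hx (Rmin_l _ _))).
specialize (H2 x (Rlt_le_trans _ _ _ Hx (Rmin_r _ _))). simpl in H1, H2.
replace (f x * g x - f a * g a) with
  ((f x - f a) * (g x - g a) + (f x - f a) * g a + f a * (g x - g a)) by ring.
set (m := Rmin 1 (eps / K)) in *.
assert (Hm1 : (m <= 1)%R) by apply Rmin_l. assert (Hm2 : (m <= eps / K)%R) by apply Rmin_r.
assert (Hm3 : (m * K <= eps)%R) by (apply Rle_div_r in Hm2; lra).
pose proof (Cmod_ge_0 (f x - f a)). pose proof (Cmod_ge_0 (g x - g a)).
eapply Rle_lt_trans.
{ eapply Rle_trans; [apply Cmod_triangle|]. apply Rplus_le_compat_r, Cmod_triangle. }
rewrite !Cmod_mult. unfold K in Hm3. nra.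
Qed.

Lemma Ccont_inv (f : C -> C) a : f a <> 0 -> Ccont f a -> Ccont (fun x => / f x) a.
Proof.
intros H0 Hf eps.
assert (Hl : (0 < Cmod (f a))%R) by exact (proj1 (Cmod_gt_0 _) H0).
assert (He : (0 < Rmin (Cmod (f a) / 2) (eps * (Cmod (f a) * Cmod (f a)) / 2))%R).
{ destruct eps as [e He]; simpl. apply Rmin_pos; [lra|].
  assert (0 < Cmod (f a) * Cmod (f a))%R by nra. nra. }
destruct (Hf (mkposreal _ He)) as [d H]. exists d. intros x Hx. specialize (H x Hx). simpl in H.
assert (H1 := Rlt_le_trans _ _ _ H (Rmin_l _ _)).
assert (H2 := Rlt_le_trans _ _ _ H (Rmin_r _ _)).
assert (Hx1 : (Cmod (f a) / 2 < Cmod (f x))%R).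
{ pose proof (Cmod_triangle (f x) (- (f x - f a))) as T.
  replace (f x + - (f x - f a)) with (f a) in T by ring. rewrite Cmod_opp in T. lra. }
assert (Hx0 : f x <> 0) by (apply (proj2 (Cmod_gt_0 _)); lra).
replace (/ f x - / f a) with (- (f x - f a) / (f x * f a)) by (field; auto).
rewrite Cmod_div, Cmod_opp, Cmod_mult by (now apply Cmult_neq_0).
apply Rlt_div_l; [nra|].
destruct eps as [e He']; simpl in *.
assert (Cmod (f a) / 2 * Cmod (f a) <= Cmod (f x) * Cmod (f a))%R by nra. nra.
Qed.

Lemma Ccont_pochhammer f a n : Ccont f a -> Ccont (fun x => pochhammer (f x) n) a.
Proof.
intros Hf. induction n as [|n IH]; simpl.
- apply Ccont_const.
- apply Ccont_mult; [exact IH|]. apply Ccont_plus; [exact Hf | apply Ccont_const].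
Qed.

Lemma Ccont_strange_term a n :
  ~ nonpos_int (a + 1 / 4) -> ~ nonpos_int (a + 3 / 4) -> Ccont (fun x => strange_term x n) a.
Proof.
intros h1 h2. unfold strange_term, hyp3F2_term, Cdiv.
assert (Hx := Ccont_id a).
repeat first [apply Ccont_const | exact Hx | apply Ccont_pochhammer | apply Ccont_mult
  | apply Ccont_plus | apply Ccont_inv].
apply Cmult_neq_0; now apply pochhammer_neq_0.
Qed.

Lemma Ccont_strange_partial_sum a m :
  ~ nonpos_int (a + 1 / 4) -> ~ nonpos_int (a + 3 / 4) ->
  Ccont (fun x => Csum_n (strange_term x) m) a.
Proof.
intros h1 h2. induction m as [|m IH]; intros eps.
- destruct (Ccont_strange_term a 0 h1 h2 eps) as [d H]. exists d. intros x Hx.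
  rewrite !sum_n_C_0. now apply H.
- destruct (Ccont_plus _ _ _ IH (Ccont_strange_term a (S m) h1 h2) eps) as [d H].
  exists d. intros x Hx. rewrite !sum_n_C_S. now apply H.
Qed.

(** The constant is (7/8) / (1 - 7/8) = 7. Subtracting 7 |u (k + m)| from the bound on partial sums
    makes the induction go through. *)
Lemma geometric_tail (u : nat -> C) l m :
  (forall n, (m <= n)%nat -> (Cmod (u (S n)) <= 7 / 8 * Cmod (u n))%R) ->
  Clim (Csum_n u) l ->
  (Cmod (l - Csum_n u m) <= 7 * Cmod (u m))%R.
Proof.
intros H Hl.
assert (B : forall k, (Cmod (Csum_n u (k + m)%nat - Csum_n u m)
   <= 7 * Cmod (u m) - 7 * Cmod (u (k + m)%nat))%R).
{ induction k as [|k IH].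
  - simpl (0 + m)%nat. replace (Csum_n u m - Csum_n u m) with (RtoC 0) by ring.
    rewrite Cmod_0; lra.
  - simpl (S k + m)%nat. rewrite sum_n_C_S.
    specialize (H (k + m)%nat ltac:(lia)).
    match goal with |- (Cmod (?s + ?t - ?w) <= _)%R =>
      pose proof (Cmod_triangle (s - w) t) as T; replace (s - w + t) with (s + t - w) in T by ring end.
    lra. }
set (s := Csum_n u) in *.
assert (HL : is_lim_seq (fun k => Cmod (s (k + m)%nat - l) + 7 * Cmod (u m))%R (0 + 7 * Cmod (u m))%R).
{ apply is_lim_seq_plus'; [|apply is_lim_seq_const].
  apply (is_lim_seq_incr_n (fun n => Cmod (s n - l)) m), Hl. }
rewrite Rplus_0_l in HL.
apply (is_lim_seq_le (fun _ => Cmod (l - s m)) _ (Cmod (l - s m)) (7 * Cmod (u m))%R) in HL;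
  [exact HL| |apply is_lim_seq_const].
intros k. specialize (B k). pose proof (Cmod_ge_0 (u (k + m)%nat)).
pose proof (Cmod_triangle (- (s (k + m)%nat - l)) (s (k + m)%nat - s m)) as T.
replace (- (s (k + m)%nat - l) + (s (k + m)%nat - s m)) with (l - s m) in T by ring.
rewrite Cmod_opp in T. lra.
Qed.

(** The integers -k with k >= |z| + 1 are at distance at least 1 from z, and the finitely many
    others are avoided one by one. The point z may itself be one of them, whence the puncture. *)
Lemma not_nonpos_int_near z : exists d : posreal, forall x, x <> z -> (Cmod (x - z) < d)%R -> ~ nonpos_int x.
Proof.
assert (H : forall K : nat, exists d : posreal, forall x, x <> z -> (Cmod (x - z) < d)%R ->
   forall k, (k < K)%nat -> x <> - INR k).
{ induction K as [|K [d Hd]].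
  - exists (mkposreal 1 Rlt_0_1). intros; lia.
  - destruct (Req_dec (Cmod (- INR K - z)) 0) as [E|E].
    + exists d. intros x Hx Hxd k Hk. destruct (Nat.eq_dec k K) as [->|Hne]; [|apply Hd; auto; lia].
      intros E'. apply Hx. rewrite E'. apply Cmod_eq_0 in E.
      now apply Ceq_minus.
    + assert (P : (0 < Cmod (- INR K - z))%R) by (pose proof (Cmod_ge_0 (- INR K - z)); lra).
      exists (mkposreal _ (Rmin_stable_in_posreal d (mkposreal _ P))). simpl.
      intros x Hx Hxd k Hk. destruct (Nat.eq_dec k K) as [->|Hne].
      * intros E'. subst x. pose proof (Rmin_r d (Cmod (- INR K - z))). lra.
      * apply Hd; auto; [|lia]. pose proof (Rmin_l d (Cmod (- INR K - z))). lra. }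
destruct (ex_nat_ge (Cmod z + 1)) as [K HK].
destruct (H K) as [d Hd].
exists (mkposreal _ (Rmin_stable_in_posreal d (mkposreal _ Rlt_0_1))). simpl.
intros x Hx Hxd [k E].
destruct (Nat.lt_ge_cases k K) as [Hk|Hk].
- apply (Hd x Hx) with k; auto. pose proof (Rmin_l d 1). lra.
- specialize (HK k Hk). pose proof (Rmin_r d 1).
  destruct (Cmod_plus_INR_bounds z (Cmod z) k) as [B _]; [lra|].
  rewrite E in Hxd. replace (- INR k - z) with (- (z + INR k)) in Hxd by ring.
  rewrite Cmod_opp in Hxd. lra.
Qed.

Lemma affine_not_nonpos_int_near (al be a : C) : al <> 0 ->
  exists d : posreal, forall x, x <> a -> (Cmod (x - a) < d)%R -> ~ nonpos_int (al * x + be).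
Proof.
intros Hal. destruct (not_nonpos_int_near (al * a + be)) as [d Hd].
assert (P : (0 < Cmod al)%R) by exact (proj1 (Cmod_gt_0 _) Hal).
assert (D : (0 < d / Cmod al)%R) by (apply Rdiv_lt_0_compat; [apply cond_pos | auto]).
exists (mkposreal _ D). simpl. intros x Hx Hxd. apply Hd.
- intros E. apply Hx. apply Ceq_minus.
  transitivity (((al * x + be) - (al * a + be)) / al); [field; auto|]. rewrite E. field. auto.
- replace (al * x + be - (al * a + be)) with (al * (x - a)) by ring.
  rewrite Cmod_mult, Rmult_comm. apply Rlt_div_r in Hxd; auto.
Qed.

Definition punctured_near (a : C) (P : C -> Prop) : Prop :=
  exists d : posreal, forall x, x <> a -> (Cmod (x - a) < d)%R -> P x.

Lemma punctured_near_and a (P Q : C -> Prop) :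
  punctured_near a P -> punctured_near a Q -> punctured_near a (fun x => P x /\ Q x).
Proof.
intros [d1 H1] [d2 H2]. exists (mkposreal _ (Rmin_stable_in_posreal d1 d2)). simpl.
intros x Hx Hd. pose proof (Rmin_l d1 d2). pose proof (Rmin_r d1 d2).
split; [apply H1 | apply H2]; auto; lra.
Qed.

Lemma punctured_near_impl a (P Q : C -> Prop) :
  (forall x, P x -> Q x) -> punctured_near a P -> punctured_near a Q.
Proof. intros H [d Hd]. exists d. auto. Qed.

Lemma punctured_near_affine (al be a : C) (f : C -> C) : al <> 0 ->
  (forall x, f x = al * x + be) -> punctured_near a (fun x => ~ nonpos_int (f x)).
Proof.
intros Hal Hf. destruct (affine_not_nonpos_int_near al be a Hal) as [d Hd].
exists d. intros x Hx Hxd. rewrite Hf. now apply Hd.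
Qed.

Lemma RtoC_ratio_neq_0 p q : (p <> 0)%R -> (q <> 0)%R -> RtoC p / q <> 0.
Proof.
intros Hp Hq. rewrite <- RtoC_div by auto. apply RtoC_neq_0.
unfold Rdiv. apply Rmult_integral_contrapositive_currified; [auto | now apply Rinv_neq_0_compat].
Qed.

Lemma admissible_near a :
  punctured_near a (fun x => ~ nonpos_int (x + 1 / 4) /\ ~ nonpos_int (x + 3 / 4)).
Proof.
apply punctured_near_and.
- apply (punctured_near_affine 1 (1 / 4)); [exact C1_nz | intros; ring].
- apply (punctured_near_affine 1 (3 / 4)); [exact C1_nz | intros; ring].
Qed.

Lemma closed_form_regular_near a : punctured_near a closed_form_regular.
Proof.
assert (Hc1 : punctured_near a (fun x => Ccos (2 * PI * x / 3) <> 0)).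
{ apply punctured_near_impl with (fun x => ~ nonpos_int (1 / 2 + 2 * x / 3) /\ ~ nonpos_int (1 / 2 - 2 * x / 3)).
  - intros x [H1 H2]. replace (2 * PI * x / 3) with (PI * (2 * x / 3)) by field. now apply Ccos_neq_0.
  - apply punctured_near_and.
    + apply (punctured_near_affine (2 / 3) (1 / 2)); [apply RtoC_ratio_neq_0; lra | intros; field].
    + apply (punctured_near_affine (- 2 / 3) (1 / 2)); [|intros; field].
      apply RtoC_ratio_neq_0; lra. }
assert (Hc2 : punctured_near a (fun x => Ccos (PI * (1 + 2 * x) / 3) <> 0)).
{ apply punctured_near_impl with
    (fun x => ~ nonpos_int (1 / 2 + (1 + 2 * x) / 3) /\ ~ nonpos_int (1 / 2 - (1 + 2 * x) / 3)).
  - intros x [H1 H2]. replace (PI * (1 + 2 * x) / 3) with (PI * ((1 + 2 * x) / 3)) by field.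
    now apply Ccos_neq_0.
  - apply punctured_near_and.
    + apply (punctured_near_affine (2 / 3) (5 / 6)); [apply RtoC_ratio_neq_0; lra | intros; field].
    + apply (punctured_near_affine (- 2 / 3) (1 / 6)); [|intros; field].
      apply RtoC_ratio_neq_0; lra. }
unfold closed_form_regular.
repeat apply punctured_near_and; auto.
- apply (punctured_near_affine (- 4 / 6) (5 / 6)); [|intros; field].
  apply RtoC_ratio_neq_0; lra.
- apply (punctured_near_affine (2 / 6) (1 / 6)); [apply RtoC_ratio_neq_0; lra | intros; field].
- apply (punctured_near_affine (1 / 3) 1); [apply RtoC_ratio_neq_0; lra | intros; field].
- apply (punctured_near_affine (- 2) (1 / 2)); [|intros; field].
  apply RtoC_neq_0; lra.
- apply (punctured_near_affine 2 1); [apply RtoC_neq_0; lra | intros; ring].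
Qed.

(** Partial sums are continuous and the tails are uniformly small: for |x - a| < 1 all five
    parameters are bounded by [M], so the geometric decay starts at the same index [n0] for every
    such admissible x. *)
Lemma Ccont_strange_sum a :
  ~ nonpos_int (a + 1 / 4) -> ~ nonpos_int (a + 3 / 4) -> Ccont strange_sum a.
Proof.
intros h1 h2 eps.
destruct (admissible_near a) as [d0 Hd0].
assert (Hadm : forall x, (Cmod (x - a) < d0)%R -> ~ nonpos_int (x + 1 / 4) /\ ~ nonpos_int (x + 3 / 4)).
{ intros x Hx. destruct (Req_dec (Cmod (x - a)) 0) as [E|E].
  - apply Cmod_eq_0 in E. apply Ceq_minus in E. subst x. auto.
  - apply Hd0; auto. intros ->. apply E. replace (a - a) with (RtoC 0) by ring. apply Cmod_0. }
set (M := (Cmod a + 3)%R).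
destruct (ex_nat_ge (200 * (M + 1))) as [n0 Hn0].
assert (Hratio : forall x, (Cmod (x - a) < d0)%R -> (Cmod (x - a) < 1)%R ->
  forall n, (n0 <= n)%nat -> (Cmod (strange_term x (S n)) <= 7 / 8 * Cmod (strange_term x n))%R).
{ intros x Hx Hx1 n Hn. destruct (Hadm x Hx) as [A1 A2].
  assert (Hxm : (Cmod x <= Cmod a + 1)%R).
  { pose proof (Cmod_triangle (x - a) a) as T. replace (x - a + a) with x in T by ring. lra. }
  assert (Hs : forall q : R, (0 <= q <= 1)%R -> (Cmod (x + q) <= M)%R).
  { intros q Hq. eapply Rle_trans; [apply Cmod_triangle|]. rewrite Cmod_R, Rabs_pos_eq; unfold M; lra. }
  assert (Q1 := Hs (1 / 2)%R ltac:(lra)). assert (Q2 := Hs (1 / 4)%R ltac:(lra)).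
  assert (Q3 := Hs (3 / 4)%R ltac:(lra)). rewrite RtoC_div in Q1, Q2, Q3 by lra.
  apply hyp3F2_term_ratio_le with M; auto.
  - unfold M; lra.
  - replace ((4 * x + 1) / 6) with ((2 / 3)%R * x + (1 / 6)%R) by (rewrite !RtoC_div by lra; field).
    eapply Rle_trans; [apply Cmod_triangle|]. rewrite Cmod_mult, !Cmod_R, !Rabs_pos_eq by lra.
    unfold M. pose proof (Cmod_ge_0 x). lra. }
set (B := (Cmod (strange_term a n0) + 1)%R).
assert (HB : (0 < B)%R) by (unfold B; pose proof (Cmod_ge_0 (strange_term a n0)); lra).
assert (Heps := cond_pos eps).
(* The tail from n0 + k on is at most 7 B (7/8)^k, and 21 = 7 times 3 brings it below eps/3. *)
assert (Hy : (0 < eps / (21 * B))%R) by (apply Rdiv_lt_0_compat; lra).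
destruct (pow_lt_1_zero (7 / 8)%R ltac:(rewrite Rabs_pos_eq; lra) _ Hy) as [k Hk].
specialize (Hk k (le_n _)). rewrite Rabs_pos_eq in Hk by (apply pow_le; lra).
apply Rlt_div_r in Hk; [|lra].
set (m := (n0 + k)%nat).
assert (He3 : (0 < eps / 3)%R) by lra.
destruct (Ccont_strange_partial_sum a m h1 h2 (mkposreal _ He3)) as [d1 H1]. simpl in H1.
destruct (Ccont_strange_term a n0 h1 h2 (mkposreal 1 Rlt_0_1)) as [d2 H2]. simpl in H2.
assert (Hd : (0 < Rmin (Rmin d0 1) (Rmin d1 d2))%R).
{ repeat apply Rmin_pos; try apply cond_pos; lra. }
assert (Htail : forall x, (Cmod (x - a) < Rmin (Rmin d0 1) (Rmin d1 d2))%R ->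
  (Cmod (strange_sum x - Csum_n (strange_term x) m) < eps / 3)%R).
{ intros x Hx.
  assert (L1 := Rmin_l (Rmin d0 1) (Rmin d1 d2)). assert (L2 := Rmin_r (Rmin d0 1) (Rmin d1 d2)).
  assert (L3 := Rmin_l d0 1). assert (L4 := Rmin_r d0 1). assert (L6 := Rmin_r d1 d2).
  destruct (Hadm x ltac:(lra)) as [A1 A2].
  assert (HR := Hratio x ltac:(lra) ltac:(lra)).
  eapply Rle_lt_trans.
  { apply geometric_tail; [|now apply strange_sum_is_series].
    intros n Hn. apply HR. unfold m in Hn. lia. }
  assert (G := ratio_geometric (fun n => Cmod (strange_term x n)) (7 / 8) n0 ltac:(lra) HR k).
  cbv beta in G. fold m in G.
  assert (HT : (Cmod (strange_term x n0) <= B)%R).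
  { specialize (H2 x ltac:(lra)). unfold B.
    pose proof (Cmod_triangle (strange_term x n0 - strange_term a n0) (strange_term a n0)) as T.
    replace (strange_term x n0 - strange_term a n0 + strange_term a n0) with (strange_term x n0) in T by ring.
    lra. }
  assert (0 <= (7 / 8) ^ k)%R by (apply pow_le; lra). nra. }
exists (mkposreal _ Hd). simpl. intros x Hx.
assert (Ha : (Cmod (a - a) < Rmin (Rmin d0 1) (Rmin d1 d2))%R).
{ replace (a - a) with (RtoC 0) by ring. now rewrite Cmod_0. }
assert (T1 := Htail x Hx). assert (T2 := Htail a Ha).
assert (T3 : (Cmod (Csum_n (strange_term x) m -
   Csum_n (strange_term a) m) < eps / 3)%R).
{ apply H1. assert (L2 := Rmin_r (Rmin d0 1) (Rmin d1 d2)). assert (L5 := Rmin_l d1 d2). lra. }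
set (sx := Csum_n (strange_term x) m) in *.
set (sa := Csum_n (strange_term a) m) in *.
replace (strange_sum x - strange_sum a) with
  ((strange_sum x - sx) + (sx - sa) + - (strange_sum a - sa)) by ring.
eapply Rle_lt_trans.
{ eapply Rle_trans; [apply Cmod_triangle|]. apply Rplus_le_compat_r, Cmod_triangle. }
rewrite Cmod_opp. lra.
Qed.

Theorem mainTheorem5 (a : C)
  (h1 : ~ nonpos_int (a + 1 / 4)) (h2 : ~ nonpos_int (a + 3 / 4)) :
  @ex_series C_AbsRing C_NormedModule
    (hyp3F2_term a (a + 1 / 2) ((4 * a + 1) / 6) (a + 1 / 4) (a + 3 / 4) (3 / 4)) /\
  value_by_continuity closed_form_regular closed_form a
    (hyp3F2 a (a + 1 / 2) ((4 * a + 1) / 6) (a + 1 / 4) (a + 3 / 4) (3 / 4)).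
Proof.
split.
{ eexists. now apply is_series_hyp3F2. }
change (value_by_continuity closed_form_regular closed_form a (strange_sum a)).
split.
{ intros HD. symmetry. now apply closed_form_strange_sum. }
intros _ P [eps HP].
destruct (Ccont_strange_sum a h1 h2 eps) as [d1 H1].
destruct (punctured_near_and _ _ _ (admissible_near a) (closed_form_regular_near a)) as [d2 H2].
(* Again [sqrt 2] passes from the boxes of [C_UniformSpace] to discs. *)
assert (Hd : (0 < Rmin d1 d2 / sqrt 2)%R).
{ apply Rdiv_lt_0_compat; [apply Rmin_stable_in_posreal | apply sqrt_lt_R0; lra]. }
exists (mkposreal _ Hd). intros x Hx Hxa.
apply C_NormedModule_mixin_compat2 in Hx. simpl in Hx.
replace (sqrt 2 * (Rmin d1 d2 / sqrt 2))%R with (Rmin d1 d2) in Hx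
  by (field; apply Rgt_not_eq, sqrt_lt_R0; lra).
change (Cmod (x - a) < Rmin d1 d2)%R in Hx.
apply HP.
destruct (H2 x Hxa (Rlt_le_trans _ _ _ Hx (Rmin_r _ _))) as [[A1 A2] A3].
rewrite closed_form_strange_sum by assumption.
apply C_NormedModule_mixin_compat1, H1, (Rlt_le_trans _ _ _ Hx (Rmin_l _ _)).
Qed.
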